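(* Assume the network assumption, the stochastic gradient assumption, the unbiased compressor assumption (with parameter $C>0$), the $\mu$-strong convexity assumption on $f$ and the smoothness assumption (with constant $L$) stated in the context, and let $x^*$ be the minimizer of $f$ and $\kappa=L/\mu$. Run CEDAS with stepsizes $\eta_k=\frac{\theta}{\mu(k+m)}$, where $$\theta\ge20,\quad m\ge\frac{48\theta\kappa}{\gamma(1-\lambda_2)},\quad\alpha\le\frac{1}{4(C+1)},\quad\gamma\le\min\left\{\frac12,\frac{\alpha^2(1-\lambda_2)}{15876\,C},\frac{\alpha}{2}\right\}.$$ Then for all $k\ge0$, $$\begin{aligned}\frac1n\sum_{i=1}^n\mathbb{E}\left[\|x_{i,k}-x^*\|^2\right]\le{}&\left(1-\frac{1-\tilde\lambda_2}{6}\right)^k\frac{2\,\mathbb{E}\mathcal{L}_0^b}{n}+\frac{8L\theta\sigma^2}{n\mu^3(k+m)}+\frac{48\theta^2(14\kappa^2+3)\sigma^2}{\mu^2(1-\tilde\lambda_2)(k+m)^2}\\&+\frac{96\theta^2(32\kappa^2+9)\sum_{i=1}^n\|\nabla f_i(x^* )\|^2}{n\mu^2(1-\tilde\lambda_2)^3(k+m)^4}+\frac{70m^{\theta/2}\,\mathbb{E}\mathcal{L}_0^v}{\mu(k+m)^{\theta/2}}\\&+\frac{456\theta^3\kappa^2\sigma^2}{n\mu^2(1-\tilde\lambda_2)(k+m)^3}+\frac{96768\theta^4\kappa^3\sigma^2}{\mu^2(1-\tilde\lambda_2)^2(k+m)^4}.\end{aligned}$$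
   Context: Notation. There are $n\ge2$ agents; $f_i:\mathbb{R}^p\to\mathbb{R}$ is differentiable, $f=\frac1n\sum_{i=1}^nf_i$, and $f^{\inf}=\inf_{x\in\mathbb{R}^p}f(x)$ (equal to $f(x^* )$ here). For $\mathbf{x}\in\mathbb{R}^{n\times p}$ with $i$-th row $x_i^\top$, $\bar x=\frac1n\sum_ix_i$, and $\nabla F(\mathbf{x})\in\mathbb{R}^{n\times p}$ has $i$-th row $\nabla f_i(x_i)^\top$. $\mathbf{1}\in\mathbb{R}^n$ is the all-ones vector. $\|\cdot\|$ is the Euclidean norm of vectors and the Frobenius norm of matrices; $\|\cdot\|_2$ is the spectral norm. Network assumption. The communication graph on the agents is undirected and connected; $W=(w_{ij})\in\mathbb{R}^{n\times n}$ is symmetric, entrywise nonnegative, positive semidefinite, $W\mathbf{1}=\mathbf{1}$, and for $i\ne j$ one has $w_{ij}=w_{ji}>0$ if $i,j$ are linked and $w_{ij}=w_{ji}=0$ otherwise. Its eigenvalues are $1=\lambda_1>\lambda_2\ge\cdots\ge\lambda_n\ge0$. CEDAS. Given stepsizes $\eta_k>0$ ($k\ge-1$), parameters $\alpha,\gamma>0$, a (possibly random) compression operator $\mathcal{C}:\mathbb{R}^p\to\mathbb{R}^p$ applied row by row, and deterministic $\mathbf{x}_{-1},H_0\in\mathbb{R}^{n\times p}$, set $D_0=0$, $\mathbf{x}_0=\mathbf{x}_{-1}-\eta_{-1}G_{-1}$, and for $k\ge0$: $\mathbf{y}_k=\mathbf{x}_k-\eta_kG_k-D_k$; $Q_k=\mathcal{C}(\mathbf{y}_k-H_k)$;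 $D_{k+1}=D_k+\frac\gamma2(I-W)(H_k+Q_k)$; $H_{k+1}=H_k+\alpha Q_k$; $\mathbf{x}_{k+1}=\mathbf{x}_k-\eta_kG_k-D_{k+1}$. Here $G_k$ has rows $g_{i,k}^\top$ with $g_{i,k}=\nabla f_i(x_{i,k};\xi_{i,k})$ the stochastic gradient, and $x_{i,k}^\top$ is the $i$-th row of $\mathbf{x}_k$. Stochastic gradient assumption. For all $k\ge-1$, conditionally on all randomness generated before the samples $\xi_{1,k},\dots,\xi_{n,k}$ are drawn, these samples are independent across $i$, $g_{i,k}$ has mean $\nabla f_i(x_{i,k})$, and $\|g_{i,k}-\nabla f_i(x_{i,k})\|^2$ has expectation at most $\sigma^2$ ($\sigma>0$). Unbiased compressor assumption. $\mathbb{E}[\mathcal{C}(x)\mid x]=x$ and $\mathbb{E}[\|\mathcal{C}(x)-x\|^2\mid x]\le C\|x\|^2$ for all $x\in\mathbb{R}^p$, with $C>0$; at each use these hold conditionally on all randomness preceding the compression. Strong convexity assumption. $\langle\nabla f(x)-\nabla f(x'),x-x'\rangle\ge\mu\|x-x'\|^2$ for all $x,x'$, with $\mu>0$. Smoothness assumption. Each $\nabla f_i$ is $L$-Lipschitz. Derived quantities. $\tilde W=I-\frac\gamma2(I-W)$ has eigenvalues $\tilde\lambda_i=1-\frac\gamma2(1-\lambda_i)$; $\tilde\Lambda_1=\mathrm{diag}(\tilde\lambda_2,\dots,\tilde\lambda_n)$; $Q_1\in\mathbb{R}^{n\times(n-1)}$ has orthonormal columns with $W=\frac{\mathbf{1}\mathbf{1}^\top}{n}+Q_1\,\mathrm{diag}(\lambda_2,\dots,\lambda_n)Q_1^\top$.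 Let $B=\begin{pmatrix}\tilde\Lambda_1&-\tilde\Lambda_1\sqrt{I-\tilde\Lambda_1}\\ \sqrt{I-\tilde\Lambda_1}&\tilde\Lambda_1\end{pmatrix}$ and fix a decomposition $B=JP_1J^{-1}$ with $\|J\|_2\le\sqrt2$, $\|J^{-1}\|_2\le1/\sqrt{2\tilde\lambda_n}$, $\|P_1\|_2^2\le\tilde\lambda_2$, $\|P_1-I\|_2^2=\gamma(1-\lambda_n)/2$ (such a decomposition exists); write $J^{-1}=(J_{L,l}\;\;J_{L,r})$ with $J_{L,l},J_{L,r}\in\mathbb{R}^{2(n-1)\times(n-1)}$. Put $\hat{\mathbf{r}}_k=D_k+\eta_k\nabla F(\mathbf{1}\bar x_k^\top)$ and $\check h_k=J_{L,l}Q_1^\top\mathbf{x}_k+J_{L,r}(I-\tilde\Lambda_1)^{-1/2}Q_1^\top\hat{\mathbf{r}}_k$. Lyapunov functions: $$\mathcal{L}_k^v=f(\bar x_k)-f^{\inf}+\frac{8L^2}{n(1-\tilde\lambda_2)}\eta_k\|\check h_k\|^2+\frac{64\gamma CL^2}{n\alpha(1-\tilde\lambda_2)}\eta_k\|\mathbf{y}_k-H_k\|^2,\qquad\mathcal{L}_k^b=\|\check h_k\|^2+\frac{8\gamma C}{\alpha}\|\mathbf{y}_k-H_k\|^2.$$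
   Formalization: The columns of Q_1 are additionally required to be orthogonal to the all-ones vector; when λ_n = 0 the stated decomposition of W does not force this, and the bound can then fail (e.g. n = 2, W = 11ᵀ/2, Q_1 = 1/√2). *)

(* Defs.v *)
From HB Require Import structures.
From mathcomp Require Import all_boot all_order all_algebra.
From mathcomp Require Import all_classical all_reals all_analysis.

Set Implicit Arguments.
Unset Strict Implicit.
Unset Printing Implicit Defensive.

Import Order.TTheory GRing.Theory Num.Theory.
Import numFieldNormedType.Exports.

Local Open Scope classical_set_scope.
Local Open Scope ring_scope.

Section LinearAlgebra.
Context {R : realType}.

(* Frobenius norm; on a row or column vector it is the Euclidean norm.  The
   library norm `|A| on matrices is the sup norm and is only used for the
   topology. *)
Definition fnorm m n (A : 'M[R]_(m, n)) : R :=
  Num.sqrt (\sum_i \sum_j A i j ^+ 2).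

Definition dotr p (u v : 'rV[R]_p) : R := \sum_j u 0 j * v 0 j.

Definition specnorm m n (A : 'M[R]_(m, n)) : R :=
  sup [set fnorm (A *m v) | v in [set v : 'cV[R]_n | fnorm v <= 1]].

Definition psd n (A : 'M[R]_n) : Prop :=
  forall v : 'cV[R]_n, 0 <= (v^T *m A *m v) 0 0.

(* lambda 1 >= ... >= lambda n are the eigenvalues of A counted with
   multiplicity; indices start at 1, other values of lambda are irrelevant. *)
Definition ordered_spectrum n (A : 'M[R]_n) (lambda : nat -> R) : Prop :=
  char_poly A = \prod_(1 <= i < n.+1) ('X - (lambda i)%:P) /\
  forall i j : nat, (1 <= i)%N -> (i <= j)%N -> (j <= n)%N ->
    lambda j <= lambda i.

Definition ones n : 'cV[R]_n := const_mx 1.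

(* diag (s_2, ..., s_n) for a sequence s indexed from 1 *)
Definition diag_from2 n (s : nat -> R) : 'M[R]_n.-1 :=
  diag_mx (\row_(i < n.-1) s i.+2).

Record eigenbasis n (W : 'M[R]_n) (lambda : nat -> R)
    (Q1 : 'M[R]_(n, n.-1)) : Prop := {
  eigenbasis_orthonormal : Q1^T *m Q1 = 1%:M;
  (* Implied by the decomposition when lambda n > 0; if 0 is an eigenvalue of
     W the decomposition alone would not force it. *)
  eigenbasis_orth_ones : Q1^T *m ones n = 0;
  eigenbasis_decomp :
    W = n%:R^-1 *: (ones n *m (ones n)^T)
        + Q1 *m diag_from2 n lambda *m Q1^T
}.

End LinearAlgebra.

Section Calculus.
Context {R : realType} {p : nat}.

Definition grad (f : 'rV[R]_p -> R) (x : 'rV[R]_p) : 'rV[R]_p :=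
  \row_j 'D_(delta_mx 0 j) f x.

Definition lipschitz_grad (L : R) (f : 'rV[R]_p -> R) : Prop :=
  forall x x' : 'rV[R]_p, fnorm (grad f x - grad f x') <= L * fnorm (x - x').

Definition strongly_convex (mu : R) (f : 'rV[R]_p -> R) : Prop :=
  forall x x' : 'rV[R]_p,
    mu * fnorm (x - x') ^+ 2 <= dotr (grad f x - grad f x') (x - x').

Definition favg n (f : 'I_n -> 'rV[R]_p -> R) (x : 'rV[R]_p) : R :=
  n%:R^-1 * \sum_i f i x.

Definition gradF n (f : 'I_n -> 'rV[R]_p -> R) (x : 'M[R]_(n, p)) :
    'M[R]_(n, p) :=
  \matrix_(i < n) grad (f i) (row i x).

Definition rowmean n (x : 'M[R]_(n, p)) : 'rV[R]_p :=
  n%:R^-1 *: \sum_i row i x.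

End Calculus.

Record network {R : realType} n (e : rel 'I_n) (W : 'M[R]_n) : Prop := {
  net_sym : symmetric e;
  net_irrefl : irreflexive e;
  net_connected : forall i j, connect e i j;
  net_Wsym : W^T = W;
  net_Wge0 : forall i j, 0 <= W i j;
  net_Wpsd : psd W;
  net_Wones : W *m ones n = ones n;
  net_link : forall i j, i != j -> e i j -> 0 < W i j;
  net_nolink : forall i j, i != j -> ~~ e i j -> W i j = 0
}.

Section ConditionalExpectation.
Context {d : measure_display} {T : measurableType d} {R : realType}.
Variable P : probability T R.

(* Y is a version of E[X | F], for F a sub-sigma-algebra of the measurable
   sets of T. *)
Record is_cexp (F : set_system T) (X Y : T -> R) : Prop := {
  cexp_integrable_arg : P.-integrable setT (EFin \o X);
  cexp_integrable : P.-integrable setT (EFin \o Y);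
  cexp_measurable : forall B : set R, measurable B -> F (Y @^-1` B);
  cexp_integral : forall A : set T, F A ->
    (\int[P]_(w in A) (Y w)%:E = \int[P]_(w in A) (X w)%:E)%E
}.

(* Product rule for conditional probabilities.  It is only stated for the whole
   family; subfamilies are obtained with A i = setT. *)
Definition cond_independent {dS : measure_display} {S : measurableType dS}
    (F : set_system T) n (X : 'I_n -> T -> S) : Prop :=
  forall A : 'I_n -> set S, (forall i, measurable (A i)) ->
  exists q : 'I_n -> T -> R,
    (forall i, is_cexp F (\1_(X i @^-1` A i)) (q i)) /\
    is_cexp F (\1_(\bigcap_i (X i @^-1` A i))) (fun w => \prod_i q i w).

End ConditionalExpectation.

(* R^p with its Borel sigma-algebra *)
Definition borel (R : realType) (p : nat) :=
  g_sigma_algebraType (@open 'rV[R]_p).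

(* The stochastic gradient of agent i at x for the sample s is g i x s; the
   random compression operator applied to x with internal randomness z is
   cmp x z.  Agent i draws the sample xi k i in round k >= -1 and the
   compression randomness zeta k i in round k >= 0. *)
Section Randomness.
Context {d dS dZ : measure_display} {T : measurableType d}
  {Xi : measurableType dS} {Z : measurableType dZ}.
Variables (n : nat) (xi : int -> 'I_n -> T -> Xi) (zeta : nat -> 'I_n -> T -> Z).

Definition sample_events (k : int) : set_system T :=
  [set E | exists l : int, exists i : 'I_n, exists B : set Xi,
    [/\ -1 <= l, l < k, measurable B & E = xi l i @^-1` B]].

Definition compression_events (k : int) : set_system T :=
  [set E | exists l : nat, exists i : 'I_n, exists B : set Z,
    [/\ l%:Z < k, measurable B & E = zeta l i @^-1` B]].

(* all randomness generated before the samples xi k _ are drawn; the initial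
   values being deterministic, nothing else is random *)
Definition history_sample (k : int) : set_system T :=
  <<s sample_events k `|` compression_events k >>.

(* all randomness generated before the compressions of round k *)
Definition history_compress (k : nat) : set_system T :=
  <<s sample_events (k%:Z + 1) `|` compression_events k >>.

End Randomness.

Section CEDAS.
Context {R : realType} {n p : nat}.
Context {d dS dZ : measure_display} {T : measurableType d}
  {Xi : measurableType dS} {Z : measurableType dZ}.

Record cedas (W : 'M[R]_n) (eta : int -> R) (alpha gamma : R)
    (g : 'I_n -> 'rV[R]_p -> Xi -> 'rV[R]_p) (cmp : 'rV[R]_p -> Z -> 'rV[R]_p)
    (x_init H_init : 'M[R]_(n, p))
    (xi : int -> 'I_n -> T -> Xi) (zeta : nat -> 'I_n -> T -> Z)
    (x G : int -> T -> 'M[R]_(n, p)) (y Q D H : nat -> T -> 'M[R]_(n, p)) :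
    Prop := {
  cedas_G : forall (k : int) w, -1 <= k ->
    G k w = \matrix_(i < n) g i (row i (x k w)) (xi k i w);
  cedas_xN1 : forall w, x (-1) w = x_init;
  cedas_H0 : forall w, H 0%N w = H_init;
  cedas_D0 : forall w, D 0%N w = 0;
  cedas_x0 : forall w, x 0 w = x (-1) w - eta (-1) *: G (-1) w;
  cedas_y : forall (k : nat) w,
    y k w = x k w - eta k *: G k w - D k w;
  cedas_Q : forall (k : nat) w,
    Q k w = \matrix_(i < n) cmp (row i (y k w - H k w)) (zeta k i w);
  cedas_D : forall (k : nat) w,
    D k.+1 w = D k w + (gamma / 2) *: ((1%:M - W) *m (H k w + Q k w));
  cedas_H : forall (k : nat) w, H k.+1 w = H k w + alpha *: Q k w;
  cedas_x : forall (k : nat) w,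
    x k.+1 w = x k w - eta k *: G k w - D k.+1 w
}.

Variable P : probability T R.

Record stochastic_gradient (sigma : R) (f : 'I_n -> 'rV[R]_p -> R)
    (g : 'I_n -> 'rV[R]_p -> Xi -> 'rV[R]_p)
    (xi : int -> 'I_n -> T -> Xi) (zeta : nat -> 'I_n -> T -> Z)
    (x G : int -> T -> 'M[R]_(n, p)) : Prop := {
  sg_measurable : forall i, measurable_fun setT
    (fun z : borel R p * Xi => (g i z.1 z.2 : borel R p));
  sg_independent : forall k : int, -1 <= k ->
    cond_independent P (history_sample xi zeta k) (xi k);
  sg_mean : forall (k : int) i j, -1 <= k ->
    is_cexp P (history_sample xi zeta k)
      (fun w => G k w i j) (fun w => grad (f i) (row i (x k w)) 0 j);
  sg_variance : forall (k : int) i, -1 <= k ->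
    exists V : T -> R,
      is_cexp P (history_sample xi zeta k)
        (fun w => fnorm (row i (G k w) - grad (f i) (row i (x k w))) ^+ 2) V /\
      {ae P, forall w, V w <= sigma ^+ 2}
}.

(* The first pair of moment conditions is for a fixed argument, the second for
   the argument actually compressed, conditionally on the past. *)
Record unbiased_compressor (C : R) (cmp : 'rV[R]_p -> Z -> 'rV[R]_p)
    (xi : int -> 'I_n -> T -> Xi) (zeta : nat -> 'I_n -> T -> Z)
    (y Q H : nat -> T -> 'M[R]_(n, p)) : Prop := {
  uc_measurable : measurable_fun setT
    (fun z : borel R p * Z => (cmp z.1 z.2 : borel R p));
  uc_mean_fixed : forall (k : nat) i (v : 'rV[R]_p) j,
    ('E_P[fun w => (cmp v (zeta k i w) 0 j)%R] = ((v 0 j)%R)%:E)%E;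
  uc_variance_fixed : forall (k : nat) i (v : 'rV[R]_p),
    ('E_P[fun w => (fnorm (cmp v (zeta k i w) - v) ^+ 2)%R]
       <= (C * fnorm v ^+ 2)%:E)%E;
  uc_mean : forall (k : nat) i j,
    is_cexp P (history_compress xi zeta k)
      (fun w => Q k w i j) (fun w => (y k w - H k w) i j);
  uc_variance : forall (k : nat) i,
    exists V : T -> R,
      is_cexp P (history_compress xi zeta k)
        (fun w => fnorm (row i (Q k w) - row i (y k w - H k w)) ^+ 2) V /\
      {ae P, forall w, V w <= C * fnorm (row i (y k w - H k w)) ^+ 2}
}.

End CEDAS.

Section Lyapunov.
Context {R : realType} {n p : nat}.

(* eigenvalues of I - (gamma / 2) (I - W) *)
Definition lambdat (gamma : R) (lambda : nat -> R) (i : nat) : R :=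
  1 - gamma / 2 * (1 - lambda i).

Definition Lambdat1 (gamma : R) (lambda : nat -> R) : 'M[R]_n.-1 :=
  diag_from2 n (lambdat gamma lambda).

Definition sqrt_I_Lambdat1 (gamma : R) (lambda : nat -> R) : 'M[R]_n.-1 :=
  diag_from2 n (fun i => Num.sqrt (1 - lambdat gamma lambda i)).

Definition Bmx (gamma : R) (lambda : nat -> R) : 'M[R]_(n.-1 + n.-1) :=
  block_mx (Lambdat1 gamma lambda)
           (- (Lambdat1 gamma lambda *m sqrt_I_Lambdat1 gamma lambda))
           (sqrt_I_Lambdat1 gamma lambda)
           (Lambdat1 gamma lambda).

Record decomposition (gamma : R) (lambda : nat -> R)
    (J P1 : 'M[R]_(n.-1 + n.-1)) : Prop := {
  dec_unit : J \in unitmx;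
  dec_eq : Bmx gamma lambda = J *m P1 *m invmx J;
  dec_J : specnorm J <= Num.sqrt 2;
  dec_Jinv : specnorm (invmx J) <= (Num.sqrt (2 * lambdat gamma lambda n))^-1;
  dec_P1 : specnorm P1 ^+ 2 <= lambdat gamma lambda 2%N;
  dec_P1_I : specnorm (P1 - 1%:M) ^+ 2 = gamma * (1 - lambda n) / 2
}.

Definition rhat (f : 'I_n -> 'rV[R]_p -> R) (etak : R)
    (xk Dk : 'M[R]_(n, p)) : 'M[R]_(n, p) :=
  Dk + etak *: gradF f (ones n *m rowmean xk).

Definition hcheck (f : 'I_n -> 'rV[R]_p -> R) (gamma : R) (lambda : nat -> R)
    (Q1 : 'M[R]_(n, n.-1)) (J : 'M[R]_(n.-1 + n.-1))
    (etak : R) (xk Dk : 'M[R]_(n, p)) : 'M[R]_(n.-1 + n.-1, p) :=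
  lsubmx (invmx J) *m Q1^T *m xk
  + rsubmx (invmx J)
      *m diag_from2 n (fun i => (Num.sqrt (1 - lambdat gamma lambda i))^-1)
      *m Q1^T *m rhat f etak xk Dk.

Definition lyap_v (f : 'I_n -> 'rV[R]_p -> R) (L C alpha gamma : R)
    (lambda : nat -> R) (Q1 : 'M[R]_(n, n.-1)) (J : 'M[R]_(n.-1 + n.-1))
    (etak : R) (xk yk Dk Hk : 'M[R]_(n, p)) : R :=
  favg f (rowmean xk) - inf (range (favg f))
  + 8 * L ^+ 2 / (n%:R * (1 - lambdat gamma lambda 2%N)) * etak
      * fnorm (hcheck f gamma lambda Q1 J etak xk Dk) ^+ 2
  + 64 * gamma * C * L ^+ 2 / (n%:R * alpha * (1 - lambdat gamma lambda 2%N))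
      * etak * fnorm (yk - Hk) ^+ 2.

Definition lyap_b (f : 'I_n -> 'rV[R]_p -> R) (C alpha gamma : R)
    (lambda : nat -> R) (Q1 : 'M[R]_(n, n.-1)) (J : 'M[R]_(n.-1 + n.-1))
    (etak : R) (xk yk Dk Hk : 'M[R]_(n, p)) : R :=
  fnorm (hcheck f gamma lambda Q1 J etak xk Dk) ^+ 2
  + 8 * gamma * C / alpha * fnorm (yk - Hk) ^+ 2.

End Lyapunov.

(* Main.v *)
Require Import Defs.
From HB Require Import structures.
From mathcomp Require Import all_boot all_order all_algebra finmap.
From mathcomp Require Import all_classical all_reals all_analysis.
From mathcomp Require Import measurable_realfun.
From mathcomp Require Import ring lra.

Set Implicit Arguments.
Unset Strict Implicit.
Unset Printing Implicit Defensive.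

Import Order.TTheory GRing.Theory Num.Theory.
Import numFieldNormedType.Exports HBSimple HBNNSimple.

Local Open Scope classical_set_scope.
Local Open Scope ring_scope.

(** The update of [D] has zero column means, so the mean of the agents performs a
    stochastic gradient descent: it moves by the average of the local gradients,
    perturbed by the average of the noises. By conditional independence of the
    samples the noises of distinct agents are uncorrelated
    ([cond_indep_orthogonal]), and the average has variance [sigma^2 / n]
    ([Ex_mean_gnoise]). The descent inequality then makes the mean suboptimality
    [gap] decrease, up to the consensus error of the agents ([gap_step]).

    The component of the iterates orthogonal to the constants, together with the
    rescaled dual residual, is multiplied in each round by the matrix [P1], which
    shrinks squared norms by the factor [1 - delta], where
    [delta = 1 - lambdat 2] ([hcheck_step], [sqn_P1_mul]). It is perturbed by the
    gradient noise and the compression error, both orthogonal in mean to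
    everything that precedes them, and by the change of a reference gradient; this
    gives [cons_step]. The error of the compressed reference points contracts by
    itself, and is driven by the dual residual ([comp_step]).

    All this uses conditional expectations only in one form: a random variable
    that has zero mean on every event of the past is orthogonal to what is
    measurable for the past ([Ex_pullout]).

    With the weight [8 gamma C / alpha] for the compression error, the sum [B] of
    the last two errors contracts by [1 - 0.46 delta], up to squared gradients
    with small coefficients and to the noise ([lyap_b_step]). Adding to [gap] a
    multiple of [eta B] of the order of [L^2 / (n delta)] absorbs the consensus
    error ([lyap_v_estimate]): up to source terms, the sum [V] contracts by
    [1 - eta mu / 2 = 1 - theta / (2 t)], where [t = k + m]. The products of these
    factors decay like [t^(- theta / 2)], and the sources, of the orders [t^-2],
    [t^-3] and [t^-5], contribute terms of the orders [t^-1], [t^-2] and [t^-4]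
    ([lyap_v_rate]). With this bound on [gap], the contraction of [B] turns into a
    rate as well ([lyap_b_rate]).
    Finally, the squared distance of the agents to the minimizer is at most
    [2 / mu] times [gap] plus [2 / n] times [B] ([dist_le]). *)

(** * Frobenius inner product and spectral norm *)

Lemma le_of_eq {R : numDomainType} (x y : R) : x = y -> x <= y.
Proof. by move=> ->. Qed.

Section FrobeniusInnerProduct.
Context {R : realType}.

Definition ip m n (A B : 'M[R]_(m, n)) : R := \sum_i \sum_j A i j * B i j.

Definition sqn m n (A : 'M[R]_(m, n)) : R := ip A A.

Lemma ip_trace m n (A B : 'M[R]_(m, n)) : ip A B = \tr (A^T *m B).
Proof.
rewrite /ip /mxtrace exchange_big; apply: eq_bigr => j _.
by rewrite mxE; apply: eq_bigr => i _; rewrite mxE.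
Qed.

Lemma ipC m n (A B : 'M[R]_(m, n)) : ip A B = ip B A.
Proof. by apply: eq_bigr => i _; apply: eq_bigr => j _; rewrite mulrC. Qed.

Lemma ipDl m n (A B D : 'M[R]_(m, n)) : ip (A + B) D = ip A D + ip B D.
Proof. by rewrite !ip_trace linearD mulmxDl linearD. Qed.

Lemma ipDr m n (A B D : 'M[R]_(m, n)) : ip D (A + B) = ip D A + ip D B.
Proof. by rewrite !ip_trace mulmxDr linearD. Qed.

Lemma ipZl m n a (A B : 'M[R]_(m, n)) : ip (a *: A) B = a * ip A B.
Proof. by rewrite !ip_trace linearZ -scalemxAl linearZ. Qed.

Lemma ipZr m n a (A B : 'M[R]_(m, n)) : ip A (a *: B) = a * ip A B.
Proof. by rewrite !ip_trace -scalemxAr linearZ. Qed.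

Lemma ip0l m n (A : 'M[R]_(m, n)) : ip 0 A = 0.
Proof. by rewrite -(scale0r 0) ipZl mul0r. Qed.

Lemma ip0r m n (A : 'M[R]_(m, n)) : ip A 0 = 0.
Proof. by rewrite ipC ip0l. Qed.

Lemma sqn0 m n : sqn (0 : 'M[R]_(m, n)) = 0.
Proof. exact: ip0l. Qed.

Lemma ipNl m n (A B : 'M[R]_(m, n)) : ip (- A) B = - ip A B.
Proof. by rewrite -scaleN1r ipZl mulN1r. Qed.

Lemma ipNr m n (A B : 'M[R]_(m, n)) : ip A (- B) = - ip A B.
Proof. by rewrite -scaleN1r ipZr mulN1r. Qed.

Definition ipE := (ipDl, ipDr, ipNl, ipNr, ipZl, ipZr).

Lemma ip_mull m n k (M : 'M[R]_(k, m)) (A : 'M[R]_(m, n)) B :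
  ip (M *m A) B = ip A (M^T *m B).
Proof. by rewrite !ip_trace trmx_mul mulmxA. Qed.

Lemma ip_mulr m n k (M : 'M[R]_(k, m)) (A : 'M[R]_(m, n)) B :
  ip B (M *m A) = ip (M^T *m B) A.
Proof. by rewrite ipC ip_mull ipC. Qed.

Lemma sqn_ge0 m n (A : 'M[R]_(m, n)) : 0 <= sqn A.
Proof. by apply: sumr_ge0 => i _; apply: sumr_ge0 => j _; rewrite -expr2 sqr_ge0. Qed.

Lemma sqr_entry_le m n (A : 'M[R]_(m, n)) i j : A i j ^+ 2 <= sqn A.
Proof.
rewrite /sqn /ip (bigD1 i) //= (bigD1 j) //= -expr2 -addrA lerDl addr_ge0 //.
  by apply: sumr_ge0 => k _; rewrite -expr2 sqr_ge0.
by apply: sumr_ge0 => k _; apply: sumr_ge0 => l _; rewrite -expr2 sqr_ge0.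
Qed.

Lemma norm_mul_le (a b s t : R) : a ^+ 2 <= s -> b ^+ 2 <= t -> `|a * b| <= s + t.
Proof. by move=> h1 h2; rewrite ler_norml; apply/andP; split; nra. Qed.

Lemma sqn0_eq0 m n (A : 'M[R]_(m, n)) : sqn A = 0 -> A = 0.
Proof.
move=> A0; apply/matrixP => i j; rewrite mxE; apply/eqP.
have H i' : 0 <= \sum_j A i' j * A i' j.
  by apply: sumr_ge0 => k _; rewrite -expr2 sqr_ge0.
move/eqP: A0; rewrite /sqn /ip psumr_eq0 // => /allP/(_ i).
rewrite mem_index_enum => /(_ isT) /=.
rewrite psumr_eq0 => [|k _]; last by rewrite -expr2 sqr_ge0.
move=> /allP/(_ j); rewrite mem_index_enum => /(_ isT) /=.
by rewrite mulf_eq0 orbb.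
Qed.

Lemma sqn_fnorm m n (A : 'M[R]_(m, n)) : fnorm A ^+ 2 = sqn A.
Proof.
rewrite /fnorm sqr_sqrtr; first by apply: eq_bigr => i _; apply: eq_bigr => j _.
by apply: sumr_ge0 => i _; apply: sumr_ge0 => j _; rewrite sqr_ge0.
Qed.

Lemma fnorm_sqn m n (A : 'M[R]_(m, n)) : fnorm A = Num.sqrt (sqn A).
Proof. by []. Qed.

Lemma sqn_le_fnorm m n k l (a : R) (A : 'M[R]_(m, n)) (B : 'M[R]_(k, l)) :
  fnorm A <= a * fnorm B -> sqn A <= a ^+ 2 * sqn B.
Proof.
rewrite -!sqn_fnorm -exprMn => h.
by rewrite ler_sqr ?nnegrE ?sqrtr_ge0 //; apply: le_trans h; apply: sqrtr_ge0.
Qed.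

Lemma dotr_ip p (u v : 'rV[R]_p) : dotr u v = ip u v.
Proof. by rewrite /ip big_ord1. Qed.

Lemma sqnD m n (A B : 'M[R]_(m, n)) : sqn (A + B) = sqn A + 2 * ip A B + sqn B.
Proof. by rewrite /sqn !ipE (ipC B A); ring. Qed.

Lemma sqnB m n (A B : 'M[R]_(m, n)) : sqn (A - B) = sqn A - 2 * ip A B + sqn B.
Proof. by rewrite /sqn !ipE (ipC B A); ring. Qed.

Lemma sqnZ m n a (A : 'M[R]_(m, n)) : sqn (a *: A) = a ^+ 2 * sqn A.
Proof. by rewrite /sqn !ipE mulrA -expr2. Qed.

Lemma sqnN m n (A : 'M[R]_(m, n)) : sqn (- A) = sqn A.
Proof. by rewrite /sqn !ipE opprK. Qed.

(** Weighted arithmetic-geometric inequality: a sqrt-free replacement of the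
    Cauchy-Schwarz inequality. *)
Lemma ip_young m n (A B : 'M[R]_(m, n)) (b : R) : 0 < b ->
  2 * ip A B <= b * sqn A + b^-1 * sqn B.
Proof.
move=> b0; have := sqn_ge0 (b *: A - B); rewrite sqnB sqnZ ipZl => H.
have -> : b * sqn A + b^-1 * sqn B = b^-1 * (b ^+ 2 * sqn A + sqn B).
  by field; rewrite gt_eqF.
rewrite ler_pdivlMl //; lra.
Qed.

Lemma ip_le m n (A B : 'M[R]_(m, n)) : 2 * ip A B <= sqn A + sqn B.
Proof. by have := @ip_young _ _ A B 1 ltr01; rewrite invr1 !mul1r. Qed.

Lemma sqnD_young m n (A B : 'M[R]_(m, n)) (b : R) : 0 < b ->
  sqn (A + B) <= (1 + b) * sqn A + (1 + b^-1) * sqn B.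
Proof. by move=> /(ip_young A B); rewrite sqnD; lra. Qed.

(** Only the first term is inflated by a factor close to one; the cross term
    with [B] is kept, as it vanishes in mean when [B] is a noise. *)
Lemma sqnD3_young m n (A B D : 'M[R]_(m, n)) (b : R) : 0 < b ->
  sqn (A + B + D) <=
    (1 + b) * sqn A + 2 * sqn B + (2 + b^-1) * sqn D + 2 * ip A B.
Proof.
move=> /(ip_young A D) h1; have := @ip_young _ _ B D 1 ltr01.
by rewrite invr1 !sqnD !ipE; lra.
Qed.

Lemma sqnD_le2 m n (A B : 'M[R]_(m, n)) : sqn (A + B) <= 2 * sqn A + 2 * sqn B.
Proof. by have := @sqnD_young _ _ A B 1 ltr01; rewrite invr1; lra. Qed.

Lemma sqnD5_le m n (A1 A2 A3 A4 A5 : 'M[R]_(m, n)) :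
  sqn (A1 + A2 + A3 + A4 + A5) <=
    5 * (sqn A1 + sqn A2 + sqn A3 + sqn A4 + sqn A5).
Proof.
have y := @ip_le m n.
rewrite !sqnD !ipE.
have := (y A1 A2, y A1 A3, y A1 A4, y A1 A5, y A2 A3).
have := (y A2 A4, y A2 A5, y A3 A4, y A3 A5, y A4 A5).
by move=> [[[[]]]] ????? [[[[]]]] ?????; lra.
Qed.

Lemma sqn_split m n k (A : 'M[R]_(m + n, k)) :
  sqn A = sqn (usubmx A) + sqn (dsubmx A).
Proof.
rewrite /sqn /ip big_split_ord /=; congr (_ + _);
  by apply: eq_bigr => i _; apply: eq_bigr => j _; rewrite !mxE.
Qed.

Lemma sqn_col_mx m n k (A : 'M[R]_(m, k)) (B : 'M[R]_(n, k)) :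
  sqn (col_mx A B) = sqn A + sqn B.
Proof. by rewrite sqn_split col_mxKu col_mxKd. Qed.

Lemma sqn_rows m n (A : 'M[R]_(m, n)) : sqn A = \sum_i sqn (row i A).
Proof.
apply: eq_bigr => i _; rewrite /sqn /ip big_ord1.
by apply: eq_bigr => j _; rewrite !mxE.
Qed.

Lemma sqn_cols m n (A : 'M[R]_(m, n)) : sqn A = \sum_j sqn (col j A).
Proof.
rewrite /sqn /ip exchange_big; apply: eq_bigr => j _.
by apply: eq_bigr => i _; rewrite big_ord1 !mxE.
Qed.

Lemma sqn_diag m n (d : 'rV[R]_m) (A : 'M[R]_(m, n)) :
  sqn (diag_mx d *m A) = \sum_i d 0 i ^+ 2 * sqn (row i A).
Proof.
rewrite sqn_rows; apply: eq_bigr => i _.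
rewrite row_mul row_diag_mx -scalemxAl sqnZ; congr (_ * sqn _).
by rewrite -rowE.
Qed.

Lemma sqn_sumE n m k (A : 'I_n -> 'M[R]_(m, k)) :
  sqn (\sum_i A i) = \sum_i \sum_j ip (A i) (A j).
Proof.
rewrite /sqn (big_morph (fun x => ip x _) (id1 := 0) (op1 := +%R)).
- apply: eq_bigr => i _; rewrite (big_morph (ip _) (id1 := 0) (op1 := +%R)) //.
    by move=> x y; rewrite ipDr.
  by rewrite ip0r.
- by move=> x y; rewrite ipDl.
- by rewrite ip0l.
Qed.

(** All cross terms are estimated by [ip_le]. *)
Lemma sqn_sum n m k (A : 'I_n -> 'M[R]_(m, k)) :
  sqn (\sum_i A i) <= n%:R * \sum_i sqn (A i).
Proof.
rewrite sqn_sumE; have H : \sum_i \sum_j 2 * ip (A i) (A j) <=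
   \sum_(i < n) \sum_(j < n) (sqn (A i) + sqn (A j)).
  apply: ler_sum => i _; apply: ler_sum => j _.
  exact: ip_le.
have E : \sum_(i < n) \sum_(j < n) (sqn (A i) + sqn (A j)) =
    2 * (n%:R * \sum_i sqn (A i)).
  under eq_bigr do rewrite big_split /= sumr_const card_ord.
  rewrite big_split /= sumr_const card_ord sumrMnl.
  by rewrite -[LHS]mulr2n -[LHS]mulr_natl -[_ *+ n]mulr_natl.
move: H; rewrite E; under eq_bigr do rewrite -mulr_sumr.
by rewrite -mulr_sumr ler_pM2l.
Qed.

End FrobeniusInnerProduct.

Section SpectralNorm.
Context {R : realType}.

Lemma ip_sqr_le m n (A B : 'M[R]_(m, n)) : ip A B ^+ 2 <= sqn A * sqn B.
Proof.
have [A0|A0] := eqVneq (sqn A) 0.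
  by rewrite (sqn0_eq0 A0) sqn0 ip0l expr0n mul0r.
have Ap : 0 < sqn A by rewrite lt_neqAle eq_sym A0 sqn_ge0.
have := sqn_ge0 ((ip A B / sqn A) *: A - B).
rewrite sqnB sqnZ ipZl => H.
have : 0 <= sqn A * ((ip A B / sqn A) ^+ 2 * sqn A - 2 * (ip A B / sqn A * ip A B) + sqn B).
  by rewrite mulr_ge0 // ltW.
have -> : sqn A * ((ip A B / sqn A) ^+ 2 * sqn A - 2 * (ip A B / sqn A * ip A B) + sqn B)
   = sqn A * sqn B - ip A B ^+ 2 by field.
by rewrite subr_ge0.
Qed.

(** Cauchy-Schwarz in every entry of the product. *)
Lemma sqn_mulmx m n k (A : 'M[R]_(m, n)) (B : 'M[R]_(n, k)) :
  sqn (A *m B) <= sqn A * sqn B.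
Proof.
rewrite [sqn (A *m B)]/sqn /ip [sqn A]sqn_rows mulr_suml.
apply: ler_sum => i _; rewrite [sqn B]sqn_cols mulr_sumr; apply: ler_sum => j _.
suff -> : (A *m B) i j = ip (row i A)^T (col j B).
  rewrite -expr2; apply: le_trans (ip_sqr_le _ _) _.
  apply: le_of_eq; congr (_ * _).
  rewrite /sqn /ip exchange_big big_ord1 big_ord1.
  by apply: eq_bigr => l _; rewrite !mxE.
by rewrite mxE /ip; apply: eq_bigr => l _; rewrite big_ord1 !mxE.
Qed.

Let fnorm0 m n : fnorm (0 : 'M[R]_(m, n)) = 0.
Proof. by rewrite fnorm_sqn sqn0 sqrtr0. Qed.

Let specnorm_ub m n (A : 'M[R]_(m, n)) (v : 'cV[R]_n) :
  fnorm v <= 1 -> fnorm (A *m v) <= specnorm A.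
Proof.
move=> v1; apply: ub_le_sup; last by exists v.
exists (fnorm A) => _ [u /= u1 <-]; rewrite !fnorm_sqn ler_sqrt ?sqn_ge0 //.
apply: le_trans (sqn_mulmx _ _) _; rewrite ler_piMr ?sqn_ge0 //.
by rewrite -sqn_fnorm expr_le1 // sqrtr_ge0.
Qed.

Lemma specnorm_ge0 m n (A : 'M[R]_(m, n)) : 0 <= specnorm A.
Proof. by have := @specnorm_ub _ _ A 0; rewrite mulmx0 !fnorm0; apply. Qed.

(** Column by column, after normalization of the column. The supremum that
    defines the spectral norm is over a bounded set by [sqn_mulmx], so it
    dominates each of its members. *)
Lemma specnormP m n (A : 'M[R]_(m, n)) k (X : 'M[R]_(n, k)) :
  sqn (A *m X) <= specnorm A ^+ 2 * sqn X.
Proof.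
rewrite sqn_cols [sqn X]sqn_cols mulr_sumr; apply: ler_sum => j _.
have -> : col j (A *m X) = A *m col j X by rewrite !colE mulmxA.
set v := col j X.
have [v0|v0] := eqVneq (sqn v) 0.
  by rewrite (sqn0_eq0 v0) mulmx0 !sqn0 mulr0.
have vp : 0 < sqn v by rewrite lt_neqAle eq_sym v0 sqn_ge0.
have := specnorm_ub A (v := (fnorm v)^-1 *: v).
have e1 : fnorm v != 0 by rewrite fnorm_sqn gt_eqF // sqrtr_gt0.
have -> : fnorm ((fnorm v)^-1 *: v) = 1.
  rewrite [LHS]fnorm_sqn sqnZ -sqn_fnorm -exprMn mulVf //.
  by rewrite expr1n sqrtr1.
move=> /(_ (lexx 1)); rewrite -scalemxAr => H.
have : fnorm ((fnorm v)^-1 *: (A *m v)) ^+ 2 <= specnorm A ^+ 2.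
  by rewrite ler_sqr ?nnegrE ?sqrtr_ge0 //; apply: le_trans H; rewrite sqrtr_ge0.
by rewrite sqn_fnorm sqnZ exprVn sqn_fnorm mulrC ler_pdivrMr.
Qed.

End SpectralNorm.

(** * Averaging and the eigenbasis of the mixing matrix *)

Section Averaging.
Context {R : realType} {n p : nat}.
Hypothesis n_gt0 : (0 < n)%N.

Let n_neq0 : n%:R != 0 :> R. Proof. by rewrite pnatr_eq0 -lt0n. Qed.

Lemma rowmeanE (A : 'M[R]_(n, p)) : rowmean A = n%:R^-1 *: ((ones n)^T *m A).
Proof.
congr (_ *: _); apply/rowP => j; rewrite summxE mxE.
by apply: eq_bigr => i _; rewrite !mxE mul1r.
Qed.

Lemma rowmeanD (A B : 'M[R]_(n, p)) : rowmean (A + B) = rowmean A + rowmean B.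
Proof. by rewrite !rowmeanE mulmxDr scalerDr. Qed.

Lemma rowmeanB (A B : 'M[R]_(n, p)) : rowmean (A - B) = rowmean A - rowmean B.
Proof. by rewrite !rowmeanE mulmxBr scalerBr. Qed.

Lemma rowmeanZ a (A : 'M[R]_(n, p)) : rowmean (a *: A) = a *: rowmean A.
Proof. by rewrite !rowmeanE -scalemxAr scalerA mulrC -scalerA. Qed.

Lemma row_ones_mul (v : 'rV[R]_p) i : row i (ones n *m v) = v.
Proof.
by apply/rowP => j; rewrite !mxE big_ord1 mxE mul1r.
Qed.

Lemma ones_sqr : (ones n)^T *m ones n = n%:R%:M :> 'M[R]_1.
Proof.
apply/matrixP => i j; rewrite !ord1 !mxE (eq_bigr (fun=> 1)).
  by rewrite sumr_const card_ord eqxx.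
by move=> k _; rewrite !mxE mulr1.
Qed.

Lemma sqn_ones_mul (v : 'rV[R]_p) : sqn (ones n *m v) = n%:R * sqn v.
Proof.
rewrite sqn_rows; under eq_bigr do rewrite row_ones_mul.
by rewrite sumr_const card_ord mulr_natl.
Qed.

Lemma sqn_rowmean (A : 'M[R]_(n, p)) : n%:R * sqn (rowmean A) <= sqn A.
Proof.
rewrite sqnZ; have := sqn_sum (fun i => row i A); rewrite -sqn_rows => H.
rewrite mulrA exprVn expr2 invfM mulrA mulfV // mul1r.
by rewrite ler_pdivrMl // ltr0n.
Qed.

(** Pythagoras: a matrix with zero column means is orthogonal to the matrices
    with constant rows. *)
Lemma sqn_center (A : 'M[R]_(n, p)) (v : 'rV[R]_p) :
  sqn (A - ones n *m v) =
  sqn (A - ones n *m rowmean A) + n%:R * sqn (rowmean A - v).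
Proof.
have -> : A - ones n *m v =
   (A - ones n *m rowmean A) + ones n *m (rowmean A - v).
  by rewrite mulmxBr addrA subrK.
rewrite sqnD sqn_ones_mul ip_mulr mulmxBr mulmxA ones_sqr mul_scalar_mx.
rewrite rowmeanE scalerA mulfV // scale1r subrr.
by rewrite ip0l mulr0 addr0.
Qed.

End Averaging.

Section Eigenbasis.
Context {R : realType} {n : nat} {W : 'M[R]_n} {lambda : nat -> R}
  {Q1 : 'M[R]_(n, n.-1)}.
Hypothesis n_gt0 : (0 < n)%N.
Hypothesis hQ1 : eigenbasis W lambda Q1.

Let n_neq0 : n%:R != 0 :> R. Proof. by rewrite pnatr_eq0 -lt0n. Qed.

Let ones_Q1 : (ones n)^T *m Q1 = 0.
Proof. by apply: trmx_inj; rewrite trmx_mul trmxK trmx0 (eigenbasis_orth_ones hQ1). Qed.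

(** A trace count: the difference of the two sides is a symmetric idempotent
    of trace [n - 1 - (n - 1)], hence it has zero Frobenius norm. *)
Lemma eigenbasis_complete :
  Q1 *m Q1^T = 1%:M - n%:R^-1 *: (ones n *m (ones n)^T).
Proof.
set A := n%:R^-1 *: _; set E := Q1 *m Q1^T.
have EE : E *m E = E.
  by rewrite /E mulmxA -(mulmxA Q1) (eigenbasis_orthonormal hQ1) mulmx1.
have AA : A *m A = A.
  rewrite /A -scalemxAl -scalemxAr scalerA mulmxA -(mulmxA (ones n)) ones_sqr.
  rewrite mul_mx_scalar -scalemxAl scalerA; congr (_ *: _).
  by rewrite -mulrA mulVf ?mulr1.
have AE : A *m E = 0.
  by rewrite /A /E -scalemxAl mulmxA -(mulmxA (ones n)) ones_Q1 mulmx0 mul0mx scaler0.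
have EA : E *m A = 0.
  rewrite /A /E -scalemxAr mulmxA -(mulmxA Q1).
  by rewrite (eigenbasis_orth_ones hQ1) mulmx0 mul0mx scaler0.
have At : A^T = A by rewrite /A linearZ /= trmx_mul trmxK.
have Et : E^T = E by rewrite /E trmx_mul trmxK.
have trA : \tr A = 1.
  by rewrite /A linearZ /= mxtrace_mulC ones_sqr mxtrace_scalar mulr1n mulVf.
have trE : \tr E = n.-1%:R.
  by rewrite /E mxtrace_mulC (eigenbasis_orthonormal hQ1) mxtrace1.
have tr1 : \tr (1%:M : 'M[R]_n) = 1 + n.-1%:R.
  by rewrite mxtrace1 -{1}(prednK n_gt0) -addn1 natrD addrC.
apply/eqP; rewrite -subr_eq0; apply/eqP; set F := E - _.
have Ft : F^T = F by rewrite /F !linearB /= trmx1 At Et.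
have FF : F *m F = - F.
  have -> : F = E + A - 1%:M by rewrite /F opprB addrA.
  rewrite !mulmxBl !mulmxBr !mulmxDl !mulmxDr !mulmx1 !mul1mx EE AA AE EA.
  by apply/matrixP => i j; rewrite !mxE; ring.
apply: sqn0_eq0; rewrite /sqn ip_trace Ft FF /F !linearN !linearB /= trA trE tr1.
by ring.
Qed.

Lemma sqn_Q1_mul k (A : 'M[R]_(_, k)) : sqn (Q1 *m A) = sqn A.
Proof. by rewrite /sqn ip_mull mulmxA (eigenbasis_orthonormal hQ1) mul1mx. Qed.

Lemma sqn_Q1T_mul k (A : 'M[R]_(n, k)) :
  sqn (Q1^T *m A) = sqn (A - ones n *m rowmean A).
Proof.
rewrite -sqn_Q1_mul mulmxA eigenbasis_complete mulmxBl mul1mx.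
by rewrite rowmeanE -scalemxAl -scalemxAr mulmxA.
Qed.

Lemma sqn_Q1T_le k (A : 'M[R]_(n, k)) : sqn (Q1^T *m A) <= sqn A.
Proof.
rewrite sqn_Q1T_mul; have := sqn_center n_gt0 A 0.
rewrite mulmx0 !subr0 => ->.
by rewrite lerDl mulr_ge0 ?sqn_ge0.
Qed.

Lemma Q1T_W : Q1^T *m W = diag_from2 n lambda *m Q1^T.
Proof.
rewrite (eigenbasis_decomp hQ1) mulmxDr -scalemxAr !mulmxA.
rewrite (eigenbasis_orth_ones hQ1) mul0mx scaler0 add0r.
by rewrite (eigenbasis_orthonormal hQ1) mul1mx.
Qed.

(** The eigenvalue is the value of the quadratic form of [W] at a column of
    [Q1]. *)
Lemma eigenvalue_ge0 (i : 'I_n.-1) : psd W -> 0 <= lambda i.+2.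
Proof.
move=> /(_ (col i Q1)); suff -> : ((col i Q1)^T *m W *m col i Q1) 0 0 = lambda i.+2 by [].
have E : Q1^T *m W *m Q1 = diag_from2 n lambda.
  by rewrite Q1T_W -mulmxA (eigenbasis_orthonormal hQ1) mulmx1.
rewrite colE trmx_mul !mulmxA -(mulmxA _ Q1^T) -(mulmxA _ (Q1^T *m W)) E.
rewrite trmx_delta -rowE row_diag_mx -scalemxAl mxE mul_delta_mx.
by rewrite !mxE !eqxx mulr1.
Qed.

End Eigenbasis.

(** * The transformed consensus state *)

(** The state [(Q1^T x, (I - Lambdat1)^(-1/2) Q1^T rhat)] of a round is multiplied
    by [Bmx], up to perturbations. In the coordinates [invmx J] this becomes a
    multiplication by [P1], which shrinks squared norms by the factor
    [lambdat 2 = 1 - delta]; [hcheck] is the state in these coordinates. *)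

Fact residual_combine (R : realType) (c1 c2 e L u1 u2 u3 u4 u5 u6 v1 v2 : R) :
  u1 <= c1 * v1 -> u2 <= c1 * v2 -> u3 <= u4 ->
  e * u5 <= e * (2 * L ^+ 2 * v1) ->
  4 * u1 + u2 + u3 + c2 * e * u6 + e * u5 <=
  (4 * c1 + 2 * (e * L ^+ 2)) * v1 + c1 * v2 + u4 + c2 * e * u6.
Proof. by move=> ????; lra. Qed.

Section TransformedDynamics.
Context {R : realType} {n p : nat} {W : 'M[R]_n} {lambda : nat -> R}
  {Q1 : 'M[R]_(n, n.-1)} {gamma : R} {J P1 : 'M[R]_(n.-1 + n.-1)}.
Hypothesis n_ge2 : (2 <= n)%N.
Hypothesis hQ1 : eigenbasis W lambda Q1.
Hypothesis hJ : decomposition gamma lambda J P1.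
Hypothesis lambda_ge0 : forall i : 'I_n.-1, 0 <= lambda i.+2.
Hypothesis lambda_le2 : forall i : 'I_n.-1, lambda i.+2 <= lambda 2.
Hypothesis lambda2_lt1 : lambda 2 < 1.
Hypothesis gamma_gt0 : 0 < gamma.
Hypothesis gamma_le : gamma <= 1 / 8.

Let n_gt0 : (0 < n)%N. Proof. exact: ltnW. Qed.

Let l i := lambdat gamma lambda i.
Let s i := Num.sqrt (1 - l i).
Let delta := 1 - l 2.

Let deltaE : delta = gamma / 2 * (1 - lambda 2).
Proof. by rewrite /delta /l /lambdat; ring. Qed.

Let delta_gt0 : 0 < delta.
Proof. by rewrite deltaE mulr_gt0 ?subr_gt0 ?divr_gt0. Qed.

Let l_bounds (i : 'I_n.-1) : delta <= 1 - l i.+2 <= gamma / 2.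
Proof.
have -> : 1 - l i.+2 = gamma / 2 * (1 - lambda i.+2) by rewrite /l /lambdat; ring.
rewrite deltaE ler_pM2l ?divr_gt0 // lerD2l lerN2 lambda_le2 /=.
by rewrite ler_piMr ?divr_ge0 ?(ltW gamma_gt0) // gerBl lambda_ge0.
Qed.

Let s_gt0 (i : 'I_n.-1) : 0 < s i.+2.
Proof. by rewrite sqrtr_gt0; case/andP: (l_bounds i) => /(lt_le_trans delta_gt0). Qed.

Let s_sqr (i : 'I_n.-1) : s i.+2 ^+ 2 = 1 - l i.+2.
Proof.
by rewrite sqr_sqrtr //; case/andP: (l_bounds i) => /(lt_le_trans delta_gt0)/ltW.
Qed.

(* Here [gamma <= 1 / 8] enters: [lambdat n >= 1 - gamma / 2 >= 15 / 16]. *)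
Let sq_invJ k (A : 'M[R]_(_, k)) : sqn (invmx J *m A) <= 2 / 3 * sqn A.
Proof.
apply: le_trans (specnormP _ _) _; rewrite ler_wpM2r ?sqn_ge0 //.
have h : (n.-2 < n.-1)%N by case: n n_ge2 => [|[]].
have e : l n = l (Ordinal h).+2 by rewrite /= !prednK //; case: n n_ge2 => [|[]].
have := l_bounds (Ordinal h); rewrite -e => /andP[_ l1].
have l2 : 15 / 16 <= l n by move: gamma_le; lra.
apply: (@le_trans _ _ ((Num.sqrt (2 * l n))^-1 ^+ 2)).
  by rewrite ler_sqr ?nnegrE ?specnorm_ge0 ?invr_ge0 ?sqrtr_ge0 // (dec_Jinv hJ).
have l3 : 0 < 2 * l n by lra.
rewrite exprVn sqr_sqrtr ?(ltW l3) // -div1r ler_pdivrMr //; lra.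
Qed.

Let sq_J k (A : 'M[R]_(_, k)) : sqn (J *m A) <= 2 * sqn A.
Proof.
apply: le_trans (specnormP _ _) _; rewrite ler_wpM2r ?sqn_ge0 //.
rewrite -[leRHS](@sqr_sqrtr _ 2) //.
by rewrite ler_sqr ?nnegrE ?specnorm_ge0 ?sqrtr_ge0 // (dec_J hJ).
Qed.

Lemma sqn_P1_mul k (A : 'M[R]_(_, k)) : sqn (P1 *m A) <= (1 - delta) * sqn A.
Proof.
apply: le_trans (specnormP _ _) _; rewrite ler_wpM2r ?sqn_ge0 //.
by rewrite /delta opprB addrCA subrr addr0 (dec_P1 hJ).
Qed.

Let Ld := diag_from2 n l.
Let Sd := diag_from2 n s.
Let Si := diag_from2 n (fun i => (s i)^-1).

(** The matrices through which an error of the gradients, the compression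
    error and a change of the reference gradient [gradF (ones n *m rowmean x)]
    enter the next state. *)
Definition grad_gain : 'M[R]_(n.-1 + n.-1, n) :=
  invmx J *m col_mx (Ld *m Q1^T) (Sd *m Q1^T).
Definition compress_gain : 'M[R]_(n.-1 + n.-1, n) :=
  invmx J *m col_mx (- (Sd *m Sd *m Q1^T)) (Sd *m Q1^T).
Definition drift_gain : 'M[R]_(n.-1 + n.-1, n) :=
  invmx J *m col_mx 0 (Si *m Q1^T).

Lemma sqn_grad_gain k (A : 'M[R]_(n, k)) :
  sqn (grad_gain *m A) <= 2 / 3 * sqn A.
Proof.
rewrite /grad_gain -(mulmxA (invmx J)) mul_col_mx; apply: le_trans (sq_invJ _) _.
rewrite ler_pM2l // sqn_col_mx -!mulmxA !sqn_diag -big_split /=.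
apply: le_trans (sqn_Q1T_le n_gt0 hQ1 A); rewrite [leRHS]sqn_rows.
apply: ler_sum => i _; rewrite -mulrDl !mxE s_sqr ler_piMl ?sqn_ge0 //.
by case/andP: (l_bounds i) => a b; move: gamma_le delta_gt0; nra.
Qed.

(** The compression error reaches the agents only through [gamma / 2 *: (1 -
    W)], which is why its gain is of the order of [gamma]. *)
Lemma sqn_compress_gain k (A : 'M[R]_(n, k)) :
  sqn (compress_gain *m A) <= 5 / 12 * gamma * sqn A.
Proof.
rewrite /compress_gain -(mulmxA (invmx J)) mul_col_mx; apply: le_trans (sq_invJ _) _.
have -> : 5 / 12 * gamma * sqn A = 2 / 3 * (5 / 8 * gamma * sqn A) by field.
rewrite ler_pM2l // sqn_col_mx mulNmx sqnN -!mulmxA !sqn_diag -big_split /=.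
apply: (@le_trans _ _ (5 / 8 * gamma * sqn (Q1^T *m A))); last first.
  by rewrite ler_pM2l ?(sqn_Q1T_le n_gt0 hQ1) // mulr_gt0.
rewrite [sqn (Q1^T *m A)]sqn_rows mulr_sumr.
apply: ler_sum => i _; rewrite row_mul row_diag_mx -scalemxAl -rowE sqnZ !mxE s_sqr.
have -> : (1 - l i.+2) * ((1 - l i.+2) * sqn (row i (Q1^T *m A))) +
  (1 - l i.+2) * sqn (row i (Q1^T *m A)) =
  ((1 - l i.+2) * (2 - l i.+2)) * sqn (row i (Q1^T *m A)) by ring.
rewrite ler_wpM2r ?sqn_ge0 //.
by case/andP: (l_bounds i) => a b; move: gamma_le delta_gt0; nra.
Qed.

(** The second component of the state is rescaled by [(1 - lambdat i)^(-1/2)],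
    which is at most [delta^(-1/2)]. *)
Lemma sqn_drift_gain k (A : 'M[R]_(n, k)) :
  sqn (drift_gain *m A) <= 2 / (3 * delta) * sqn A.
Proof.
rewrite /drift_gain -(mulmxA (invmx J)) mul_col_mx; apply: le_trans (sq_invJ _) _.
have -> : 2 / (3 * delta) * sqn A = 2 / 3 * (delta^-1 * sqn A).
  by field; rewrite gt_eqF.
rewrite ler_pM2l // sqn_col_mx mul0mx sqn0 add0r -!mulmxA sqn_diag.
apply: (@le_trans _ _ (delta^-1 * sqn (Q1^T *m A))); last first.
  by rewrite ler_pM2l ?invr_gt0 // (sqn_Q1T_le n_gt0 hQ1).
rewrite [sqn (Q1^T *m A)]sqn_rows mulr_sumr.
apply: ler_sum => i _; rewrite !mxE exprVn s_sqr ler_wpM2r ?sqn_ge0 //.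
case/andP: (l_bounds i) => a _.
by rewrite lef_pV2 ?posrE // (lt_le_trans delta_gt0).
Qed.

Context (f : 'I_n -> 'rV[R]_p -> R).
Let hc := hcheck f gamma lambda Q1 J.
Let gradbar (x : 'M[R]_(n, p)) := gradF f (ones n *m rowmean x).

Lemma hcheckE eta (x D : 'M[R]_(n, p)) :
  hc eta x D = invmx J *m col_mx (Q1^T *m x) (Si *m (Q1^T *m rhat f eta x D)).
Proof.
rewrite -{1}(hsubmxK (invmx J)) mul_row_col /hc /hcheck.
by rewrite !mulmxA.
Qed.

Let sqn_state eta (x D : 'M[R]_(n, p)) :
  sqn (Q1^T *m x) + sqn (Si *m (Q1^T *m rhat f eta x D)) <= 2 * sqn (hc eta x D).
Proof.
by rewrite -sqn_col_mx -[col_mx _ _](mulKVmx (dec_unit hJ)) -hcheckE; apply: sq_J.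
Qed.

Lemma sqn_consensus eta (x D : 'M[R]_(n, p)) :
  sqn (Q1^T *m x) <= 2 * sqn (hc eta x D).
Proof. by apply: le_trans (sqn_state _ _ _); rewrite lerDl sqn_ge0. Qed.

(** Conversely, the rescaling of the second component is at least by [(gamma /
    2)^(-1/2)], so that the dual residual is smaller than the state by a
    factor of the order of [gamma]. *)
Lemma sqn_rhat eta (x D : 'M[R]_(n, p)) :
  sqn (Q1^T *m rhat f eta x D) <= gamma * sqn (hc eta x D).
Proof.
have -> : gamma * sqn (hc eta x D) = gamma / 2 * (2 * sqn (hc eta x D)) by field.
apply: (@le_trans _ _ (gamma / 2 * sqn (Si *m (Q1^T *m rhat f eta x D)))); last first.
  rewrite ler_pM2l ?divr_gt0 //; apply: le_trans (sqn_state _ _ _).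
  by rewrite lerDr sqn_ge0.
rewrite sqn_diag mulr_sumr sqn_rows; apply: ler_sum => i _.
rewrite mulrA ler_peMl ?sqn_ge0 // !mxE exprVn s_sqr.
case/andP: (l_bounds i) => a b.
by rewrite ler_pdivlMr ?mul1r // (lt_le_trans delta_gt0).
Qed.

Lemma Q1T_IW k (A : 'M[R]_(n, k)) :
  (gamma / 2) *: (Q1^T *m ((1%:M - W) *m A)) = Sd *m (Sd *m (Q1^T *m A)).
Proof.
rewrite mulmxBl mul1mx mulmxBr (mulmxA _ W) (Q1T_W hQ1) -mulmxA.
rewrite !mul_diag_mx; apply/matrixP => i j; rewrite !mxE mulrA -expr2 s_sqr.
by rewrite /l /lambdat; ring.
Qed.

(** Projecting the two updates on [Q1] diagonalizes [W]; one round is then the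
    matrix [Bmx] acting on the state of [hcheck], whose second component is
    centered at the reference gradient of its own round. Hence the change of
    reference gradient appears as a third perturbation. *)
Lemma hcheck_step eta eta' (x D x' D' G E : 'M[R]_(n, p)) :
  D' = D + (gamma / 2) *: ((1%:M - W) *m (x - eta *: G - D + E)) ->
  x' = x - eta *: G - D' ->
  hc eta' x' D' =
    P1 *m hc eta x D - eta *: (grad_gain *m (G - gradbar x))
    + compress_gain *m E
    + drift_gain *m (eta' *: gradbar x' - eta *: gradbar x).
Proof.
move=> eD ex; rewrite !hcheckE /rhat -/(gradbar x) -/(gradbar x').
move: (gradbar x) (gradbar x') => gx gx'.
pose a := Q1^T *m x; pose dd := Q1^T *m D; pose g := Q1^T *m G.
pose e := Q1^T *m E; pose c := Q1^T *m gx; pose c' := Q1^T *m gx'.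
have eD' : Q1^T *m D' = dd + Sd *m (Sd *m (a - eta *: g - dd + e)).
  rewrite eD (mulmxDr Q1^T) -scalemxAr Q1T_IW -/dd.
  by rewrite [Q1^T *m (_ - D + E)]mulmxDr !mulmxBr -(scalemxAr eta).
have ex' : Q1^T *m x' = a - eta *: g - Q1^T *m D'.
  by rewrite ex !mulmxBr -(scalemxAr eta).
have er : Q1^T *m (D + eta *: gx) = dd + eta *: c.
  rewrite (mulmxDr Q1^T) -(scalemxAr eta Q1^T); reflexivity.
have er' : Q1^T *m (D' + eta' *: gx') = Q1^T *m D' + eta' *: c'.
  rewrite (mulmxDr Q1^T) -(scalemxAr eta' Q1^T); reflexivity.
have tG : grad_gain *m (G - gx) = invmx J *m col_mx (Ld *m (g - c)) (Sd *m (g - c)).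
  by rewrite /grad_gain -(mulmxA (invmx J)) mul_col_mx -!(mulmxA _ Q1^T) mulmxBr.
have tE : compress_gain *m E = invmx J *m col_mx (- (Sd *m (Sd *m e))) (Sd *m e).
  by rewrite /compress_gain -(mulmxA (invmx J)) mul_col_mx mulNmx -!mulmxA.
have tK : drift_gain *m (eta' *: gx' - eta *: gx) =
    invmx J *m col_mx 0 (Si *m (eta' *: c' - eta *: c)).
  rewrite /drift_gain -(mulmxA (invmx J)) mul_col_mx mul0mx -(mulmxA _ Q1^T).
  rewrite (mulmxBr Q1^T) -(scalemxAr eta' Q1^T) -(scalemxAr eta Q1^T); reflexivity.
have tB : P1 *m (invmx J *m col_mx a (Si *m (Q1^T *m (D + eta *: gx)))) = invmx J *m (col_mx
    (Ld *m a - Ld *m (Sd *m (Si *m (dd + eta *: c))))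
    (Sd *m a + Ld *m (Si *m (dd + eta *: c)))).
  rewrite er (mulmxA P1); have -> : P1 *m invmx J = invmx J *m Bmx gamma lambda.
    by rewrite (dec_eq hJ) !mulmxA mulVmx ?(dec_unit hJ) // mul1mx.
  rewrite -(mulmxA (invmx J)) mul_block_col; congr (_ *m col_mx (_ + _) _).
  by rewrite mulNmx -mulmxA.
have tL : invmx J *m col_mx (Q1^T *m x') (Si *m (Q1^T *m (D' + eta' *: gx'))) =
    invmx J *m col_mx (a - eta *: g - Q1^T *m D')
    (Si *m (Q1^T *m D' + eta' *: c')) by rewrite ex' er'.
apply: (etrans tL); rewrite eD'.
transitivity (invmx J *m col_mx
      (Ld *m a - Ld *m (Sd *m (Si *m (dd + eta *: c))))
      (Sd *m a + Ld *m (Si *m (dd + eta *: c)))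
    - eta *: (invmx J *m col_mx (Ld *m (g - c)) (Sd *m (g - c)))
    + invmx J *m col_mx (- (Sd *m (Sd *m e))) (Sd *m e)
    + invmx J *m col_mx 0 (Si *m (eta' *: c' - eta *: c))); last first.
  by rewrite -tB -tG -tE -tK.
clear tL tB tK tE tG er er' ex' eD'; clearbody a dd g e c c'.
rewrite scalemxAr -mulmxBr -!mulmxDr; congr (_ *m _).
rewrite scale_col_mx opp_col_mx !add_col_mx.
have sn (i : 'I_n.-1) : s i.+2 != 0 by rewrite gt_eqF.
have lE (i : 'I_n.-1) : l i.+2 = 1 - s i.+2 ^+ 2 by rewrite s_sqr opprB addrCA subrr addr0.
by congr col_mx; apply/matrixP => i j;
  rewrite !mul_diag_mx !mxE -/(l _) -/(s _) !lE; field; exact: sn.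
Qed.

Lemma gradF_lipschitz L (x y : 'M[R]_(n, p)) :
  (forall i, lipschitz_grad L (f i)) ->
  sqn (gradF f x - gradF f y) <= L ^+ 2 * sqn (x - y).
Proof.
move=> hL; rewrite sqn_rows [sqn (x - y)]sqn_rows mulr_sumr; apply: ler_sum => i _.
by rewrite !linearB /= !rowK; exact/sqn_le_fnorm/hL.
Qed.

Lemma gradF_consensus L eta (x D : 'M[R]_(n, p)) :
  (forall i, lipschitz_grad L (f i)) ->
  sqn (gradF f x - gradbar x) <= 2 * L ^+ 2 * sqn (hc eta x D).
Proof.
move=> hL; apply: le_trans (gradF_lipschitz _ _ hL) _.
rewrite -(sqn_Q1T_mul n_gt0 hQ1) (mulrC 2) -[leRHS]mulrA.
by rewrite ler_wpM2l ?sqr_ge0 // sqn_consensus.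
Qed.

Lemma gradbar_lipschitz L (x y : 'M[R]_(n, p)) :
  (forall i, lipschitz_grad L (f i)) ->
  sqn (gradbar x - gradbar y) <= L ^+ 2 * (n%:R * sqn (rowmean x - rowmean y)).
Proof.
move=> /(@gradF_lipschitz L (ones n *m rowmean x) (ones n *m rowmean y)).
by rewrite -mulmxBr sqn_ones_mul.
Qed.

(** The vector estimated here is what the compressed reference point [H] fails
    to follow in one round. As the dual variables have zero column means, they
    equal their projections on [Q1]; writing these as [rhat] minus the
    reference gradients leaves the two dual residuals, the change of the
    reference gradient, its mean, and a consensus error of the gradients. *)
Lemma residual_bound L eta eta' (x D x' D' : 'M[R]_(n, p)) :
  (forall i, lipschitz_grad L (f i)) ->
  (ones n)^T *m D = 0 -> (ones n)^T *m D' = 0 ->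
  sqn (D - 2 *: D' - eta' *: gradF f x') <=
  5 * ((4 * gamma + 2 * (eta' ^+ 2 * L ^+ 2)) * sqn (hc eta' x' D')
       + gamma * sqn (hc eta x D) + sqn (eta' *: gradbar x' - eta *: gradbar x)
       + n%:R * eta' ^+ 2 * sqn (rowmean (gradbar x'))).
Proof.
move=> hL D0 D0'.
have QD (A : 'M[R]_(n, p)) : (ones n)^T *m A = 0 -> Q1 *m (Q1^T *m A) = A.
  move=> A0; rewrite mulmxA (eigenbasis_complete n_gt0 hQ1) mulmxBl mul1mx.
  by rewrite -scalemxAl -mulmxA A0 mulmx0 scaler0 subr0.
have QM (A : 'M[R]_(n, p)) : ones n *m rowmean A = A - Q1 *m (Q1^T *m A).
  rewrite mulmxA (eigenbasis_complete n_gt0 hQ1) mulmxBl mul1mx opprB addrCA subrr.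
  by rewrite addr0 rowmeanE -scalemxAl -scalemxAr mulmxA.
set c := gradbar x; set c' := gradbar x'.
have -> : D - 2 *: D' - eta' *: gradF f x' =
  (- 2) *: (Q1 *m (Q1^T *m rhat f eta' x' D')) + Q1 *m (Q1^T *m rhat f eta x D)
  + Q1 *m (Q1^T *m (eta' *: c' - eta *: c))
  + (- eta') *: (ones n *m rowmean c') + (- eta') *: (gradF f x' - c').
  rewrite QM /rhat -/(gradbar x) -/(gradbar x') -/c -/c'.
  move: (QD _ D0) (QD _ D0') => {QD QM}; clearbody c c'; move: (gradF f x') => u.
  rewrite !mulmxA; move: (Q1 *m Q1^T) => S eS eS'.
  rewrite !(mulmxDr S) !(mulmxN S) -!(scalemxAr _ S) eS eS'.
  by apply/matrixP => i j; rewrite !mxE; ring.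
apply: le_trans (sqnD5_le _ _ _ _ _) _; rewrite ler_pM2l //.
have e1 (A : 'M[R]_(n.-1, p)) : sqn ((- 2) *: (Q1 *m A)) = 4 * sqn A.
  by rewrite sqnZ (sqn_Q1_mul hQ1) sqrrN; congr (_ * _); ring.
have e2 := sqn_Q1_mul hQ1.
have e4 (v : 'rV[R]_p) : sqn ((- eta') *: (ones n *m v)) = n%:R * eta' ^+ 2 * sqn v.
  by rewrite sqnZ sqn_ones_mul sqrrN mulrCA mulrA.
have e5 (A : 'M[R]_(n, p)) : sqn ((- eta') *: A) = eta' ^+ 2 * sqn A.
  by rewrite sqnZ sqrrN.
rewrite e1 !e2 e4 e5.
have h1 := sqn_rhat eta' x' D'; have h2 := sqn_rhat eta x D.
have h3 := sqn_Q1T_le n_gt0 hQ1 (eta' *: c' - eta *: c).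
have h4 := ler_wpM2l (sqr_ge0 eta') (gradF_consensus eta' x' D' hL).
exact: (residual_combine _ _ h1 h2 h3 h4).
Qed.

End TransformedDynamics.

(** * Smooth and strongly convex functions *)

Section Gradient.
Context {R : realType} {p : nat}.
Implicit Types (F : 'rV[R]_p -> R) (x v : 'rV[R]_p).

Lemma derive_grad F x v : differentiable F x -> 'D_v F x = ip (grad F x) v.
Proof.
move=> dF; rewrite deriveE // {1}(row_sum_delta v) linear_sum /ip big_ord1.
by apply: eq_bigr => j _; rewrite linearZ mxE deriveE //= mulrC.
Qed.

Lemma is_derive_line F x v (t : R) : (forall y, differentiable F y) ->
  is_derive t 1 (fun s : R => F (x + s *: v)) (ip (grad F (x + t *: v)) v).
Proof.
move=> dF; have dv : derivable F (x + t *: v) v by exact: diff_derivable.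
have E : (fun h : R => h^-1 *: (((fun s : R => F (x + s *: v)) \o shift t) (h *: 1) - F (x + t *: v)))
   = (fun h : R => h^-1 *: ((F \o shift (x + t *: v)) (h *: v) - F (x + t *: v))).
  apply/funext => h /=; congr (_ *: (F _ - _)).
  by rewrite /shift /= scalerDl addrCA (_ : h *: (1 : R) = h) // [h *: _]mulr1.
split; first by rewrite /derivable E.
by rewrite -derive_grad // /derive E.
Qed.

(** Mean value theorem for the first order remainder compensated by a
    quadratic: a sign condition on gradient increments along the segment then
    turns into an upper or a lower quadratic bound on [F]. *)
Lemma taylor_mvt F (c : R) x v : (forall y, differentiable F y) ->
  exists2 t : R, 0 < t &
    F (x + v) - (F x + ip (grad F x) v + c / 2 * sqn v) =
    ip (grad F (x + t *: v) - grad F x) v - c * t * sqn v.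
Proof.
move=> dF.
pose h (s : R) := F (x + s *: v) - s * ip (grad F x) v - s ^+ 2 * (c / 2 * sqn v).
pose dh (s : R) := ip (grad F (x + s *: v)) v - ip (grad F x) v - s * (c * sqn v).
have hd (t : R) : is_derive t 1 h (dh t).
  have := is_derive_line x v t dF => d1.
  rewrite /h; apply: is_derive_eq.
  by rewrite /dh -!/(_ *: _) /GRing.scale /=; field.
have ch : {within `[0, 1], continuous h}.
  by apply: derivable_within_continuous => t _; exact: ex_derive.
have [t t01] := MVT ltr01 (fun t _ => hd t) ch.
rewrite in_itv /= in t01; case/andP: t01 => t0 _.
rewrite /h /dh !scale1r !scale0r addr0 subr0 mulr1 expr0n expr1n /= !mul0r !subr0 !mul1r.
by exists t => //; rewrite ipDl ipNl; lra.
Qed.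

Lemma taylor_upper F (c : R) x v : (forall y, differentiable F y) ->
  (forall t : R, 0 < t -> ip (grad F (x + t *: v) - grad F x) v <= c * t * sqn v) ->
  F (x + v) <= F x + ip (grad F x) v + c / 2 * sqn v.
Proof.
by move=> dF hc; have [t t0] := taylor_mvt c x v dF; have := hc _ t0; lra.
Qed.

Lemma taylor_lower F (c : R) x v : (forall y, differentiable F y) ->
  (forall t : R, 0 < t -> c * t * sqn v <= ip (grad F (x + t *: v) - grad F x) v) ->
  F x + ip (grad F x) v + c / 2 * sqn v <= F (x + v).
Proof.
by move=> dF hc; have [t t0] := taylor_mvt c x v dF; have := hc _ t0; lra.
Qed.

End Gradient.

Section AverageObjective.
Context {R : realType} {n p : nat} {f : 'I_n -> 'rV[R]_p -> R} {mu L : R}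
  {xstar : 'rV[R]_p}.
Hypothesis n_gt0 : (0 < n)%N.
Hypothesis p_gt0 : (0 < p)%N.
Hypothesis f_diff : forall i x, differentiable (f i) x.
Hypothesis mu_gt0 : 0 < mu.
Hypothesis f_convex : strongly_convex mu (favg f).
Hypothesis f_smooth : forall i, lipschitz_grad L (f i).
Hypothesis f_min : forall x, favg f xstar <= favg f x.

Let F := favg f.

Let FE : F = n%:R^-1 *: \sum_i f i.
Proof. by apply/funext => x; rewrite /F /favg fctE fct_sumE. Qed.

Lemma favg_differentiable x : differentiable F x.
Proof.
by rewrite FE; apply: differentiableZ; apply: differentiable_sum => i; apply: f_diff.
Qed.

Lemma grad_favg x : grad F x = n%:R^-1 *: \sum_i grad (f i) x.
Proof.
apply/rowP => j; rewrite !mxE summxE FE deriveZ; last first.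
  by apply: derivable_sum => i; exact/diff_derivable.
rewrite derive_sum; last by move=> i; exact/diff_derivable.
by congr (_ * _); apply: eq_bigr => i _; rewrite mxE.
Qed.

Lemma rowmean_gradF (x : 'M[R]_(n, p)) v : (forall i, row i x = v) ->
  rowmean (gradF f x) = grad F v.
Proof.
move=> xv; rewrite grad_favg; congr (_ *: _).
by apply: eq_bigr => i _; rewrite rowK xv.
Qed.

Let lip_favg x y : sqn (grad F x - grad F y) <= L ^+ 2 * sqn (x - y).
Proof.
have n0 : 0 < n%:R :> R by rewrite ltr0n.
rewrite -(rowmean_gradF (row_ones_mul x)) -(rowmean_gradF (row_ones_mul y)).
rewrite -rowmeanB -(ler_pM2l n0); apply: le_trans (sqn_rowmean n_gt0 _) _.
have -> : n%:R * (L ^+ 2 * sqn (x - y)) = \sum_(i < n) L ^+ 2 * sqn (x - y).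
  by rewrite sumr_const card_ord mulr_natl.
rewrite sqn_rows; apply: ler_sum => i _.
by rewrite linearB /= !rowK !row_ones_mul; exact/sqn_le_fnorm/f_smooth.
Qed.

(** Compare the two conditions along one unit vector. *)
Lemma mu_le_L : mu <= L.
Proof.
pose v : 'rV[R]_p := delta_mx 0 (Ordinal p_gt0).
have v1 : sqn v = 1.
  rewrite /sqn /ip big_ord1 (bigD1 (Ordinal p_gt0)) //= big1 ?addr0.
    by rewrite mxE !eqxx mulr1.
  by move=> j /negPf jn; rewrite mxE jn andbF mulr0.
have L0 : 0 <= L.
  have := f_smooth (Ordinal n_gt0) v 0; rewrite subr0 [fnorm v]fnorm_sqn v1 sqrtr1 mulr1.
  by apply: le_trans; exact: sqrtr_ge0.
have := f_convex v 0; rewrite dotr_ip sqn_fnorm subr0 v1 mulr1 => h1.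
have h2 := lip_favg v 0; rewrite subr0 v1 mulr1 in h2.
have h3 := ip_sqr_le (grad F v - grad F 0) v; rewrite v1 mulr1 in h3.
rewrite -ler_sqr ?nnegrE ?(ltW mu_gt0) //.
apply: le_trans (le_trans h3 h2).
by rewrite ler_sqr ?nnegrE ?(ltW mu_gt0) // (le_trans _ h1) ?(ltW mu_gt0).
Qed.

Let L_gt0 : 0 < L := lt_le_trans mu_gt0 mu_le_L.

Lemma descent x v : F (x + v) <= F x + ip (grad F x) v + L / 2 * sqn v.
Proof.
apply: taylor_upper; first exact: favg_differentiable.
move=> t t0; have h := ip_sqr_le (grad F (x + t *: v) - grad F x) v.
have := lip_favg (x + t *: v) x; rewrite addrAC subrr add0r sqnZ => h'.
have tv : 0 <= L * t * sqn v by rewrite !mulr_ge0 ?sqn_ge0 ?(ltW t0) ?(ltW L_gt0).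
apply: le_trans (ler_norm _) _.
rewrite -ler_sqr ?nnegrE // real_normK ?num_real //; apply: le_trans h _.
apply: le_trans (ler_wpM2r (sqn_ge0 _) h') _.
by apply: le_of_eq; ring.
Qed.

Let convex_lower x v : F x + ip (grad F x) v + mu / 2 * sqn v <= F (x + v).
Proof.
apply: taylor_lower; first exact: favg_differentiable.
move=> t t0; have := f_convex (x + t *: v) x.
rewrite dotr_ip sqn_fnorm addrAC subrr add0r sqnZ ipZr => h.
by rewrite -(ler_pM2l t0); apply: le_trans h; apply: le_of_eq; ring.
Qed.

(** A gradient step of length [1 / L] cannot go below the minimum. *)
Lemma sqn_grad_le x : sqn (grad F x) <= 2 * L * (F x - F xstar).
Proof.
have := descent x (- L^-1 *: grad F x); rewrite ipZr sqnZ sqrrN -/(sqn _) => h1.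
have h2 := f_min (x + - L^-1 *: grad F x); rewrite -/F in h2.
have h3 := le_trans h2 h1.
have e : F x + - L^-1 * sqn (grad F x) + L / 2 * (L^-1 ^+ 2 * sqn (grad F x))
   = F x - (2 * L)^-1 * sqn (grad F x) by field; rewrite gt_eqF.
rewrite e in h3.
by rewrite -ler_pdivrMl ?mulr_gt0 //; lra.
Qed.

Lemma grad_min : grad F xstar = 0.
Proof.
apply: sqn0_eq0; apply/eqP; rewrite eq_le sqn_ge0 andbT.
by have := sqn_grad_le xstar; rewrite subrr mulr0.
Qed.

Lemma favg_gap_ge x : mu / 2 * sqn (x - xstar) <= F x - F xstar.
Proof.
by have := convex_lower xstar (x - xstar); rewrite grad_min ip0l addrCA subrr !addr0; lra.
Qed.

(** The Polyak-Lojasiewicz inequality: strong convexity bounds [F] below by a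
    quadratic function, whose minimum is explicit. *)
Lemma favg_gap_le x : 2 * mu * (F x - F xstar) <= sqn (grad F x).
Proof.
have := convex_lower x (xstar - x); rewrite addrCA subrr addr0 => h1.
have := ip_young (- grad F x) (xstar - x) (_ : 0 < mu^-1).
rewrite invr_gt0 => /(_ mu_gt0); rewrite invrK ipNl sqnN => h2.
have h3 : 2 * (F x - F xstar) <= mu^-1 * sqn (grad F x) by lra.
by rewrite ler_pdivlMl // in h3; lra.
Qed.

Lemma sqn_dist_le x : mu ^+ 2 * sqn (x - xstar) <= sqn (grad F x).
Proof.
apply: le_trans (favg_gap_le x).
have -> : mu ^+ 2 * sqn (x - xstar) = 2 * mu * (mu / 2 * sqn (x - xstar)) by field.
by rewrite ler_pM2l ?mulr_gt0 // favg_gap_ge.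
Qed.

Lemma inf_favg : inf (range F) = F xstar.
Proof.
apply/eqP; rewrite eq_le; apply/andP; split.
  by apply: ge_inf; [exists (F xstar) => _ [y _ <-]; apply: f_min | exists xstar].
by apply: lb_le_inf; [exists (F xstar), xstar | move=> _ [y _ <-]; apply: f_min].
Qed.

End AverageObjective.

(** * Borel measurability of vector-valued maps *)

Section BorelVectors.
Context {R : realType} {p : nat}.

(** An open set is the union of the countably many rational boxes that it
    contains. *)
Lemma measurable_fun_rV d (T : measurableType d) (X : T -> 'rV[R]_p) :
  (forall j, measurable_fun setT (fun w => X w 0 j)) ->
  measurable_fun setT (X : T -> borel R p).
Proof.
move=> mX; apply: (@measurability _ _ T (borel R p) setT X (@open 'rV[R]_p)) => //.
move=> _ [U oU <-]; rewrite setTI.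
pose box (a : 'rV[rat]_p * rat) :=
  [set y : 'rV[R]_p | forall j, ratr (a.1 0 j) - ratr a.2 < y 0 j < ratr (a.1 0 j) + ratr a.2].
pose V (a : 'rV[rat]_p * rat) := if `[< box a `<=` U >] then box a else set0.
have UV : U = \bigcup_a V a.
  apply/seteqP; split => [x Ux|x [a _]]; last first.
    by rewrite /V; case: asboolP => // aU /aU.
  have /nbhs_ballP[e /= e0 eU] := oU _ Ux.
  have [r] := rat_in_itvoo (divr_gt0 e0 (ltr0Sn R 1)).
  rewrite in_itv /= => /andP[r0 re].
  have : forall j, exists q : rat, ratr q \in `](x 0 j - ratr r), (x 0 j + ratr r)[.
    by move=> j; apply: rat_in_itvoo; lra.
  move=> /choice[q qx].
  have bx : box (\row_j q j, r) x.
    by move=> j; rewrite mxE /=; have := qx j; rewrite in_itv /= => /andP[? ?]; lra.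
  exists (\row_j q j, r) => //; rewrite /V; case: asboolP => // -[].
  move=> y yb; apply: eU; split => // i j; rewrite ord1 /ball /=.
  have := yb j; have := bx j; rewrite !mxE /= => /andP[a b] /andP[c dd].
  rewrite ltr_norml; lra.
rewrite UV preimage_bigcup; apply: countable_bigcupT_measurable.
  exact: countableP.
move=> a; rewrite /V; case: asboolP => _; last by rewrite preimage_set0.
have -> : X @^-1` box a = \bigcap_j
   ((fun w => X w 0 j) @^-1` `](ratr (a.1 0 j) - ratr a.2), (ratr (a.1 0 j) + ratr a.2)[%classic).
  apply/seteqP; split => w /= h j; first by move=> _; rewrite /= in_itv /= h.
  by have := h j I; rewrite /= in_itv.
apply: fin_bigcap_measurable; first exact: finite_finset.
by move=> j _; rewrite -[X in measurable X]setTI; apply: mX.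
Qed.

Lemma continuous_measurable_rV (phi : 'rV[R]_p -> R) : continuous phi ->
  measurable_fun setT (phi : borel R p -> R).
Proof.
move=> cphi; apply: (@measurability _ _ (borel R p) R setT phi _ (measurable_realfun.RGenOpens.measurableE R)).
move=> _ [_ [a [b ->]] <-]; rewrite setTI; apply: sub_sigma_algebra.
by have /continuousP := cphi; apply; exact: interval_open.
Qed.

Lemma measurable_comp_rV d (T : measurableType d) (X : T -> 'rV[R]_p) phi :
  (forall j, measurable_fun setT (fun w => X w 0 j)) -> continuous phi ->
  measurable_fun setT (fun w => phi (X w) : R).
Proof.
move=> mX cphi; have h := measurableT_comp (continuous_measurable_rV cphi) (measurable_fun_rV mX).
exact: h.
Qed.

(** The topology of row vectors is given by the sup norm, which the Euclidean
    norm exceeds by a factor at most [p]; hence the constants. *)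
Lemma lipschitz_grad_continuous L (f : 'rV[R]_p -> R) j :
  lipschitz_grad L f -> continuous (fun v => grad f v 0 j).
Proof.
move=> hL x; apply/(@cvgrPdist_le _ _ _ (nbhs x) (nbhs_filter x)) => e e0.
have K0 : 0 < `|L| * p%:R + 1 by rewrite ltr_wpDl // mulr_ge0.
pose e' := e / (`|L| * p%:R + 1); have d0 : 0 < e' by rewrite divr_gt0.
near=> y.
have yb : ball x (e') y by near: y; apply: nbhsx_ballx.
have xy k : `|x 0 k - y 0 k| <= e' by apply/ltW/(yb.2 0 k).
have h1 : `|grad f x 0 j - grad f y 0 j| ^+ 2 <= sqn (grad f x - grad f y).
  rewrite real_normK ?num_real // /sqn /ip big_ord1 (bigD1 j) //= !mxE -expr2.
  by rewrite lerDl sumr_ge0 // => k _; rewrite -expr2 sqr_ge0.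
have h2 := sqn_le_fnorm (hL x y).
have h3 : sqn (x - y) <= (p%:R * (e')) ^+ 2.
  apply: (@le_trans _ _ (p%:R * (e') ^+ 2)).
    rewrite /sqn /ip big_ord1 mulr_natl -[in leRHS](card_ord p) -sumr_const.
    apply: ler_sum => k _; rewrite !mxE -expr2 -real_normK ?num_real //.
    by rewrite ler_sqr ?nnegrE ?(ltW d0) //; exact: xy.
  rewrite [leRHS]exprMn ler_wpM2r ?sqr_ge0 //.
  by rewrite -natrX ler_nat -{1}(expn1 p); case: p => // q; rewrite leq_pexp2l.
have h4 : `|grad f x 0 j - grad f y 0 j| <= `|L| * (p%:R * e').
  rewrite -ler_sqr ?nnegrE ?(mulr_ge0 (normr_ge0 _)) ?(mulr_ge0 _ (ltW d0)) //.
  apply: le_trans (le_trans h1 h2) _.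
  by rewrite [leRHS]exprMn real_normK ?num_real // ler_wpM2l ?sqr_ge0.
apply: le_trans h4 _; rewrite mulrA /e' mulrCA ger_pMr //.
by rewrite ler_pdivrMr // mul1r lerDl.
Unshelve. all: by end_near.
Qed.

End BorelVectors.

(** * Expectations of real random variables *)

Section RealExpectation.
Context {d : measure_display} {T : measurableType d} {R : realType}.
Variable P : probability T R.

Definition integ (X : T -> R) : Prop := P.-integrable setT (EFin \o X).

Definition Ex (X : T -> R) : R := \int[P]_(w in setT) X w.

Lemma ExpE X : integ X -> ('E_P[X] = (Ex X)%:E)%E.
Proof.
move=> iX; rewrite unlock /Ex /Rintegral fineK //.
exact: integrable_fin_num.
Qed.

Lemma integ_meas X : integ X -> measurable_fun setT X.
Proof. by move=> /measurable_int/measurable_EFinP. Qed.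

Lemma eq_integ X Y : X =1 Y -> integ X -> integ Y.
Proof. by move=> /funext ->. Qed.

Lemma eq_Ex X Y : X =1 Y -> Ex X = Ex Y.
Proof. by move=> /funext ->. Qed.

Lemma integD X Y : integ X -> integ Y -> integ (fun w => X w + Y w).
Proof. by move=> iX iY; exact: (@integrableD _ _ _ P _ measurableT _ _ iX iY). Qed.

Lemma ExD X Y : integ X -> integ Y -> Ex (fun w => X w + Y w) = Ex X + Ex Y.
Proof. by move=> iX iY; exact: RintegralD. Qed.

Lemma integZ a X : integ X -> integ (fun w => a * X w).
Proof. by move=> iX; exact: (@integrableZl _ _ _ P _ measurableT a _ iX). Qed.

Lemma ExZ a X : integ X -> Ex (fun w => a * X w) = a * Ex X.
Proof. by move=> iX; exact: RintegralZl. Qed.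

Lemma integN X : integ X -> integ (fun w => - X w).
Proof. by move/(integZ (-1)); apply: eq_integ => w; rewrite mulN1r. Qed.

Lemma ExN X : integ X -> Ex (fun w => - X w) = - Ex X.
Proof.
by move=> iX; rewrite -mulN1r -ExZ //; apply: eq_Ex => w; rewrite mulN1r.
Qed.

Lemma integB X Y : integ X -> integ Y -> integ (fun w => X w - Y w).
Proof. by move=> iX /integN; exact: integD. Qed.

Lemma ExB X Y : integ X -> integ Y -> Ex (fun w => X w - Y w) = Ex X - Ex Y.
Proof. by move=> iX iY; rewrite ExD ?ExN //; exact: integN. Qed.

Lemma integ_cst a : integ (fun=> a).
Proof. exact: finite_measure_integrable_cst. Qed.

Lemma Ex_cst a : Ex (fun=> a) = a.
Proof. by rewrite /Ex Rintegral_cst // [X in fine X](@probability_setT _ _ _ P) mulr1. Qed.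

Lemma integ_sum I (r : seq I) (X : I -> T -> R) :
  (forall i, integ (X i)) -> integ (fun w => \sum_(i <- r) X i w).
Proof.
move=> iX; elim: r => [|i r ih].
  by apply: eq_integ (integ_cst 0) => w; rewrite big_nil.
by apply: eq_integ (integD (iX i) ih) => w; rewrite big_cons.
Qed.

Lemma Ex_sum I (r : seq I) (X : I -> T -> R) : (forall i, integ (X i)) ->
  Ex (fun w => \sum_(i <- r) X i w) = \sum_(i <- r) Ex (X i).
Proof.
move=> iX; elim: r => [|i r ih].
  by rewrite big_nil -[RHS](Ex_cst 0); apply: eq_Ex => w; rewrite big_nil.
rewrite big_cons -ih -ExD //; last exact: integ_sum.
by apply: eq_Ex => w; rewrite big_cons.
Qed.

Lemma Ex_le X Y : integ X -> integ Y -> (forall w, X w <= Y w) -> Ex X <= Ex Y.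
Proof. by move=> iX iY XY; apply: le_Rintegral. Qed.

(** A linear combination of random variables is encoded by the list of its
    weighted terms: integrability is then checked term by term, and a pointwise
    bound becomes a bound between explicit combinations of expectations. *)
Definition lin_integ (s : seq (R * (T -> R))) : Prop :=
  foldr (fun z A => integ z.2 /\ A) True s.
Definition lin_fun (s : seq (R * (T -> R))) (w : T) : R :=
  foldr (fun z a => z.1 * z.2 w + a) 0 s.
Definition lin_Ex (s : seq (R * (T -> R))) : R :=
  foldr (fun z a => z.1 * Ex z.2 + a) 0 s.

Lemma lin_funP s : lin_integ s -> integ (lin_fun s) /\ Ex (lin_fun s) = lin_Ex s.
Proof.
elim: s => [_|[a X] s ih /= [iX /ih[iS eS]]].
  by split; [exact: integ_cst | exact: Ex_cst].
split; first by apply: integD => //; exact: integZ.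
by rewrite ExD ?ExZ ?eS //; exact: integZ.
Qed.

Lemma Ex_le_lin X s : integ X -> lin_integ s -> (forall w, X w <= lin_fun s w) ->
  Ex X <= lin_Ex s.
Proof. by move=> iX /lin_funP[iS <-]; exact: Ex_le. Qed.

Lemma Ex_ge0 X : (forall w, 0 <= X w) -> 0 <= Ex X.
Proof. by move=> X0; apply: Rintegral_ge0. Qed.

Lemma integ_le (X Y : T -> R) : measurable_fun setT X -> integ Y ->
  (forall w, `|X w| <= Y w) -> integ X.
Proof.
move=> mX iY XY; apply: (@le_integrable _ _ _ P _ measurableT _ (EFin \o Y)) => //.
  exact/measurable_EFinP.
by move=> w _ /=; rewrite lee_fin (le_trans (XY w)) // ler_norm.
Qed.

Lemma Ex_lim0 (X_ : nat -> T -> R) (X Y : T -> R) :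
  (forall n, measurable_fun setT (X_ n)) -> measurable_fun setT X ->
  (forall w, (fun n => X_ n w) @ \oo --> X w) -> integ Y ->
  (forall n w, `|X_ n w| <= Y w) -> (forall n, Ex (X_ n) = 0) -> Ex X = 0.
Proof.
move=> mX_ mX cX iY bX X0.
have iX_ n : integ (X_ n) by apply: integ_le iY _.
have [||||iX _ h] := @dominated_convergence _ _ _ P _ measurableT
    (fun n => EFin \o X_ n) (EFin \o X) (EFin \o Y) _ _ _ iY.
- by move=> n; exact/measurable_EFinP.
- exact/measurable_EFinP.
- by apply: aeW => w _; apply: cvg_EFin; [exact: nearW | exact: cX].
- by apply: aeW => w n _; rewrite lee_fin bX.
have E n : (\int[P]_(x in setT) (X_ n x)%:E = 0)%E.
  have := X0 n; rewrite /Ex /Rintegral => /eqP; rewrite fine_eq0; first by move/eqP.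
  exact: (integrable_fin_num measurableT (iX_ n)).
have : (\int[P]_(x in setT) (X x)%:E = 0)%E.
  apply: (cvg_unique (@ereal_hausdorff R) h).
  suff -> : [sequence (\int[P]_(x in setT) (EFin \o X_ n) x)%E]_n = cst 0%E by exact: cvg_cst.
  by apply/funext => n; exact: E.
by rewrite /Ex /Rintegral => ->.
Qed.

Lemma set_integralE A X : measurable A ->
  (\int[P]_(w in A) (X w)%:E = \int[P]_w (\1_A w * X w)%:E)%E.
Proof.
move=> mA; rewrite integral_mkcond; apply: eq_integral => w _.
rewrite patchE indicE; case: ifPn => /= _; first by rewrite mul1r.
by rewrite mul0r.
Qed.

Lemma integ_indicM A X : measurable A -> integ X -> integ (fun w => \1_A w * X w).
Proof.
move=> mA iX; apply: (@integ_le _ (fun w => `|X w|)).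
- by apply: measurable_funM; [exact: measurable_indic | exact: integ_meas].
- exact: integrable_norm.
- by move=> w; rewrite normrM indicE ler_piMl //; case: (_ \in _); rewrite ?normr1 ?normr0.
Qed.

End RealExpectation.

(** * Zero mean on the events of a sigma-algebra *)

(** Measurability for the sigma-algebra generated by [G]; the parameter is the
    generator because monotone class arguments start from it. *)
Definition adapted {d d'} {T : measurableType d} {U : measurableType d'}
    (G : set_system T) (X : T -> U) : Prop :=
  @measurable_fun _ _ (g_sigma_algebraType G) U setT X.

Section Conditioning.
Context {d : measure_display} {T : measurableType d} {R : realType}.
Variable P : probability T R.
Local Notation Ex := (Ex P).
Local Notation integ := (integ P).
Implicit Types (G : set_system T) (X Y h : T -> R).

Lemma sub_sigma G : G `<=` measurable -> <<s G>> `<=` (measurable : set_system T).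
Proof.
move=> hG; apply: smallest_sub => //; split; first exact: measurable0.
  by move=> A mA; rewrite setTD; exact: measurableC.
by move=> F mF; exact: bigcupT_measurable.
Qed.

Lemma adapted_preimage G X (B : set R) : adapted G X -> measurable B -> <<s G>> (X @^-1` B).
Proof. by move=> aX mB; rewrite -[_ @^-1` _]setTI; exact: aX. Qed.

Lemma adapted_measurable d' (U : measurableType d') G (X : T -> U) :
  G `<=` measurable -> adapted G X -> measurable_fun setT X.
Proof. by move=> hG aX _ B mB; apply: (sub_sigma hG); exact: aX. Qed.

Lemma adapted_sub d' (U : measurableType d') G G' (X : T -> U) :
  G `<=` <<s G'>> -> adapted G X -> adapted G' X.
Proof.
move=> hG aX _ B mB; have := aX measurableT B mB; apply: smallest_sub => //.
exact: smallest_sigma_algebra.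
Qed.

Lemma Ex_simpleM G (g : {nnsfun g_sigma_algebraType G >-> R}) X :
  G `<=` measurable -> integ X -> (forall A, <<s G>> A -> Ex (fun w => \1_A w * X w) = 0) ->
  Ex (fun w => g w * X w) = 0.
Proof.
move=> hG iX X0.
have mg y : <<s G>> (g @^-1` [set y]) by exact: (measurable_funPTI g).
have E : (fun w : T => g w * X w) =1
  (fun w : T => \sum_(y <- fset_set (range g)) y * (\1_(g @^-1` [set y]) w * X w)).
  move=> w; rewrite fimfunE fsbig_finite //= mulr_suml.
  by apply: eq_bigr => y _; rewrite mulrA.
have iy y : integ (fun w => y * (\1_(g @^-1` [set y]) w * X w)).
  by apply/integZ/integ_indicM => //; exact: sub_sigma (mg y).
rewrite (eq_Ex P E) Ex_sum //; apply: big1 => y _.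
by rewrite ExZ ?X0 ?mulr0 //; apply: integ_indicM => //; exact: sub_sigma (mg y).
Qed.

(** If [X] has zero mean on every event of a sigma-algebra, it is orthogonal
    to every function measurable for it: approximate that function by simple
    functions and pass to the limit under the domination by the product. *)
Lemma Ex_pullout G X h : G `<=` measurable -> integ X ->
  (forall A, <<s G>> A -> Ex (fun w => \1_A w * X w) = 0) ->
  adapted G h -> integ (fun w => h w * X w) -> Ex (fun w => h w * X w) = 0.
Proof.
move=> hG iX X0.
have pos (k : T -> R) : adapted G k -> (forall w, 0 <= k w) -> integ (fun w => k w * X w) ->
    Ex (fun w => k w * X w) = 0.
  move=> ak k0 ikX; have mk := adapted_measurable hG ak.
  have [||g [gle gcvg]] := @approximation _ (g_sigma_algebraType G) R setT
     (@measurableT _ _) (EFin \o k).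
  - exact/measurable_EFinP.
  - by move=> w _; rewrite lee_fin k0.
  have gc w : (fun n => g n w) @ \oo --> k w by have /fine_cvgP[_] := gcvg w I.
  have gk n w : g n w <= k w.
    rewrite -(cvg_lim (@Rhausdorff R) (gc w)).
    apply: nondecreasing_cvgn_le; last by apply/cvg_ex; exists (k w).
    by move=> a b ab; have /lefP/(_ w) := gle _ _ ab.
  apply: (@Ex_lim0 _ _ _ P (fun n w => g n w * X w) _ (fun w => `|k w * X w|)).
  - move=> n; apply: measurable_funM; last exact: integ_meas iX.
    by apply: (adapted_measurable hG); exact: measurable_funPT.
  - exact: integ_meas ikX.
  - by move=> w; apply: cvgMl; exact: gc.
  - exact: integrable_norm.
  - move=> n w; rewrite !normrM ler_wpM2r // ger0_norm; last exact: fun_ge0.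
    by rewrite ger0_norm.
  - by move=> n; exact: Ex_simpleM.
move=> ah ihX; have mh := adapted_measurable hG ah.
have hE w : h w * X w = h^\+ w * X w - h^\- w * X w.
  by rewrite -mulrBl -[in LHS](funrposBneg h).
have ip : integ (fun w => h^\+ w * X w).
  apply: (@integ_le _ _ _ P _ (fun w => `|h w * X w|)).
  - by apply: measurable_funM; [exact: measurable_funrpos | exact: integ_meas iX].
  - exact: integrable_norm.
  - move=> w; rewrite !normrM ler_wpM2r // ger0_norm ?funrpos_ge0 //.
    by rewrite /funrpos maxElt; case: ifP => // _; exact: ler_norm.
have iN : integ (fun w => h^\- w * X w).
  apply: (eq_integ _ (integB ip ihX)) => w; rewrite hE; ring.
have e1 : Ex (fun w => h^\+ w * X w) = 0.
  by apply: pos ip; [exact: measurable_funrpos | move=> w; exact: funrpos_ge0].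
have e2 : Ex (fun w => h^\- w * X w) = 0.
  apply: pos iN; first exact: measurable_funrneg.
  by move=> w; rewrite -funrposN funrpos_ge0.
by rewrite (eq_Ex _ hE) ExB // e1 e2 subrr.
Qed.

(** By dominated convergence along increasing unions, the events on which [X]
    has zero mean form a lambda-system. *)
Lemma Ex_pi_lambda G X : G `<=` measurable -> setI_closed G -> G setT -> integ X ->
  (forall A, G A -> Ex (fun w => \1_A w * X w) = 0) ->
  forall A, <<s G>> A -> Ex (fun w => \1_A w * X w) = 0.
Proof.
move=> hG IG TG iX X0.
pose H : set_system T := [set A | measurable A /\ Ex (fun w => \1_A w * X w) = 0].
suff h : <<s G>> `<=` H by move=> A /h[].
apply: lambda_system_subset => //; last by move=> A GA; split; [exact: hG | exact: X0].
split=> //.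
- by split=> //; exact: X0.
- move=> A B BA [mA A0] [mB B0]; split; first exact: measurableD.
  have E w : \1_(A `\` B) w * X w = \1_A w * X w - \1_B w * X w.
    rewrite -mulrBl; congr (_ * _); rewrite !indicE.
    rewrite in_setD; have [/set_mem wB|_] := boolP (w \in B); last by rewrite andbT subr0.
    by rewrite (mem_set (BA _ wB)) subrr.
  by rewrite (eq_Ex _ E) ExB ?A0 ?B0 ?subr0 //; exact: integ_indicM.
- move=> F ndF HF; have mU : measurable (\bigcup_i F i).
    by apply: bigcupT_measurable => i; have [] := HF i.
  split=> //; apply: (@Ex_lim0 _ _ _ P (fun n w => \1_(F n) w * X w) _ (fun w => `|X w|)).
  + by move=> n; apply: (@integ_meas _ _ _ P); apply: integ_indicM => //; have [] := HF n.
  + by apply: (@integ_meas _ _ _ P); exact: integ_indicM.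
  + move=> w; apply: cvgMl; apply: cvg_near_cst.
    have [[i _ Fi]|nF] := pselect ((\bigcup_i F i) w).
      exists i => // n /= ni; have Fn : F n w by have /subsetPset := ndF _ _ ni; apply.
      by rewrite !indicE !mem_set //; exists i.
    apply: nearW => n; rewrite !indicE !memNset // => Fn.
    by apply: nF; exists n.
  + exact: integrable_norm.
  + move=> n w; rewrite normrM ler_piMl // indicE.
    by case: (_ \in _); rewrite ?normr1 ?normr0.
  + by move=> n; have [] := HF n.
Qed.

End Conditioning.

(** * Conditional independence of the samples *)

Section ConditionalMean.
Context {d : measure_display} {T : measurableType d} {R : realType}.
Variable P : probability T R.
Local Notation Ex := (Ex P).
Local Notation integ := (integ P).
Implicit Types (G : set_system T) (X Y h : T -> R).

Lemma indicM (A B : set T) w : \1_A w * \1_B w = \1_(A `&` B) w :> R.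
Proof. by rewrite !indicE in_setI -natrM mulnb. Qed.

Lemma indic_le1 (A : set T) w : 0 <= (\1_A w : R) <= 1.
Proof. by rewrite indicE; case: (_ \in _); rewrite ?lexx ?ler01. Qed.

Lemma integ_boundedM h X : measurable_fun setT h -> (forall w, 0 <= h w <= 1) ->
  integ X -> integ (fun w => h w * X w).
Proof.
move=> mh h01 iX; apply: (@integ_le _ _ _ P _ (fun w => `|X w|)).
- by apply: measurable_funM => //; exact: integ_meas iX.
- exact: integrable_norm.
- by move=> w; case/andP: (h01 w) => h0 h1; rewrite normrM ger0_norm // ler_piMl.
Qed.

Lemma integ_bounded h : measurable_fun setT h -> (forall w, 0 <= h w <= 1) -> integ h.
Proof.
move=> mh h01; apply: eq_integ (integ_boundedM mh h01 (integ_cst P 1)) => w.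
by rewrite mulr1.
Qed.

(** The conditional expectation of [X] given the sigma-algebra generated by
    [G] vanishes. Only events of the past occur, so that no version has to be
    chosen. *)
Definition centered G X := integ X /\ forall A, <<s G>> A -> Ex (fun w => \1_A w * X w) = 0.

Lemma cexp_centered G X Y : G `<=` measurable -> is_cexp P <<s G>> X Y ->
  centered G (fun w => X w - Y w).
Proof.
move=> hG [iX iY _ hI]; split; first exact: integB.
move=> A GA; have mA := sub_sigma hG GA.
have := hI A GA; rewrite !(set_integralE P _ mA) => e.
have E : (fun w => \1_A w * (X w - Y w)) =1 (fun w => \1_A w * X w - \1_A w * Y w).
  by move=> w; rewrite mulrBr.
rewrite (eq_Ex _ E) ExB; [|exact: integ_indicM..].
by rewrite /Ex /Rintegral e subrr.
Qed.

Lemma cexp_adapted G X Y : is_cexp P <<s G>> X Y -> adapted G Y.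
Proof. by move=> [_ _ mY _] _ B mB; rewrite setTI; exact: mY. Qed.

Lemma cexp_Ex G X Y : is_cexp P <<s G>> X Y -> Ex X = Ex Y.
Proof.
by move=> [_ _ _ /(_ setT)]; rewrite /Ex /Rintegral => -> //; exact: (@measurableT _ (g_sigma_algebraType G)).
Qed.

Lemma centeredN G X : G `<=` measurable -> centered G X -> centered G (fun w => - X w).
Proof.
move=> hG [iX X0]; split; first exact: integN.
move=> A GA; have E : (fun w => \1_A w * - X w) =1 (fun w => - (\1_A w * X w)).
  by move=> w; rewrite mulrN.
rewrite (eq_Ex _ E) ExN ?X0 ?oppr0 //.
by apply: integ_indicM => //; exact: sub_sigma GA.
Qed.

(** A strictly negative value on an event of positive probability would make
    the mean over that event negative. *)
Lemma centered_ae_ge0 G X Y : G `<=` measurable -> adapted G Y ->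
  centered G (fun w => X w - Y w) -> (forall w, 0 <= X w) -> {ae P, forall w, 0 <= Y w}.
Proof.
move=> hG aY [iXY XY0] X0.
pose A := Y @^-1` `]-oo, 0[%classic.
have GA : <<s G>> A by apply: adapted_preimage => //; exact: measurable_itv.
pose V w := \1_A w * (X w - Y w).
have V0 w : 0 <= V w.
  rewrite /V indicE; have [/set_mem|_] := boolP (w \in A); last by rewrite mul0r.
  by rewrite /A /= in_itv /= => Yw; rewrite mul1r; have := X0 w; lra.
have iV : integ V by apply: integ_indicM => //; exact: sub_sigma GA.
have : (\int[P]_(w in setT) `|(EFin \o V) w| = 0)%E.
  have := XY0 A GA; rewrite -/V /Ex /Rintegral => /eqP.
  rewrite fine_eq0 ?(integrable_fin_num measurableT iV) // => /eqP <-.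
  by apply: eq_integral => w _; rewrite /= ger0_norm.
move/(ae_eq_integral_abs _ measurableT (measurable_int _ iV)).1.
apply: filterS => w /(_ I) [Vw]; rewrite leNgt; apply/negP => Yw.
have : V w > 0.
  rewrite /V indicE mem_set /A /=; last by rewrite in_itv.
  by rewrite mul1r; have := X0 w; lra.
by rewrite Vw ltxx.
Qed.

Lemma ae_eq_Ex X Y : measurable_fun setT X -> measurable_fun setT Y ->
  {ae P, forall w, X w = Y w} -> Ex X = Ex Y.
Proof.
move=> mX mY h; rewrite /Ex /Rintegral; congr fine; apply: ae_eq_integral => //.
- exact/measurable_EFinP.
- exact/measurable_EFinP.
- by apply: filterS h => w e _; rewrite /= e.
Qed.

Lemma Ex_ae_le X Y : integ X -> integ Y -> {ae P, forall w, X w <= Y w} -> Ex X <= Ex Y.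
Proof.
move=> iX iY h.
have mZ : measurable_fun setT (fun w => Num.max (X w) (Y w)).
  by apply: measurable_maxr; [exact: integ_meas iX | exact: integ_meas iY].
have -> : Ex Y = Ex (fun w => Num.max (X w) (Y w)).
  apply: ae_eq_Ex => //; first exact: integ_meas iY.
  by apply: filterS h => w XY; rewrite max_r.
apply: Ex_le => //; last by move=> w; rewrite le_max lexx.
apply: (@integ_le _ _ _ P _ (fun w => `|X w| + `|Y w|)) => //.
  by apply: integD; exact: integrable_norm.
by move=> w; rewrite maxElt; case: ifP => _; rewrite ?lerDl ?lerDr.
Qed.

End ConditionalMean.

Section ConditionalIndependence.
Context {d dS : measure_display} {T : measurableType d} {S : measurableType dS}
  {R : realType}.
Variables (P : probability T R) (G : set_system T) (n : nat) (xi : 'I_n -> T -> S).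
Hypothesis hG : G `<=` measurable.
Hypothesis mxi : forall i, measurable_fun setT (xi i).
Hypothesis cxi : cond_independent P <<s G>> xi.
Local Notation Ex := (Ex P).
Local Notation integ := (integ P).
Local Notation centered := (centered P).

Let mpre i A : measurable A -> measurable (xi i @^-1` A).
Proof. by move=> mA; rewrite -[X in measurable X]setTI; exact: mxi. Qed.

(* Versions of conditional probabilities lie in the unit interval only almost
   surely; clipping them makes their products integrable at once. *)
Let clip (x : R) : R := Num.min 1 (Num.max 0 x).

Let clip01 x : 0 <= clip x <= 1.
Proof. by rewrite /clip ge_min lexx /= andbT le_min ler01 le_max lexx. Qed.

Let clip_id x : 0 <= x <= 1 -> clip x = x.
Proof. by move=> /andP[x0 x1]; rewrite /clip max_r // min_r. Qed.

Let indic_cexp_ae E q : measurable E -> is_cexp P <<s G>> (\1_E : T -> R) q ->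
  {ae P, forall w, 0 <= q w <= 1}.
Proof.
move=> mE cq; have aq := cexp_adapted cq; have [iq q0] := cexp_centered hG cq.
have h1 : {ae P, forall w, 0 <= q w}.
  by apply: (centered_ae_ge0 hG aq (conj iq q0)) => w; case/andP: (@indic_le1 _ _ R E w).
have h2 : {ae P, forall w, 0 <= 1 - q w}.
  apply: (@centered_ae_ge0 _ _ _ P G (fun w => 1 - \1_E w) (fun w => 1 - q w)) => //.
  - by apply: measurable_funB => //; exact: measurable_cst.
  - have := centeredN hG (conj iq q0).
    by rewrite (_ : (fun w => - _) = (fun w => 1 - \1_E w - (1 - q w))) //;
       apply/funext => w; ring.
by apply: (@filterS2 _ _ (ae_filter_ringOfSetsType P) _ _ _ _ h1 h2) => w a b; rewrite a -subr_ge0.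
Qed.

Let full_cexp_ae q : is_cexp P <<s G>> (\1_[set: T] : T -> R) q ->
  {ae P, forall w, q w = 1}.
Proof.
move=> cq; have aq := cexp_adapted cq; have [iq q0] := cexp_centered hG cq.
have h1 := indic_cexp_ae measurableT cq.
have h2 : {ae P, forall w, 0 <= q w - 1}.
  apply: (@centered_ae_ge0 _ _ _ P G (fun w => \1_[set: T] w - 1) (fun w => q w - 1)) => //.
  - by apply: measurable_funB => //; exact: measurable_cst.
  - split; first by apply: eq_integ iq => w; ring.
    by move=> A GA; rewrite -(q0 A GA); apply: eq_Ex => w; congr (_ * _); ring.
  - by move=> w; rewrite indicT subrr.
by apply: (@filterS2 _ _ (ae_filter_ringOfSetsType P) _ _ _ _ h1 h2) => w /andP[_ a] b; apply/eqP; rewrite eq_le a -subr_ge0.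
Qed.

(** Taking the whole space as the event of every other sample leaves two
    factors in the product rule, as the conditional probability of the whole
    space is almost surely one. *)
Lemma cond_indep_pair i j A B : i != j -> measurable A -> measurable B ->
  exists a b : T -> R,
  [/\ adapted G a /\ (forall w, 0 <= a w <= 1),
      adapted G b /\ (forall w, 0 <= b w <= 1),
      centered G (fun w => \1_(xi i @^-1` A) w - a w),
      centered G (fun w => \1_(xi j @^-1` B) w - b w) &
      centered G (fun w => \1_(xi i @^-1` A) w * \1_(xi j @^-1` B) w - a w * b w)].
Proof.
move=> ij mA mB.
pose C k := if k == i then A else if k == j then B else setT.
have mC k : measurable (C k) by rewrite /C; case: ifP => // _; case: ifP.
have [q [cq cqp]] := cxi mC.
have mq k := adapted_measurable hG (cexp_adapted (cq k)).
have aclip k : adapted G (fun w => clip (q k w)).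
  have ak := cexp_adapted (cq k).
  by apply: measurable_minr; [exact: measurable_cst |
     apply: measurable_maxr => //; exact: measurable_cst].
have mclip k := adapted_measurable hG (aclip k).
have q01 k := indic_cexp_ae (mpre _ (mC k)) (cq k).
have qclip k : {ae P, forall w, q k w = clip (q k w)}.
  by apply: filterS (q01 k) => w /clip_id ->.
have cc k : centered G (fun w => \1_(xi k @^-1` C k) w - clip (q k w)).
  have [i0 h0] := cexp_centered hG (cq k).
  have ick : integ (fun w => clip (q k w)) by apply: integ_bounded.
  have i1 : integ (\1_(xi k @^-1` C k) : T -> R) by case: (cq k).
  split; first exact: integB.
  move=> F GF; rewrite -(h0 F GF); have mF := sub_sigma hG GF.
  apply: ae_eq_Ex; [apply: (@integ_meas _ _ _ P)..|].
  - by apply: integ_indicM => //; exact: integB.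
  - exact: integ_indicM.
  - by apply: filterS (qclip k) => w <-.
exists (fun w => clip (q i w)), (fun w => clip (q j w)).
have Ci : C i = A by rewrite /C eqxx.
have Cj : C j = B by rewrite /C eq_sym (negbTE ij) eqxx.
split; [by split|by split|by have := cc i; rewrite Ci|by have := cc j; rewrite Cj|].
have Eind : (\1_(\bigcap_k (xi k @^-1` C k)) : T -> R) =
    (fun w => \1_(xi i @^-1` A) w * \1_(xi j @^-1` B) w).
  apply/funext => w; rewrite indicM; congr (\1_ _ w); apply/seteqP; split => [u h|u [ui uj] k _].
    by split; [have := h i I; rewrite Ci | have := h j I; rewrite Cj].
  by rewrite /C; case: eqP => [->//|_]; case: eqP => [->|].
have [i0 h0] := cexp_centered hG cqp; rewrite Eind in i0 h0 cqp.
have iAB : integ (fun w => \1_(xi i @^-1` A) w * \1_(xi j @^-1` B) w) by case: cqp.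
have iab : integ (fun w => clip (q i w) * clip (q j w)).
  by apply: integ_boundedM => //; exact: integ_bounded.
split; first exact: integB.
move=> F GF; rewrite -(h0 F GF); have mF := sub_sigma hG GF.
apply: ae_eq_Ex; [apply: (@integ_meas _ _ _ P)..|].
- by apply: integ_indicM => //; exact: integB.
- exact: integ_indicM.
have h1 k : {ae P, forall w, k != i -> k != j -> q k w = 1}.
  have [->|ki] := eqVneq k i; first by apply: aeW.
  have [->|kj] := eqVneq k j; first by apply: aeW.
  have := cq k; rewrite /C (negbTE ki) (negbTE kj) preimage_setT => /full_cexp_ae.
  by apply: filterS.
have : {ae P, forall w, forall k, k != i -> k != j -> q k w = 1}.
  by apply: filter_forall.
move=> h2.
apply: (@filterS3 _ _ (ae_filter_ringOfSetsType P) _ _ _ _ _ (qclip i) (qclip j) h2).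
move=> w <- <- {}h2.
rewrite (bigD1 i) //= (bigD1 j) //=; last by rewrite eq_sym.
by rewrite big1 ?mulr1 // => k /andP[ki kj]; exact: h2.
Qed.

(** A generator, closed under intersections, of the sigma-algebra of the past
    together with one sample. *)
Definition sample_rectangles i : set_system T :=
  [set E | exists F, exists2 A, <<s G>> F /\ measurable A & E = F `&` xi i @^-1` A].

Let rect_measurable i : sample_rectangles i `<=` measurable.
Proof.
by move=> _ [F [A [/(sub_sigma hG) mF mA] ->]]; apply: measurableI => //; exact: mpre.
Qed.

Let rect_setI i : setI_closed (sample_rectangles i).
Proof.
move=> _ _ [F [A [GF mA] ->]] [F' [A' [GF' mA'] ->]].
exists (F `&` F'), (A `&` A').
  by split; [exact: (@measurableI _ (g_sigma_algebraType G)) | exact: measurableI].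
by rewrite preimage_setI setIACA.
Qed.

Let rect_setT i : sample_rectangles i setT.
Proof.
exists setT, setT; last by rewrite preimage_setT setTI.
by split => //; exact: (@measurableT _ (g_sigma_algebraType G)).
Qed.

Let rect_sub i : G `<=` <<s sample_rectangles i>>.
Proof.
move=> F GF; apply: sub_sigma_algebra; exists F, setT.
  by split => //; exact: sub_sigma_algebra.
by rewrite preimage_setT setIT.
Qed.

(** Given the past, what is measurable for the past and one sample is
    uncorrelated with what is measurable for the past and another sample and
    centered.  Two monotone class extensions, one per sample, reduce this to
    rectangles, where it is the product rule. *)
Lemma cond_indep_orthogonal i j (X Y : T -> R) : i != j ->
  adapted (sample_rectangles i) X -> adapted (sample_rectangles j) Y ->
  centered G Y -> integ (fun w => X w * Y w) -> Ex (fun w => X w * Y w) = 0.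
Proof.
move=> ij aX aY [iY Y0] iXY; apply: (Ex_pullout (@rect_measurable i)) => //.
apply: Ex_pi_lambda => // _ [F [A [GF mA] ->]].
have mF := sub_sigma hG GF.
have [a [_ [[aa a01] _ [ia ca] _ _]]] := cond_indep_pair ij mA (@measurableT _ S).
have ma := adapted_measurable hG aa.
pose Xa w := \1_(xi i @^-1` A) w - a w : R.
have Xa0 E : <<s sample_rectangles j>> E -> Ex (fun w => \1_E w * Xa w) = 0.
  move: E; apply: Ex_pi_lambda => // _ [F' [B [GF' mB] ->]].
  have mF' := sub_sigma hG GF'.
  have [a' [b [[aa' a'01] [ab b01] [ia' ca'] [ib cb] [iab cab]]]] := cond_indep_pair ij mA mB.
  have ma' := adapted_measurable hG aa'; have mb := adapted_measurable hG ab.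
  set IA := \1_(xi i @^-1` A) : T -> R; set IB := \1_(xi j @^-1` B) : T -> R.
  set IF := \1_F' : T -> R.
  have aF : adapted G IF by exact: (@measurable_indic _ (g_sigma_algebraType G)).
  have mIF := adapted_measurable hG aF.
  have bM (u v : T -> R) : (forall w, 0 <= u w <= 1) -> (forall w, 0 <= v w <= 1) ->
      forall w, 0 <= u w * v w <= 1.
    move=> u1 v1 w; case/andP: (u1 w) => ? ?; case/andP: (v1 w) => ? ?.
    by rewrite mulr_ge0 //= mulr_ile1.
  have z1 : Ex (fun w => IF w * (IA w * IB w - a' w * b w)) = 0 by exact: cab.
  have ha : adapted G (fun w => IF w * a w) by exact: measurable_funM.
  have hb : adapted G (fun w => IF w * b w) by exact: measurable_funM.
  have ja := adapted_measurable hG ha; have jb := adapted_measurable hG hb.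
  have ja01 := bM _ _ (indic_le1 F') a01; have jb01 := bM _ _ (indic_le1 F') b01.
  have k2 : integ (fun w => IF w * b w * (IA w - a' w)) by exact: integ_boundedM.
  have k3 : integ (fun w => IF w * b w * (IA w - a w)) by exact: integ_boundedM.
  have k4 : integ (fun w => IF w * a w * (IB w - b w)) by exact: integ_boundedM.
  have k1 : integ (fun w => IF w * (IA w * IB w - a' w * b w)).
    by apply: integ_boundedM => //; exact: indic_le1.
  have z2 := Ex_pullout hG ia' ca' hb k2.
  have z3 := Ex_pullout hG ia ca hb k3.
  have z4 := Ex_pullout hG ib cb ha k4.
  have E : (fun w => \1_(F' `&` xi j @^-1` B) w * Xa w) =1 (fun w =>
      IF w * (IA w * IB w - a' w * b w) - IF w * b w * (IA w - a' w)
      + IF w * b w * (IA w - a w) - IF w * a w * (IB w - b w)).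
    by move=> w; rewrite -indicM /Xa /IF /IA /IB; ring.
  rewrite (eq_Ex _ E) ExB //; last by apply: integD => //; exact: integB.
  by rewrite ExD ?ExB //; [rewrite z1 z2 z3 z4; ring | exact: integB].
set IF := \1_F : T -> R.
have aF : adapted G IF by exact: (@measurable_indic _ (g_sigma_algebraType G)).
have mIF := adapted_measurable hG aF.
have mY := integ_meas iY.
have iIFY : integ (fun w => IF w * Y w) by exact: integ_indicM.
have aFY : adapted (sample_rectangles j) (fun w => IF w * Y w).
  by apply: measurable_funM => //; exact: adapted_sub (@rect_sub j) aF.
have aFa : adapted G (fun w => IF w * a w) by exact: measurable_funM.
have w1 : integ (fun w => IF w * Y w * Xa w).
  have h1 : integ (fun w => \1_(xi i @^-1` A) w * (IF w * Y w)).
    by apply: integ_indicM => //; exact: mpre.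
  have h2 : integ (fun w => a w * (IF w * Y w)) by exact: integ_boundedM.
  by apply: eq_integ (integB h1 h2) => w; rewrite /Xa; ring.
have w2 : integ (fun w => IF w * a w * Y w).
  have h2 : integ (fun w => a w * (IF w * Y w)) by exact: integ_boundedM.
  by apply: eq_integ h2 => w; ring.
have z1 := Ex_pullout (@rect_measurable j) ia Xa0 aFY w1.
have z2 := Ex_pullout hG iY Y0 aFa w2.
have E : (fun w => \1_(F `&` xi i @^-1` A) w * Y w) =1
    (fun w => IF w * Y w * Xa w + IF w * a w * Y w).
  by move=> w; rewrite -indicM /Xa /IF; ring.
by rewrite (eq_Ex _ E) ExD // z1 z2 addr0.
Qed.

End ConditionalIndependence.

(** * Square integrable random matrices *)

Section MeasurableMatrices.
Context {d : measure_display} {T : measurableType d} {R : realType}.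

Definition mxmeas m n (X : T -> 'M[R]_(m, n)) : Prop :=
  forall i j, measurable_fun setT (fun w => X w i j).

Lemma mxmeas_cst m n (A : 'M[R]_(m, n)) : mxmeas (fun=> A).
Proof. by move=> i j; exact: measurable_cst. Qed.

Lemma mxmeasD m n (X Y : T -> 'M[R]_(m, n)) :
  mxmeas X -> mxmeas Y -> mxmeas (fun w => X w + Y w).
Proof.
by move=> mX mY i j; under eq_fun do rewrite mxE; exact: measurable_funD.
Qed.

Lemma mxmeasZ m n a (X : T -> 'M[R]_(m, n)) : mxmeas X -> mxmeas (fun w => a *: X w).
Proof.
by move=> mX i j; under eq_fun do rewrite mxE; apply: measurable_funM => //; exact: measurable_cst.
Qed.

Lemma mxmeasN m n (X : T -> 'M[R]_(m, n)) : mxmeas X -> mxmeas (fun w => - X w).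
Proof. by move=> mX; under eq_fun do rewrite -scaleN1r; exact: mxmeasZ. Qed.

Lemma mxmeasB m n (X Y : T -> 'M[R]_(m, n)) :
  mxmeas X -> mxmeas Y -> mxmeas (fun w => X w - Y w).
Proof. by move=> mX /mxmeasN; exact: mxmeasD. Qed.

Lemma mxmeas_mull m n k (M : 'M[R]_(k, m)) (X : T -> 'M[R]_(m, n)) :
  mxmeas X -> mxmeas (fun w => M *m X w).
Proof.
move=> mX i j; under eq_fun do rewrite mxE.
by apply: measurable_sum => l; apply: measurable_funM => //; exact: measurable_cst.
Qed.

Lemma mxmeas_row m n i (X : T -> 'M[R]_(m, n)) : mxmeas X -> mxmeas (fun w => row i (X w)).
Proof. by move=> mX i' j; under eq_fun do rewrite mxE; exact: mX. Qed.

Lemma mxmeas_rows m n (X : T -> 'M[R]_(m, n)) :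
  (forall i, mxmeas (fun w => row i (X w))) -> mxmeas X.
Proof.
move=> mX i j; have -> : (fun w => X w i j) = (fun w => row i (X w) 0 j).
  by apply/funext => w; rewrite mxE.
exact: mX.
Qed.

Lemma mxmeas_rowmean m n (X : T -> 'M[R]_(m, n)) : mxmeas X -> mxmeas (fun w => rowmean (X w)).
Proof.
move=> mX; under eq_fun do rewrite rowmeanE.
exact/mxmeasZ/mxmeas_mull.
Qed.

Lemma measurable_ip m n (X Y : T -> 'M[R]_(m, n)) :
  mxmeas X -> mxmeas Y -> measurable_fun setT (fun w => ip (X w) (Y w)).
Proof.
move=> mX mY; apply: measurable_sum => i; apply: measurable_sum => j.
exact: measurable_funM.
Qed.

Lemma mxmeas_grad L n (f : 'rV[R]_n -> R) (X : T -> 'rV[R]_n) :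
  lipschitz_grad L f -> mxmeas X -> mxmeas (fun w => grad f (X w)).
Proof.
move=> hL mX i j; rewrite ord1.
exact: (measurable_comp_rV (mX 0) (lipschitz_grad_continuous (j := j) hL)).
Qed.

Lemma mxmeas_gradF L m n (f : 'I_m -> 'rV[R]_n -> R) (X : T -> 'M[R]_(m, n)) :
  (forall i, lipschitz_grad L (f i)) -> mxmeas X -> mxmeas (fun w => gradF f (X w)).
Proof.
move=> hL mX; apply: mxmeas_rows => i; under eq_fun do rewrite rowK.
by apply: mxmeas_grad => //; exact: mxmeas_row.
Qed.

Lemma mxmeas_field d' (S : measurableType d') p (g : 'rV[R]_p -> S -> 'rV[R]_p)
    (X : T -> 'rV[R]_p) (s : T -> S) :
  measurable_fun setT (fun z : borel R p * S => (g z.1 z.2 : borel R p)) ->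
  mxmeas X -> measurable_fun setT s -> mxmeas (fun w => g (X w) (s w)).
Proof.
move=> mg mX ms i j; rewrite ord1.
have mXs : measurable_fun setT (fun w => (X w : borel R p, s w)).
  by apply/measurable_fun_pairP; split => //; exact: measurable_fun_rV.
have mc := continuous_measurable_rV (@coord_continuous R 1 p 0 j).
exact: (measurableT_comp mc (measurableT_comp mg mXs)).
Qed.

End MeasurableMatrices.

Definition mxadapted {d} {T : measurableType d} {R : realType} (G : set_system T)
  m n (X : T -> 'M[R]_(m, n)) : Prop := @mxmeas _ (g_sigma_algebraType G) R m n X.

Section SquareIntegrableMatrices.
Context {d : measure_display} {T : measurableType d} {R : realType}.
Variable P : probability T R.
Local Notation Ex := (Ex P).
Local Notation integ := (integ P).

Definition L2 m n (X : T -> 'M[R]_(m, n)) : Prop :=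
  mxmeas X /\ integ (fun w => sqn (X w)).

Lemma L2_le m n (X : T -> 'M[R]_(m, n)) (Y : T -> R) :
  mxmeas X -> integ Y -> (forall w, sqn (X w) <= Y w) -> L2 X.
Proof.
move=> mX iY XY; split => //; apply: integ_le iY _; first exact: measurable_ip.
by move=> w; rewrite ger0_norm ?sqn_ge0.
Qed.

Lemma L2_cst m n (A : 'M[R]_(m, n)) : L2 (fun=> A).
Proof. by split; [exact: mxmeas_cst | exact: integ_cst]. Qed.

Lemma L2D m n (X Y : T -> 'M[R]_(m, n)) : L2 X -> L2 Y -> L2 (fun w => X w + Y w).
Proof.
move=> [mX iX] [mY iY]; apply: L2_le (mxmeasD mX mY) (integD (integZ 2 iX) (integZ 2 iY)) _.
by move=> w; exact: sqnD_le2.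
Qed.

Lemma L2Z m n a (X : T -> 'M[R]_(m, n)) : L2 X -> L2 (fun w => a *: X w).
Proof.
move=> [mX iX]; apply: L2_le (mxmeasZ a mX) (integZ (a ^+ 2) iX) _.
by move=> w; rewrite sqnZ.
Qed.

Lemma L2N m n (X : T -> 'M[R]_(m, n)) : L2 X -> L2 (fun w => - X w).
Proof. by move=> X2; under eq_fun do rewrite -scaleN1r; exact: L2Z. Qed.

Lemma L2B m n (X Y : T -> 'M[R]_(m, n)) : L2 X -> L2 Y -> L2 (fun w => X w - Y w).
Proof. by move=> X2 /L2N; exact: L2D. Qed.

Lemma L2_mull m n k (M : 'M[R]_(k, m)) (X : T -> 'M[R]_(m, n)) :
  L2 X -> L2 (fun w => M *m X w).
Proof.
move=> [mX iX]; apply: L2_le (mxmeas_mull M mX) (integZ (sqn M) iX) _.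
by move=> w; exact: sqn_mulmx.
Qed.

Lemma L2_rowmean m n (X : T -> 'M[R]_(m, n)) : L2 X -> L2 (fun w => rowmean (X w)).
Proof. by move=> X2; under eq_fun do rewrite rowmeanE; exact/L2Z/L2_mull. Qed.

Lemma L2_gradF L m n (f : 'I_m -> 'rV[R]_n -> R) (X : T -> 'M[R]_(m, n)) :
  (forall i, lipschitz_grad L (f i)) -> L2 X -> L2 (fun w => gradF f (X w)).
Proof.
move=> hL [mX iX]; apply: (L2_le (Y := fun w =>
    2 * (L ^+ 2 * sqn (X w)) + 2 * sqn (gradF f (0 : 'M[R]_(m, n))))).
- exact: mxmeas_gradF hL mX.
- by apply: integD; [exact/integZ/integZ | exact: integ_cst].
- move=> w; rewrite -{1}(subrK (gradF f 0) (gradF f (X w))).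
  apply: le_trans (sqnD_le2 _ _) _; rewrite lerD2r ler_pM2l //.
  by have := gradF_lipschitz (X w) 0 hL; rewrite subr0.
Qed.

Lemma L2_ip m n (X Y : T -> 'M[R]_(m, n)) :
  L2 X -> L2 Y -> integ (fun w => ip (X w) (Y w)).
Proof.
move=> [mX iX] [mY iY]; apply: integ_le (integD iX iY) _; first exact: measurable_ip.
move=> w; have a := ip_le (X w) (Y w); have b := ip_le (- X w) (Y w); rewrite ipNl sqnN in b.
have c := sqn_ge0 (X w); have e := sqn_ge0 (Y w).
rewrite ler_norml; apply/andP; split; lra.
Qed.

Lemma L2_entry m n (X : T -> 'M[R]_(m, n)) i j : L2 X -> integ (fun w => X w i j).
Proof.
move=> [mX iX]; apply: integ_le (integD iX (integ_cst P 1)) _; first exact: mX.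
by move=> w; rewrite -[X w i j]mulr1; apply: norm_mul_le; rewrite ?expr1n ?sqr_entry_le.
Qed.

(** [Ex_pullout] in every entry; square integrability makes the products
    integrable. *)
Lemma Ex_ip_centered m n (G : set_system T) (A N : T -> 'M[R]_(m, n)) :
  G `<=` measurable -> mxadapted G A -> L2 A -> L2 N ->
  (forall i j, centered P G (fun w => N w i j)) -> Ex (fun w => ip (A w) (N w)) = 0.
Proof.
move=> hG aA A2 N2 cN.
have iAN i j : integ (fun w => A w i j * N w i j).
  apply: (@integ_le _ _ _ P _ (fun w => sqn (A w) + sqn (N w))).
  - by apply: measurable_funM; [exact: A2.1 | exact: N2.1].
  - by apply: integD; [exact: A2.2 | exact: N2.2].
  by move=> w; apply: norm_mul_le; exact: sqr_entry_le.
rewrite /ip Ex_sum; last by move=> i; exact: integ_sum.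
apply: big1 => i _; rewrite Ex_sum //; apply: big1 => j _.
by have [i0 c0] := cN i j; exact: (Ex_pullout hG i0 c0 (aA i j)).
Qed.

End SquareIntegrableMatrices.

(** * Gradient noise and compression error *)

Section Noise.
Context {R : realType} {n p : nat} {d dS dZ : measure_display} {T : measurableType d}
  {Xi : measurableType dS} {Z : measurableType dZ}.
Variables (xi : int -> 'I_n -> T -> Xi) (zeta : nat -> 'I_n -> T -> Z)
  (f : 'I_n -> 'rV[R]_p -> R) (x G : int -> T -> 'M[R]_(n, p))
  (y Q H : nat -> T -> 'M[R]_(n, p)).

Definition past_sample (k : int) : set_system T :=
  sample_events xi k `|` compression_events zeta k.
Definition past_compress (k : nat) : set_system T :=
  sample_events xi (k%:Z + 1) `|` compression_events zeta k.

Definition gnoise (k : int) w : 'M[R]_(n, p) := G k w - gradF f (x k w).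
Definition cerror (k : nat) w : 'M[R]_(n, p) := Q k w - (y k w - H k w).

End Noise.

Section Process.
Context {R : realType} {n p : nat} {d dS dZ : measure_display} {T : measurableType d}
  {Xi : measurableType dS} {Z : measurableType dZ} (P : probability T R).
Context {W : 'M[R]_n} {f : 'I_n -> 'rV[R]_p -> R} {L sigma C : R}.
Context {xi : int -> 'I_n -> T -> Xi} {zeta : nat -> 'I_n -> T -> Z}
  {eta : int -> R} {alpha gamma : R}
  {g : 'I_n -> 'rV[R]_p -> Xi -> 'rV[R]_p} {cmp : 'rV[R]_p -> Z -> 'rV[R]_p}
  {x_init H_init : 'M[R]_(n, p)}
  {x G : int -> T -> 'M[R]_(n, p)} {y Q D H : nat -> T -> 'M[R]_(n, p)}.
Hypothesis n_gt0 : (0 < n)%N.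
Hypothesis hxi : forall k i, measurable_fun setT (xi k i).
Hypothesis hzeta : forall k i, measurable_fun setT (zeta k i).
Hypothesis f_smooth : forall i, lipschitz_grad L (f i).
Hypothesis hcedas : cedas W eta alpha gamma g cmp x_init H_init xi zeta x G y Q D H.
Hypothesis hgrad : stochastic_gradient P sigma f g xi zeta x G.
Hypothesis hcmp : unbiased_compressor P C cmp xi zeta y Q H.
Local Notation Ex := (Ex P).
Local Notation integ := (integ P).
Local Notation L2 := (L2 P).
Local Notation past_sample := (past_sample xi zeta).
Local Notation past_compress := (past_compress xi zeta).
Local Notation gnoise := (gnoise f x G).
Local Notation cerror := (cerror y Q H).

Lemma past_measurable (k l : int) :
  sample_events xi k `|` compression_events zeta l `<=` measurable.
Proof.
move=> E [[j [i [B [_ _ mB ->]]]]|[j [i [B [_ mB ->]]]]].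
  by rewrite -[X in measurable X]setTI; exact: hxi.
by rewrite -[X in measurable X]setTI; exact: hzeta.
Qed.

Let sample_adapted (k l k' : int) i : -1 <= l -> l < k ->
  adapted (sample_events xi k `|` compression_events zeta k') (xi l i).
Proof.
move=> l1 lk _ B mB; rewrite setTI; apply: sub_sigma_algebra; left.
by exists l, i, B.
Qed.

Let compress_adapted (k' k : int) (l : nat) i : l%:Z < k ->
  adapted (sample_events xi k' `|` compression_events zeta k) (zeta l i).
Proof.
move=> lk _ B mB; rewrite setTI; apply: sub_sigma_algebra; right.
by exists l, i, B.
Qed.

Let past_mono (k k' l l' : int) : k <= k' -> l <= l' ->
  sample_events xi k `|` compression_events zeta l `<=`
  <<s sample_events xi k' `|` compression_events zeta l'>>.
Proof.
move=> kk ll E h; apply: sub_sigma_algebra; case: h.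
  by move=> [j [i [B [j1 jk mB ->]]]]; left; exists j, i, B; split => //; exact: lt_le_trans kk.
by move=> [j [i [B [jk mB ->]]]]; right; exists j, i, B; split => //; exact: lt_le_trans ll.
Qed.

Let mxadapted_mono (k k' l l' : int) m q (X : T -> 'M[R]_(m, q)) : k <= k' -> l <= l' ->
  mxadapted (sample_events xi k `|` compression_events zeta l) X ->
  mxadapted (sample_events xi k' `|` compression_events zeta l') X.
Proof. by move=> kk ll aX i j; exact: adapted_sub (past_mono kk ll) (aX i j). Qed.

Let x0E : x 0 = fun w => x_init - eta (-1) *: G (-1) w.
Proof. by apply/funext => w; rewrite (cedas_x0 hcedas) (cedas_xN1 hcedas). Qed.
Let xN1E : x (-1) = fun=> x_init.
Proof. by apply/funext => w; rewrite (cedas_xN1 hcedas). Qed.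
Let D0E : D 0%N = fun=> 0.
Proof. by apply/funext => w; rewrite (cedas_D0 hcedas). Qed.
Let H0E : H 0%N = fun=> H_init.
Proof. by apply/funext => w; rewrite (cedas_H0 hcedas). Qed.
Let yE (k : nat) : y k = fun w => x k w - eta k *: G k w - D k w.
Proof. by apply/funext => w; rewrite (cedas_y hcedas). Qed.
Let DE (k : nat) : D k.+1 = fun w => D k w + (gamma / 2) *: ((1%:M - W) *m (H k w + Q k w)).
Proof. by apply/funext => w; rewrite (cedas_D hcedas). Qed.
Let xE (k : nat) : x k.+1 = fun w => x k w - eta k *: G k w - D k.+1 w.
Proof. by apply/funext => w; rewrite (cedas_x hcedas). Qed.
Let HE (k : nat) : H k.+1 = fun w => H k w + alpha *: Q k w.
Proof. by apply/funext => w; rewrite (cedas_H hcedas). Qed.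

Let G_adapted (k l k' : int) : -1 <= l -> l < k ->
  mxadapted (sample_events xi k `|` compression_events zeta k') (x l) ->
  mxadapted (sample_events xi k `|` compression_events zeta k') (G l).
Proof.
move=> l1 lk ax; have -> : G l = fun w => \matrix_(i < n) g i (row i (x l w)) (xi l i w).
  by apply/funext => w; rewrite (cedas_G hcedas).
apply: mxmeas_rows => i; under eq_fun do rewrite rowK.
apply: mxmeas_field; first exact: (sg_measurable hgrad).
  exact: mxmeas_row.
exact: sample_adapted.
Qed.

Lemma state_adapted (k : nat) :
  [/\ mxadapted (past_sample k) (x k), mxadapted (past_sample k) (D k) &
      mxadapted (past_sample k) (H k)].
Proof.
elim: k => [|k [ax aD aH]].
  split.
  - rewrite x0E; apply: mxmeasB; first exact: mxmeas_cst.
    apply: mxmeasZ; apply: G_adapted => //.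
    rewrite xN1E; exact: mxmeas_cst.
  - rewrite D0E; exact: mxmeas_cst.
  - rewrite H0E; exact: mxmeas_cst.
have k1 : k%:Z <= k.+1%:Z by rewrite lez_nat.
have up m q (X : T -> 'M[R]_(m, q)) : mxadapted (past_sample k) X -> mxadapted (past_sample k.+1) X.
  exact: mxadapted_mono.
have {}ax := up _ _ _ ax; have {}aD := up _ _ _ aD; have {}aH := up _ _ _ aH.
have aG : mxadapted (past_sample k.+1) (G k) by apply: G_adapted => //; rewrite ltz_nat.
have ay : mxadapted (past_sample k.+1) (y k).
  by rewrite yE; apply: mxmeasB => //; apply: mxmeasB => //; exact: mxmeasZ.
have aQ : mxadapted (past_sample k.+1) (Q k).
  have -> : Q k = fun w => \matrix_(i < n) cmp (row i (y k w - H k w)) (zeta k i w).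
    by apply/funext => w; rewrite (cedas_Q hcedas).
  apply: mxmeas_rows => i; under eq_fun do rewrite rowK.
  apply: mxmeas_field; first exact: (uc_measurable hcmp).
    by apply: mxmeas_row; exact: mxmeasB.
  by apply: compress_adapted; rewrite ltz_nat.
have aD' : mxadapted (past_sample k.+1) (D k.+1).
  by rewrite DE; apply: mxmeasD => //; apply/mxmeasZ/mxmeas_mull; exact: mxmeasD.
split => //.
- by rewrite xE; apply: mxmeasB => //; apply: mxmeasB => //; exact: mxmeasZ.
- by rewrite HE; apply: mxmeasD => //; exact: mxmeasZ.
Qed.

Lemma G_adapted_compress (k : nat) : mxadapted (past_compress k) (G k).
Proof.
apply: G_adapted => //; first by rewrite ltrDl.
have [ax _ _] := state_adapted k.
by apply: mxadapted_mono ax => //; rewrite lerDl.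
Qed.

Lemma sample_to_compress (k : nat) m q (X : T -> 'M[R]_(m, q)) :
  mxadapted (past_sample k) X -> mxadapted (past_compress k) X.
Proof. by apply: mxadapted_mono => //; rewrite lerDl. Qed.

Lemma gnoise_centered (k : int) i j : -1 <= k ->
  centered P (past_sample k) (fun w => gnoise k w i j).
Proof.
move=> k1; have := cexp_centered (past_measurable (k:=k) (l:=k)) (sg_mean hgrad i j k1).
by rewrite (_ : (fun w => _ - _) = (fun w => gnoise k w i j)) //; apply/funext => w; rewrite !mxE.
Qed.

Let row_gnoise k i w : row i (gnoise k w) = row i (G k w) - grad (f i) (row i (x k w)).
Proof. by rewrite /gnoise linearB /= rowK. Qed.

Lemma gnoise_L2 (k : int) : -1 <= k -> L2 (gnoise k).
Proof.
move=> k1; split.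
  by move=> i j; have [i0 _] := gnoise_centered i j k1; exact: integ_meas i0.
under eq_fun do rewrite sqn_rows; apply: integ_sum => i.
have [V [[iX _ _ _] _]] := sg_variance hgrad i k1.
by apply: eq_integ iX => w; rewrite sqn_fnorm row_gnoise.
Qed.

Lemma gnoise_variance (k : int) i : -1 <= k ->
  Ex (fun w => sqn (row i (gnoise k w))) <= sigma ^+ 2.
Proof.
move=> k1; have [V [cV Vs]] := sg_variance hgrad i k1.
have -> : Ex (fun w => sqn (row i (gnoise k w))) = Ex V.
  by rewrite -(cexp_Ex cV); apply: eq_Ex => w; rewrite sqn_fnorm row_gnoise.
rewrite -(Ex_cst P (sigma ^+ 2)); apply: Ex_ae_le => //; last exact: integ_cst.
by case: cV.
Qed.

Lemma gnoise_row_L2 (k : int) i : -1 <= k -> L2 (fun w => row i (gnoise k w)).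
Proof.
move=> k1; under eq_fun do rewrite rowE; apply: L2_mull; exact: gnoise_L2.
Qed.

Lemma Ex_gnoise (k : int) : -1 <= k ->
  Ex (fun w => sqn (gnoise k w)) <= n%:R * sigma ^+ 2.
Proof.
move=> k1; under eq_fun do rewrite sqn_rows.
rewrite Ex_sum; last by move=> i; case: (gnoise_row_L2 i k1).
rewrite -[X in X%:R * _](card_ord n) mulr_natl -sumr_const.
by apply: ler_sum => i _; exact: gnoise_variance.
Qed.

Lemma Ex_ip_gnoise (k : nat) (A : T -> 'M[R]_(n, p)) :
  mxadapted (past_sample k) A -> L2 A -> Ex (fun w => ip (A w) (gnoise k w)) = 0.
Proof.
move=> aA A2; apply: (Ex_ip_centered (@past_measurable k k) aA A2); first exact: gnoise_L2.
by move=> i j; exact: gnoise_centered.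
Qed.

(** Averaging over the agents divides the variance by their number: the
    cross terms vanish by conditional independence of the samples. *)
Lemma Ex_mean_gnoise (k : nat) :
  n%:R * Ex (fun w => sqn (rowmean (gnoise k w))) <= sigma ^+ 2.
Proof.
have k1 : -1 <= k%:Z by [].
have cross i j : i != j -> Ex (fun w => ip (row i (gnoise k w)) (row j (gnoise k w))) = 0.
  move=> ij; have ent l c : integ (fun w => gnoise k w l c).
    by apply: L2_entry; exact: gnoise_L2.
  have ic c : integ (fun w => gnoise k w i c * gnoise k w j c).
    have iS := integD (gnoise_L2 k1).2 (gnoise_L2 k1).2.
    apply: integ_le iS _.
      by apply: measurable_funM; [exact: integ_meas (ent i c) | exact: integ_meas (ent j c)].
    by move=> w; apply: norm_mul_le; exact: sqr_entry_le.
  have E : (fun w => ip (row i (gnoise k w)) (row j (gnoise k w))) =1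
      (fun w => \sum_c gnoise k w i c * gnoise k w j c).
    by move=> w; rewrite /ip big_ord1; apply: eq_bigr => c _; rewrite !mxE.
  rewrite (eq_Ex _ E) Ex_sum //; apply: big1 => c _.
  have [ax _ _] := state_adapted k.
  have ad l : adapted (sample_rectangles (past_sample k) (xi k) l) (fun w => gnoise k w l c).
    have sub : past_sample k `<=` <<s sample_rectangles (past_sample k) (xi k) l>>.
      move=> F GF; apply: sub_sigma_algebra; exists F, setT.
        by split => //; exact: sub_sigma_algebra.
      by rewrite preimage_setT setIT.
    have ax' : mxadapted (sample_rectangles (past_sample k) (xi k) l) (x k).
      by move=> a b; exact: adapted_sub sub (ax a b).
    have -> : (fun w => gnoise k w l c) =
        (fun w => (g l (row l (x k w)) (xi k l w) - grad (f l) (row l (x k w))) 0 c).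
      by apply/funext => w; rewrite /gnoise (cedas_G hcedas) // !mxE.
    apply: mxmeasB.
      apply: mxmeas_field; [exact: (sg_measurable hgrad) | exact: mxmeas_row |].
      move=> _ B mB; rewrite setTI; apply: sub_sigma_algebra; exists setT, B.
        by split => //; exact: (@measurableT _ (g_sigma_algebraType _)).
      by rewrite setTI.
    by apply: mxmeas_grad; [exact: f_smooth | exact: mxmeas_row].
  apply: (cond_indep_orthogonal (@past_measurable k k) (hxi k) (sg_independent hgrad k1) ij) => //.
  exact: gnoise_centered.
have nn : 0 < n%:R :> R by rewrite ltr0n.
have E : (fun w => sqn (rowmean (gnoise k w))) =1
   (fun w => n%:R^-1 ^+ 2 * \sum_i \sum_j ip (row i (gnoise k w)) (row j (gnoise k w))).
  by move=> w; rewrite sqnZ sqn_sumE.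
have irow i j : integ (fun w => ip (row i (gnoise k w)) (row j (gnoise k w))).
  by apply: L2_ip; exact: gnoise_row_L2.
rewrite (eq_Ex _ E) ExZ; last by apply: integ_sum => i; exact: integ_sum.
rewrite Ex_sum; last by move=> i; exact: integ_sum.
under eq_bigr do rewrite Ex_sum //.
rewrite (eq_bigr (fun i => Ex (fun w => sqn (row i (gnoise k w))))); last first.
  by move=> i _; rewrite (bigD1 i) //= big1 ?addr0 // => j ji; rewrite cross // eq_sym.
rewrite expr2 !mulrA mulfV ?gt_eqF // mul1r ler_pdivrMl //.
rewrite -[X in X%:R * _](card_ord n) mulr_natl -sumr_const.
by apply: ler_sum => i _; exact: gnoise_variance.
Qed.

Lemma cerror_centered k i j : centered P (past_compress k) (fun w => cerror k w i j).
Proof.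
have := cexp_centered (@past_measurable (k%:Z + 1) k) (uc_mean hcmp k i j).
by rewrite (_ : (fun w => _ - _) = (fun w => cerror k w i j)) //; apply/funext => w; rewrite !mxE.
Qed.

Let row_cerror k i w : row i (cerror k w) = row i (Q k w) - row i (y k w - H k w).
Proof. by rewrite /cerror linearB. Qed.

Lemma cerror_L2 k : L2 (cerror k).
Proof.
split; first by move=> i j; have [i0 _] := cerror_centered k i j; exact: integ_meas i0.
under eq_fun do rewrite sqn_rows; apply: integ_sum => i.
have [V [[iX _ _ _] _]] := uc_variance hcmp k i.
by apply: eq_integ iX => w; rewrite sqn_fnorm row_cerror.
Qed.

Lemma Ex_cerror k : L2 (fun w => y k w - H k w) ->
  Ex (fun w => sqn (cerror k w)) <= C * Ex (fun w => sqn (y k w - H k w)).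
Proof.
move=> h2.
have r2 i : L2 (fun w => row i (cerror k w)).
  by under eq_fun do rewrite rowE; apply: L2_mull; exact: cerror_L2.
have s2 i : L2 (fun w => row i (y k w - H k w)).
  by under eq_fun do rewrite rowE; exact: L2_mull.
have -> : Ex (fun w => sqn (y k w - H k w)) = \sum_i Ex (fun w => sqn (row i (y k w - H k w))).
  rewrite -Ex_sum; last by move=> i; case: (s2 i).
  by apply: eq_Ex => w; rewrite sqn_rows.
under eq_fun do rewrite sqn_rows; rewrite Ex_sum; last by move=> i; case: (r2 i).
rewrite mulr_sumr; apply: ler_sum => i _.
have [V [cV Vs]] := uc_variance hcmp k i.
have -> : Ex (fun w => sqn (row i (cerror k w))) = Ex V.
  by rewrite -(cexp_Ex cV); apply: eq_Ex => w; rewrite sqn_fnorm row_cerror.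
rewrite -ExZ; last by case: (s2 i).
apply: Ex_ae_le; first by case: cV.
  by apply: integZ; case: (s2 i).
by apply: filterS Vs => w; rewrite sqn_fnorm.
Qed.

Lemma Ex_ip_cerror k (A : T -> 'M[R]_(n, p)) :
  mxadapted (past_compress k) A -> L2 A -> Ex (fun w => ip (A w) (cerror k w)) = 0.
Proof.
move=> aA A2; apply: (Ex_ip_centered (@past_measurable (k%:Z + 1) k) aA A2).
  exact: cerror_L2.
by move=> i j; exact: cerror_centered.
Qed.

Lemma state_L2 (k : nat) : [/\ L2 (x k), L2 (D k) & L2 (H k)].
Proof.
have G2 (l : int) : -1 <= l -> L2 (x l) -> L2 (G l).
  move=> l1 x2; have -> : G l = fun w => gnoise l w + gradF f (x l w).
    by apply/funext => w; rewrite /gnoise subrK.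
  by apply: L2D; [exact: gnoise_L2 | exact: L2_gradF f_smooth x2].
elim: k => [|k [x2 D2 H2]].
  split.
  - rewrite x0E; apply: L2B; first exact: L2_cst.
    apply/L2Z/G2 => //.
    rewrite xN1E; exact: L2_cst.
  - rewrite D0E; exact: L2_cst.
  - rewrite H0E; exact: L2_cst.
have Gk : L2 (G k) by apply: G2.
have y2 : L2 (y k).
  by rewrite yE; apply: L2B => //; apply: L2B => //; exact: L2Z.
have Q2 : L2 (Q k).
  have -> : Q k = fun w => cerror k w + (y k w - H k w).
    by apply/funext => w; rewrite /cerror subrK.
  by apply: L2D; [exact: cerror_L2 | exact: L2B].
have D2' : L2 (D k.+1).
  by rewrite DE; apply: L2D => //; apply/L2Z/L2_mull; exact: L2D.
split => //.
- by rewrite xE; apply: L2B => //; apply: L2B => //; exact: L2Z.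
- by rewrite HE; apply: L2D => //; exact: L2Z.
Qed.

Lemma G_L2 (k : nat) : L2 (G k).
Proof.
have [x2 _ _] := state_L2 k.
have -> : G k = fun w => gnoise k w + gradF f (x k w).
  by apply/funext => w; rewrite /gnoise subrK.
by apply: L2D; [exact: gnoise_L2 | exact: L2_gradF f_smooth x2].
Qed.

Lemma y_L2 (k : nat) : L2 (y k).
Proof.
have [x2 D2 _] := state_L2 k.
rewrite yE.
by apply: L2B => //; apply: L2B => //; apply: L2Z; exact: G_L2.
Qed.

End Process.

(** * Recursions for the mean errors *)

(** The linear arithmetic that combines the pointwise bounds of this part, kept
    free of matrices and of random variables. *)

Section ScalarSteps.
Context {R : realType}.

Fact descent_combine (Fx Fy Fs eta L a b gu gn s t : R) :
  Fy <= Fx + - eta * (gu + gn) + L / 2 * ((- eta) ^+ 2 * s) ->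
  t = a - 2 * gu + b ->
  Fy - Fs <= 1 * (Fx - Fs) + (- (eta / 2) * a + (- (eta / 2) * b
    + (eta / 2 * t + (L * eta ^+ 2 / 2 * s + (- eta * gn + 0))))).
Proof. by move=> h ->; lra. Qed.

Fact gap_combine (phi' phi e L q U t ub t' s : R) : 0 <= e -> 0 <= L ->
  phi' <= 1 * phi + (- (e / 2) * q + (- (e / 2) * U
    + (e / 2 * t + (L * e ^+ 2 / 2 * ub + (- e * 0 + 0))))) ->
  t <= t' -> ub <= s ->
  phi' <= phi - e / 2 * q - e / 2 * U + e / 2 * t' + L * e ^+ 2 / 2 * s.
Proof.
move=> e0 L0 h1 h2 h3.
have h4 := ler_wpM2l (divr_ge0 e0 (ler0n _ 2)) h2.
have h5 := ler_wpM2l (divr_ge0 (mulr_ge0 L0 (sqr_ge0 e)) (ler0n _ 2)) h3.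
by lra.
Qed.

Fact drift_combine (s1 s2 a b ub q A B c e : R) :
  0 <= a -> 0 <= b -> s1 <= A * ub -> s2 <= B * q + c ->
  e <= 2 * (a * s1) + 2 * (b * s2) ->
  e <= 2 * a * A * ub + (2 * b * B * q + (2 * b * c * 1 + 0)).
Proof.
move=> a0 b0 h1 h2.
have := ler_wpM2l a0 h1; have := ler_wpM2l b0 h2; lra.
Qed.

Fact drift_final (dr a A ub s b B q c : R) : 0 <= a * A -> ub <= s ->
  dr <= 2 * a * A * ub + (2 * b * B * q + (2 * b * c * 1 + 0)) ->
  dr <= 2 * a * A * s + 2 * b * (B * q + c).
Proof. by move=> a0 /(ler_wpM2l a0); lra. Qed.

Fact cons_combine (hh A Cc aC U V K uv sh sN sD sE b c0 cV cK cC : R) : 0 < b ->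
  hh = A + 2 * aC + Cc ->
  A <= (1 + b) * U + 2 * V + (2 + b^-1) * K + 2 * uv ->
  U <= c0 * sh -> V <= cV * sN -> K <= cK * sD -> Cc <= cC * sE ->
  hh <= (1 + b) * c0 * sh + (2 * cV * sN + ((2 + b^-1) * cK * sD
    + (2 * uv + (2 * aC + (cC * sE + 0))))).
Proof.
move=> b0 -> hA hU hV hK hC.
have b1 : 0 <= 1 + b by rewrite addr_ge0 // ltW.
have b2 : 0 <= 2 + b^-1 by rewrite addr_ge0 // invr_ge0 ltW.
have := ler_wpM2l b1 hU; have := ler_wpM2l b2 hK; rewrite !mulrA.
move: hA hV hC; move: (b^-1) => bi; lra.
Qed.

Fact cons_U_combine (b q d P h g l e : R) : 0 < b -> 0 <= e ->
  q <= (1 + b) * P + (1 + b^-1) * (e * g) -> P <= d * h -> g <= 2 / 3 * (l * h) ->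
  q <= ((1 + b) * d + (1 + b^-1) * (e * (2 / 3 * l))) * h.
Proof.
move=> b0 e0 hq hP hg.
have b1 : 0 <= 1 + b by rewrite addr_ge0 // ltW.
have b2 : 0 <= (1 + b^-1) * e by rewrite mulr_ge0 // addr_ge0 // invr_ge0 ltW.
have := ler_wpM2l b1 hP; have := ler_wpM2l b2 hg.
move: hq; move: (b^-1) => bi; lra.
Qed.

Fact cons_final (h' h N E a b c cN cE sN : R) : 0 <= b -> 0 <= c ->
  h' <= a * h + (b * N + (sN + (2 * 0 + (2 * 0 + (c * E + 0))))) ->
  N <= cN -> E <= cE -> h' <= a * h + b * cN + sN + c * cE.
Proof. by move=> b0 c0 H /(ler_wpM2l b0) h1 /(ler_wpM2l c0) h2; lra. Qed.

Fact sqn_le_diff m q (A B : 'M[R]_(m, q)) : sqn B <= 2 * sqn A + 2 * sqn (B - A).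
Proof. by rewrite -{1}(subrK A B) addrC; apply: sqnD_le2. Qed.

Fact sqgrad_combine (N s' s t L2 e2 ub : R) : 0 < N -> s' <= 2 * s + 2 * t ->
  N * t <= L2 * (N * e2) * ub -> s' <= 2 * s + 2 * (L2 * e2) * ub.
Proof.
move=> N0 h1; have -> : L2 * (N * e2) * ub = N * (L2 * e2 * ub) by ring.
by rewrite ler_pM2l // => h2; lra.
Qed.

Fact comp_combine (rr S sS sR ip1 sN e a sr ip2 sE g1 g2 g3 h' h D q : R) : 0 < a ->
  rr = S - 2 * (e * ip1) + e ^+ 2 * sN ->
  S <= (1 + a) * sS + (1 + a^-1) * sR ->
  sS = (1 - a) ^+ 2 * sr - 2 * ((1 - a) * (a * ip2)) + a ^+ 2 * sE ->
  sR <= 5 * (g1 * h' + g2 * h + D + g3 * q) ->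
  rr <= (1 + a) * (1 - a) ^+ 2 * sr + ((1 + a) * a ^+ 2 * sE
    + ((1 + a^-1) * 5 * g1 * h' + ((1 + a^-1) * 5 * g2 * h + ((1 + a^-1) * 5 * D
    + ((1 + a^-1) * 5 * g3 * q + (e ^+ 2 * sN + (- 2 * e * ip1
    + (- 2 * (1 + a) * (1 - a) * a * ip2 + 0)))))))).
Proof.
move=> a0 -> hS eS hR; rewrite eS in hS; have a1 : 0 <= 1 + a^-1 by rewrite addr_ge0 // invr_ge0 ltW.
have := ler_wpM2l a1 hR; move: hS; rewrite !mulrDr; move: (a^-1) => ai.
rewrite !mulr1; lra.
Qed.

Fact comp_final (rr r a sE K h' h D q g1 g2 g3 e sN N C : R) : 0 <= a ->
  rr <= (1 + a) * (1 - a) ^+ 2 * r + ((1 + a) * a ^+ 2 * sE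
    + (K * 5 * g1 * h' + (K * 5 * g2 * h + (K * 5 * D
    + (K * 5 * g3 * q + (e ^+ 2 * sN + (- 2 * e * 0
    + (- 2 * (1 + a) * (1 - a) * a * 0 + 0)))))))) ->
  sE <= C * r -> sN <= N ->
  rr <= (1 + a) * ((1 - a) ^+ 2 + a ^+ 2 * C) * r
    + K * (5 * (g1 * h' + g2 * h + D + g3 * q)) + e ^+ 2 * N.
Proof.
move=> a0 H0 hE hN; have b0 : 0 <= (1 + a) * a ^+ 2 by rewrite mulr_ge0 ?sqr_ge0 ?addr_ge0.
have := ler_wpM2l b0 hE; have := ler_wpM2l (sqr_ge0 e) hN.
by move: H0; rewrite !mulr0 !addr0; lra.
Qed.

Fact sqn_le_diffC m q (A B : 'M[R]_(m, q)) : sqn B <= 2 * sqn A + 2 * sqn (A - B).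
Proof. by rewrite -(sqnN (A - B)) opprB; exact: sqn_le_diff. Qed.

End ScalarSteps.

Section Recursions.
Context {R : realType} {n p : nat} {d dS dZ : measure_display} {T : measurableType d}
  {Xi : measurableType dS} {Z : measurableType dZ} (P : probability T R).
Context {W : 'M[R]_n} {lambda : nat -> R} {Q1 : 'M[R]_(n, n.-1)}
  {J P1 : 'M[R]_(n.-1 + n.-1)} {f : 'I_n -> 'rV[R]_p -> R} {mu L sigma C : R}
  {xstar : 'rV[R]_p}.
Context {xi : int -> 'I_n -> T -> Xi} {zeta : nat -> 'I_n -> T -> Z}
  {eta : int -> R} {alpha gamma : R}
  {g : 'I_n -> 'rV[R]_p -> Xi -> 'rV[R]_p} {cmp : 'rV[R]_p -> Z -> 'rV[R]_p}
  {x_init H_init : 'M[R]_(n, p)}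
  {x G : int -> T -> 'M[R]_(n, p)} {y Q D H : nat -> T -> 'M[R]_(n, p)}.
Hypothesis n_ge2 : (2 <= n)%N.
Hypothesis p_gt0 : (0 < p)%N.
Hypothesis f_diff : forall i x, differentiable (f i) x.
Hypothesis mu_gt0 : 0 < mu.
Hypothesis f_convex : strongly_convex mu (favg f).
Hypothesis f_smooth : forall i, lipschitz_grad L (f i).
Hypothesis f_min : forall x, favg f xstar <= favg f x.
Hypothesis W_sym : W^T = W.
Hypothesis W_ones : W *m ones n = ones n.
Hypothesis hQ1 : eigenbasis W lambda Q1.
Hypothesis hJ : decomposition gamma lambda J P1.
Hypothesis lambda_ge0 : forall i : 'I_n.-1, 0 <= lambda i.+2.
Hypothesis lambda_le2 : forall i : 'I_n.-1, lambda i.+2 <= lambda 2.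
Hypothesis lambda2_lt1 : lambda 2 < 1.
Hypothesis gamma_gt0 : 0 < gamma.
Hypothesis gamma_le : gamma <= 1 / 8.
Hypothesis alpha_gt0 : 0 < alpha.
Hypothesis hxi : forall k i, measurable_fun setT (xi k i).
Hypothesis hzeta : forall k i, measurable_fun setT (zeta k i).
Hypothesis hcedas : cedas W eta alpha gamma g cmp x_init H_init xi zeta x G y Q D H.
Hypothesis hgrad : stochastic_gradient P sigma f g xi zeta x G.
Hypothesis hcmp : unbiased_compressor P C cmp xi zeta y Q H.
Local Notation Ex := (Ex P).
Local Notation integ := (integ P).
Local Notation L2 := (L2 P).

Let n_gt0 : (0 < n)%N. Proof. exact: ltnW. Qed.
Let N_gt0 : 0 < n%:R :> R. Proof. by rewrite ltr0n. Qed.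
Let delta := 1 - lambdat gamma lambda 2.

Let N (k : nat) w : 'M[R]_(n, p) := gnoise f x G k w.
Let E (k : nat) w : 'M[R]_(n, p) := cerror y Q H k w.
Let gb (k : nat) w := gradF f (ones n *m rowmean (x k w)).
Let gm (k : nat) w := rowmean (gb k w).
Let u (k : nat) w := rowmean (gradF f (x k w)).
Let nu (k : nat) w := rowmean (N k w).
Let h (k : nat) w := hcheck f gamma lambda Q1 J (eta k) (x k w) (D k w).
Let r (k : nat) w := y k w - H k w.
Let Dl (k : nat) w := eta k.+1 *: gb k.+1 w - eta k *: gb k w.

Definition gap (k : nat) := Ex (fun w => favg f (rowmean (x k w)) - favg f xstar).
Definition sqgrad (k : nat) := Ex (fun w => sqn (gm k w)).
Definition sqmean (k : nat) := Ex (fun w => sqn (u k w)).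
Definition consensus_err (k : nat) := Ex (fun w => sqn (h k w)).
Definition compress_err (k : nat) := Ex (fun w => sqn (r k w)).
Definition drift (k : nat) := Ex (fun w => sqn (Dl k w)).
Definition hetero := \sum_i sqn (grad (f i) xstar).

Let xL2 k : L2 (x (k : nat)).
Proof. by have [] := state_L2 hxi hzeta f_smooth hcedas hgrad hcmp k. Qed.
Let DL2 k : L2 (D k).
Proof. by have [] := state_L2 hxi hzeta f_smooth hcedas hgrad hcmp k. Qed.
Let HL2 k : L2 (H k).
Proof. by have [] := state_L2 hxi hzeta f_smooth hcedas hgrad hcmp k. Qed.
Let yL2 k : L2 (y k).
Proof. exact: y_L2 f_smooth hcedas hgrad hcmp k. Qed.
Let NL2 k : L2 (N k).
Proof. by apply: (gnoise_L2 hxi hzeta hgrad). Qed.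
Let EL2 k : L2 (E k).
Proof. exact: (cerror_L2 hxi hzeta hcmp). Qed.
Let xbL2 k : L2 (fun w => ones n *m rowmean (x (k : nat) w)).
Proof. by apply: L2_mull; exact: L2_rowmean. Qed.
Let gbL2 k : L2 (gb k).
Proof. exact: L2_gradF f_smooth (xbL2 k). Qed.
Let gmL2 k : L2 (gm k).
Proof. exact: L2_rowmean. Qed.
Let gxL2 k : L2 (fun w => gradF f (x (k : nat) w)).
Proof. exact: L2_gradF f_smooth (xL2 k). Qed.
Let uL2 k : L2 (u k).
Proof. exact: L2_rowmean. Qed.
Let nuL2 k : L2 (nu k).
Proof. exact: L2_rowmean. Qed.
Let rL2 k : L2 (r k).
Proof. exact: L2B (yL2 k) (HL2 k). Qed.
Let DlL2 k : L2 (Dl k).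
Proof. exact: L2B (L2Z _ (gbL2 _)) (L2Z _ (gbL2 _)). Qed.

Let hE k w : h k w = lsubmx (invmx J) *m Q1^T *m x k w
  + rsubmx (invmx J) *m diag_from2 n (fun i => (Num.sqrt (1 - lambdat gamma lambda i))^-1)
      *m Q1^T *m (D k w + eta k *: gb k w).
Proof. by []. Qed.

Let hL2 k : L2 (h k).
Proof.
have A2 := L2_mull (lsubmx (invmx J) *m Q1^T) (xL2 k).
have B2 := L2D (DL2 k) (L2Z (eta k) (gbL2 k)).
exact: L2D A2 (L2_mull _ B2).
Qed.

(** The dual variable starts at zero and moves in the range of [I - W], so the
    agents' mean is driven by the mean stochastic gradient alone. *)
Lemma ones_D k w : (ones n)^T *m D k w = 0.
Proof.
elim: k => [|k ih]; first by rewrite (cedas_D0 hcedas) mulmx0.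
rewrite (cedas_D hcedas) mulmxDr ih add0r -scalemxAr mulmxA.
suff -> : (ones n)^T *m (1%:M - W) = 0 by rewrite mul0mx scaler0.
by rewrite mulmxBr mulmx1 -{1}W_sym -trmx_mul W_ones subrr.
Qed.

Lemma mean_step (k : nat) w :
  rowmean (x k.+1 w) = rowmean (x k w) - eta k *: (u k w + nu k w).
Proof.
rewrite (cedas_x hcedas) !rowmeanB rowmeanZ.
have -> : rowmean (D k.+1 w) = 0 by rewrite rowmeanE ones_D scaler0.
by rewrite subr0 /u /nu -rowmeanD /N /gnoise [gradF _ _ + _]addrC subrK.
Qed.

Let gmE k w : gm k w = grad (favg f) (rowmean (x k w)).
Proof. by apply: rowmean_gradF => // i; exact: row_ones_mul. Qed.

Let xs (k : nat) : mxadapted (past_sample xi zeta k) (x k).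
Proof. by have [] := state_adapted hcedas hgrad hcmp k. Qed.
Let Ds (k : nat) : mxadapted (past_sample xi zeta k) (D k).
Proof. by have [] := state_adapted hcedas hgrad hcmp k. Qed.
Let Hs (k : nat) : mxadapted (past_sample xi zeta k) (H k).
Proof. by have [] := state_adapted hcedas hgrad hcmp k. Qed.

Let Ex_ip_nu (k : nat) (A : T -> 'rV[R]_p) :
  mxadapted (past_sample xi zeta k) A -> L2 A ->
  Ex (fun w => ip (A w) (nu k w)) = 0.
Proof.
move=> aA A2.
have eq w : ip (A w) (nu k w) = ip (n%:R^-1 *: (ones n *m A w)) (N k w).
  by rewrite /nu rowmeanE ipZr ipZl ip_mulr trmxK.
rewrite (eq_Ex P eq).
apply: (Ex_ip_gnoise hxi hzeta hgrad); first exact/mxmeasZ/mxmeas_mull.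
exact/L2Z/L2_mull.
Qed.

Let Ex_nu (k : nat) : Ex (fun w => sqn (nu k w)) <= sigma ^+ 2 / n%:R.
Proof.
rewrite ler_pdivlMr // mulrC.
exact: Ex_mean_gnoise n_gt0 hxi hzeta f_smooth hcedas hgrad hcmp k.
Qed.

Let us (k : nat) : mxadapted (past_sample xi zeta k) (u k).
Proof. by apply: mxmeas_rowmean; apply: mxmeas_gradF f_smooth _; exact: xs. Qed.

Let gbs (k : nat) : mxadapted (past_sample xi zeta k) (gb k).
Proof.
apply: mxmeas_gradF f_smooth _; apply: mxmeas_mull; apply: mxmeas_rowmean; exact: xs.
Qed.

Lemma sqn_mean_step (k : nat) :
  Ex (fun w => sqn (u k w + nu k w)) <= sqmean k + sigma ^+ 2 / n%:R.
Proof.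
have eq w : sqn (u k w + nu k w) = sqn (u k w) + 2 * ip (u k w) (nu k w) + sqn (nu k w).
  exact: sqnD.
have i1 := (uL2 k).2; have i2 := (nuL2 k).2; have i3 := L2_ip (uL2 k) (nuL2 k).
rewrite (eq_Ex P eq) ExD //; last by apply: integD => //; exact: integZ.
rewrite ExD //; last exact: integZ.
by rewrite ExZ // Ex_ip_nu // mulr0 addr0 lerD2l Ex_nu.
Qed.

Lemma integ_gap (k : nat) : integ (fun w => favg f (rowmean (x (k : nat) w)) - favg f xstar).
Proof.
apply: (@integ_le _ _ _ P _ (fun w => (2 * mu)^-1 * sqn (gm k w))).
- apply: measurable_funB; last exact: measurable_cst.
  apply: measurable_comp_rV; first by move=> j; exact: (mxmeas_rowmean (xL2 k).1).
  by move=> v; apply: differentiable_continuous; exact: favg_differentiable.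
- by apply: integZ; case: (gmL2 k).
- move=> w; rewrite ger0_norm; last by rewrite subr_ge0 f_min.
  rewrite ler_pdivlMl ?mulr_gt0 // gmE.
  exact: favg_gap_le f_diff mu_gt0 f_convex _.
Qed.

Let sqn_gm_u (k : nat) w : sqn (gm k w - u k w) <= 2 * L ^+ 2 / n%:R * sqn (h k w).
Proof.
have h1 := sqn_rowmean n_gt0 (gb k w - gradF f (x k w)).
have h2 : sqn (gb k w - gradF f (x k w)) <= 2 * L ^+ 2 * sqn (h k w).
  rewrite -sqnN opprB; exact (gradF_consensus n_ge2 hQ1 hJ (eta k) (x k w) (D k w) f_smooth).
rewrite /gm /u -rowmeanB mulrAC ler_pdivlMr // [leLHS]mulrC.
exact: le_trans h1 h2.
Qed.

(** The descent inequality along the step of the mean iterate. Polarizing the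
    inner product of the true gradient and the average of the local gradients
    leaves both squared norms with a negative sign, and the squared distance
    of the two, which is a consensus error. The noise is orthogonal in mean to
    the gradient. *)
Lemma gap_step (k : nat) : 0 <= eta k -> 0 <= L ->
  gap k.+1 <= gap k - eta k / 2 * sqgrad k - eta k / 2 * sqmean k
    + eta k / 2 * (2 * L ^+ 2 / n%:R * consensus_err k)
    + L * eta k ^+ 2 / 2 * (sqmean k + sigma ^+ 2 / n%:R).
Proof.
move=> e0 L0.
have i1 := integ_gap k; have i2 := (gmL2 k).2; have i3 := (uL2 k).2.
have i4 := (L2B (gmL2 k) (uL2 k)).2; have i5 := (L2D (uL2 k) (nuL2 k)).2.
have i6 := L2_ip (gmL2 k) (nuL2 k).
have gms : mxadapted (past_sample xi zeta k) (gm k) by apply: mxmeas_rowmean; exact: gbs.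
have z6 := Ex_ip_nu gms (gmL2 k).
pose F0 w := favg f (rowmean (x k w)) - favg f xstar.
have := @Ex_le_lin _ _ _ P _ [:: (1, F0); (- (eta k / 2), fun w => sqn (gm k w));
   (- (eta k / 2), fun w => sqn (u k w)); (eta k / 2, fun w => sqn (gm k w - u k w));
   (L * eta k ^+ 2 / 2, fun w => sqn (u k w + nu k w));
   (- eta k, fun w => ip (gm k w) (nu k w))] (integ_gap k.+1)
   (conj i1 (conj i2 (conj i3 (conj i4 (conj i5 (conj i6 I)))))).
rewrite /lin_fun /lin_Ex /= z6 => le_lin.
have h4 : Ex (fun w => sqn (gm k w - u k w)) <= 2 * L ^+ 2 / n%:R * consensus_err k.
  have ih := (hL2 k).2; rewrite /consensus_err -(ExZ _ ih); apply: Ex_le => //; exact: integZ.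
apply: (gap_combine e0 L0 (le_lin _) h4 (sqn_mean_step k)).
move=> w; rewrite mean_step -scaleNr.
have := descent n_gt0 p_gt0 f_diff mu_gt0 f_convex f_smooth
  (rowmean (x k w)) (- eta k *: (u k w + nu k w)).
rewrite -gmE ipZr ipDr sqnZ => h1.
exact: (descent_combine _ h1 (sqnB _ _)).
Qed.

Let heteroE : hetero = sqn (gradF f (ones n *m xstar)).
Proof.
rewrite sqn_rows; apply: eq_bigr => i _.
by rewrite rowK row_ones_mul.
Qed.

Let sqn_gb (k : nat) w :
  sqn (gb k w) <= 2 * n%:R * (L / mu) ^+ 2 * sqn (gm k w) + 2 * hetero.
Proof.
rewrite -(subrK (gradF f (ones n *m xstar)) (gb k w)) heteroE.
apply: le_trans (sqnD_le2 _ _) _; rewrite lerD2r.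
have h1 := gradF_lipschitz (ones n *m rowmean (x k w)) (ones n *m xstar) f_smooth.
rewrite -mulmxBr sqn_ones_mul in h1.
have h2 : sqn (rowmean (x k w) - xstar) <= mu^-1 ^+ 2 * sqn (gm k w).
  rewrite exprVn ler_pdivlMl ?exprn_gt0 // gmE.
  exact: (sqn_dist_le n_gt0 p_gt0 f_diff mu_gt0 f_convex f_smooth f_min).
have -> : 2 * n%:R * (L / mu) ^+ 2 * sqn (gm k w) =
    2 * (n%:R * (L ^+ 2 * (mu^-1 ^+ 2 * sqn (gm k w)))) by rewrite exprMn; ring.
rewrite ler_pM2l //; apply: le_trans h1 _; rewrite mulrCA ler_pM2l //.
exact: ler_wpM2l (sqr_ge0 L) _ _ h2.
Qed.

Let sqn_gb_step (k : nat) w :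
  sqn (gb k.+1 w - gb k w) <= L ^+ 2 * (n%:R * eta k ^+ 2) * sqn (u k w + nu k w).
Proof.
have h1 := gradbar_lipschitz (x k.+1 w) (x k w) f_smooth.
have e2 : rowmean (x k.+1 w) - rowmean (x k w) = - (eta k *: (u k w + nu k w)).
  by rewrite mean_step addrAC subrr add0r.
rewrite e2 sqnN sqnZ in h1.
have e1 : L ^+ 2 * (n%:R * eta k ^+ 2) * sqn (u k w + nu k w) =
  L ^+ 2 * (n%:R * (eta k ^+ 2 * sqn (u k w + nu k w))) by rewrite !mulrA.
rewrite e1; exact h1.
Qed.

(** The reference gradients change because the mean iterate moves and because
    the step size does. The size of a reference gradient is that of the global
    gradient, up to the disagreement of the local gradients at the minimizer. *)
Lemma drift_step (k : nat) :
  drift k <= 2 * eta k.+1 ^+ 2 * (L ^+ 2 * (n%:R * eta k ^+ 2))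
               * (sqmean k + sigma ^+ 2 / n%:R)
    + 2 * (eta k.+1 - eta k) ^+ 2
        * (2 * n%:R * (L / mu) ^+ 2 * sqgrad k + 2 * hetero).
Proof.
have i1 := (L2D (uL2 k) (nuL2 k)).2; have i2 := (gmL2 k).2.
have := @Ex_le_lin _ _ _ P _
  [:: (2 * eta k.+1 ^+ 2 * (L ^+ 2 * (n%:R * eta k ^+ 2)), fun w => sqn (u k w + nu k w));
      (2 * (eta k.+1 - eta k) ^+ 2 * (2 * n%:R * (L / mu) ^+ 2), fun w => sqn (gm k w));
      (2 * (eta k.+1 - eta k) ^+ 2 * (2 * hetero), fun=> 1)] (DlL2 k).2
  (conj i1 (conj i2 (conj (integ_cst P 1) I))).
rewrite /lin_fun /lin_Ex /= Ex_cst => le_lin.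
apply: (drift_final _ (sqn_mean_step k) (le_lin _)).
  by apply: mulr_ge0 (sqr_ge0 _) (mulr_ge0 (sqr_ge0 _) (mulr_ge0 (ler0n _ _) (sqr_ge0 _))).
move=> w; apply: (drift_combine (sqr_ge0 _) (sqr_ge0 _) (sqn_gb_step k w) (sqn_gb k w)).
rewrite -!sqnZ; apply: le_trans (sqnD_le2 _ _).
rewrite le_eqVlt /Dl; apply/orP; left; apply/eqP; congr sqn.
by rewrite scalerBr scalerBl addrA subrK.
Qed.

Lemma sqgrad_step (k : nat) :
  sqgrad k.+1 <= 2 * sqgrad k + 2 * (L ^+ 2 * eta k ^+ 2 * (sqmean k + sigma ^+ 2 / n%:R)).
Proof.
have i1 := (L2D (uL2 k) (nuL2 k)).2; have i2 := (gmL2 k).2.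
have := @Ex_le_lin _ _ _ P _
  [:: (2, fun w => sqn (gm k w));
      (2 * (L ^+ 2 * eta k ^+ 2), fun w => sqn (u k w + nu k w))] (gmL2 k.+1).2
  (conj i2 (conj i1 I)).
rewrite /lin_fun /lin_Ex /= => le_lin.
apply: (le_trans (le_lin _)).
  move=> w; rewrite addr0; have h1 := sqn_le_diff (gm k w) (gm k.+1 w).
  have h2 := le_trans (sqn_rowmean n_gt0 _) (sqn_gb_step k w).
  rewrite rowmeanB in h2; exact: (sqgrad_combine N_gt0 h1 h2).
rewrite addr0 lerD2l -mulrA ler_pM2l //.
exact: ler_wpM2l (mulr_ge0 (sqr_ge0 _) (sqr_ge0 _)) _ _ (sqn_mean_step k).
Qed.

Let Mg := @grad_gain R n lambda Q1 gamma J.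
Let Mc := @compress_gain R n lambda Q1 gamma J.
Let Md := @drift_gain R n lambda Q1 gamma J.
Let U0 (k : nat) w := P1 *m h k w - eta k *: (Mg *m (gradF f (x k w) - gb k w)).
Let V0 (k : nat) w := (- eta k) *: (Mg *m N k w).
Let A0 (k : nat) w := U0 k w + V0 k w + Md *m Dl k w.

Let reorder q k k' (M : 'M[R]_(k, k')) e (a c c' : 'M[R]_(k, q)) (A B : 'M[R]_(k', q)) :
  a - e *: (M *m (A + B)) + c + c' = a - e *: (M *m B) + (- e) *: (M *m A) + c' + c.
Proof.
rewrite mulmxDr scalerDr scaleNr addrAC; congr (_ + _ + _).
by rewrite opprD addrA addrAC.
Qed.

Let h_step (k : nat) w : h k.+1 w = A0 k w + Mc *m E k w.
Proof.
have eD : D k.+1 w = D k w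
    + (gamma / 2) *: ((1%:M - W) *m (x k w - eta k *: G k w - D k w + E k w)).
  rewrite (cedas_D hcedas); congr (_ + _ *: (_ *m _)).
  rewrite -(cedas_y hcedas) /E /cerror addrCA addrC; congr (_ + _).
  by rewrite opprB addrCA subrr addr0.
have := hcheck_step hQ1 hJ lambda_ge0 lambda_le2 lambda2_lt1 gamma_gt0 f (eta k.+1)
  eD (cedas_x hcedas k w).
have -> : G k w - gradF f (ones n *m rowmean (x k w)) =
    N k w + (gradF f (x k w) - gb k w) by rewrite /N /gnoise addrA subrK.
rewrite -/(h k.+1 w) -/(h k w) -/(gb k w) -/(gb k.+1 w) -/(Dl k w) -/Mg -/Mc -/Md => ->.
exact: reorder.
Qed.

Let hs (k : nat) : mxadapted (past_sample xi zeta k) (h k).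
Proof.
apply: mxmeasD; first by apply: mxmeas_mull; exact: xs.
by apply: mxmeas_mull; apply: mxmeasD; [exact: Ds | apply: mxmeasZ; exact: gbs].
Qed.

Let U0s (k : nat) : mxadapted (past_sample xi zeta k) (U0 k).
Proof.
apply: mxmeasB; first by apply: mxmeas_mull; exact: hs.
apply/mxmeasZ/mxmeas_mull; apply: mxmeasB; last exact: gbs.
by apply: mxmeas_gradF f_smooth _; exact: xs.
Qed.

Let U0L2 (k : nat) : L2 (U0 k).
Proof. exact: L2B (L2_mull _ (hL2 k)) (L2Z _ (L2_mull _ (L2B (gxL2 k) (gbL2 k)))). Qed.

Let V0L2 (k : nat) : L2 (V0 k).
Proof. exact: L2Z _ (L2_mull _ (NL2 k)). Qed.

Let A0L2 (k : nat) : L2 (A0 k).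
Proof. exact: L2D (L2D (U0L2 k) (V0L2 k)) (L2_mull _ (DlL2 k)). Qed.

Let Ncompress (k : nat) : mxadapted (past_compress xi zeta k) (N k).
Proof.
apply: mxmeasB; first exact (G_adapted_compress hcedas hgrad hcmp (k:=k)).
by apply: mxmeas_gradF f_smooth _; apply: sample_to_compress; exact: xs.
Qed.

Let A0_compress (k : nat) : mxadapted (past_compress xi zeta k) (A0 k).
Proof.
apply: mxmeasD; first apply: mxmeasD.
- by apply: sample_to_compress; exact: U0s.
- by apply: mxmeasZ; apply: mxmeas_mull; exact: Ncompress.
apply: mxmeas_mull; apply: mxmeasB; apply: mxmeasZ; last by apply: sample_to_compress; exact: gbs.
apply: mxmeas_gradF f_smooth _; apply: mxmeas_mull.
under eq_fun do rewrite mean_step.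
apply: mxmeasB; first by apply: mxmeas_rowmean; apply: sample_to_compress; exact: xs.
apply: mxmeasZ; apply: mxmeasD; first by apply: sample_to_compress; exact: us.
by apply: mxmeas_rowmean; exact: Ncompress.
Qed.

(** The gradient noise and the compression error are orthogonal in mean to
    what precedes them, so that their variances add up. Only the perturbations
    that are not centered need Young weights, [b] and [b']. *)
Lemma cons_step (k : nat) (b b' : R) : 0 < b -> 0 < b' -> 0 <= C ->
  consensus_err k.+1 <=
    (1 + b) * ((1 + b') * (1 - delta) + (1 + b'^-1) * (eta k ^+ 2 * (2 / 3 * (2 * L ^+ 2))))
      * consensus_err k
    + 2 * (eta k ^+ 2 * (2 / 3)) * (n%:R * sigma ^+ 2)
    + (2 + b^-1) * (2 / (3 * delta)) * drift k
    + 5 / 12 * gamma * (C * compress_err k).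
Proof.
move=> b0 b'0 C0.
have z1 : Ex (fun w => ip (U0 k w) (V0 k w)) = 0.
  have eq w : ip (U0 k w) (V0 k w) = ip ((- eta k) *: (Mg^T *m U0 k w)) (N k w).
    by rewrite /V0 ipZr ipZl ip_mulr.
  rewrite (eq_Ex P eq); apply: (Ex_ip_gnoise hxi hzeta hgrad).
    by apply: mxmeasZ; apply: mxmeas_mull; exact: U0s.
  exact: L2Z _ (L2_mull _ (U0L2 k)).
have z2 : Ex (fun w => ip (A0 k w) (Mc *m E k w)) = 0.
  have eq w : ip (A0 k w) (Mc *m E k w) = ip (Mc^T *m A0 k w) (E k w).
    by rewrite ip_mulr.
  rewrite (eq_Ex P eq); apply: (Ex_ip_cerror hxi hzeta hcmp).
    by apply: mxmeas_mull; exact: A0_compress.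
  exact: L2_mull _ (A0L2 k).
have i3 := L2_ip (U0L2 k) (V0L2 k); have i4 := L2_ip (A0L2 k) (L2_mull Mc (EL2 k)).
set c0 := (1 + b') * _ + _.
have := @Ex_le_lin _ _ _ P _
  [:: ((1 + b) * c0, fun w => sqn (h k w));
      (2 * (eta k ^+ 2 * (2 / 3)), fun w => sqn (N k w));
      ((2 + b^-1) * (2 / (3 * delta)), fun w => sqn (Dl k w));
      (2, fun w => ip (U0 k w) (V0 k w));
      (2, fun w => ip (A0 k w) (Mc *m E k w));
      (5 / 12 * gamma, fun w => sqn (E k w))] (hL2 k.+1).2
  (conj (hL2 k).2 (conj (NL2 k).2 (conj (DlL2 k).2 (conj i3 (conj i4 (conj (EL2 k).2 I)))))).
rewrite /lin_fun /lin_Ex /= z1 z2 => le_lin.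
have e0 : 0 <= 2 * (eta k ^+ 2 * (2 / 3)).
  by apply: mulr_ge0 (ler0n _ 2) (mulr_ge0 (sqr_ge0 _) (divr_ge0 (ler0n _ _) (ler0n _ _))).
have g0 : 0 <= 5 / 12 * gamma.
  by apply: mulr_ge0 (divr_ge0 (ler0n _ _) (ler0n _ _)) (ltW gamma_gt0).
have hEk : Ex (fun w => sqn (E k w)) <= C * compress_err k.
  exact (Ex_cerror hxi hzeta hcmp (rL2 k)).
have hNk : Ex (fun w => sqn (N k w)) <= n%:R * sigma ^+ 2.
  by apply: (Ex_gnoise hxi hzeta hgrad).
refine (cons_final e0 g0 (le_lin _) hNk hEk) => w.
have hV : sqn (V0 k w) <= eta k ^+ 2 * (2 / 3) * sqn (N k w).
  rewrite /V0 sqnZ sqrrN -mulrA; apply: ler_wpM2l; first exact: sqr_ge0.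
  exact (sqn_grad_gain n_ge2 hQ1 hJ lambda_ge0 lambda_le2 lambda2_lt1 gamma_gt0 gamma_le (N k w)).
have hK := sqn_drift_gain n_ge2 hQ1 hJ lambda_ge0 lambda_le2 lambda2_lt1 gamma_gt0 gamma_le (Dl k w).
have hC := sqn_compress_gain n_ge2 hQ1 hJ lambda_ge0 lambda_le2 lambda2_lt1 gamma_gt0 gamma_le (E k w).
have hU : sqn (U0 k w) <= c0 * sqn (h k w).
  have g1 := sqn_grad_gain n_ge2 hQ1 hJ lambda_ge0 lambda_le2 lambda2_lt1 gamma_gt0 gamma_le
     (gradF f (x k w) - gb k w).
  have g2 : sqn (gradF f (x k w) - gb k w) <= 2 * L ^+ 2 * sqn (h k w).
    exact (gradF_consensus n_ge2 hQ1 hJ (eta k) (x k w) (D k w) f_smooth).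
  have g3 := le_trans g1 (ler_wpM2l (divr_ge0 (ler0n R 2) (ler0n R 3)) g2).
  have y1 := sqnD_young (P1 *m h k w) (- (eta k *: (Mg *m (gradF f (x k w) - gb k w)))) b'0.
  rewrite sqnN sqnZ in y1.
  exact: (cons_U_combine b'0 (sqr_ge0 _) y1 (sqn_P1_mul hJ (h k w)) g3).
rewrite h_step.
exact: (cons_combine b0 (sqnD _ _) (sqnD3_young _ _ _ b0) hU hV hK hC).
Qed.

Let B0 (k : nat) w := x k.+1 w - D k.+1 w - H k.+1 w - eta k.+1 *: gradF f (x k.+1 w).
Let S0 (k : nat) w := (1 - alpha) *: r k w - alpha *: E k w.
Let R0 (k : nat) w := D k w - 2 *: D k.+1 w - eta k.+1 *: gradF f (x k.+1 w).

Let r_step (k : nat) w : r k.+1 w = B0 k w - eta k.+1 *: N k.+1 w.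
Proof.
rewrite /r (cedas_y hcedas) /B0 /N /gnoise; move: (gradF _ _) => gr.
by apply/matrixP => i j; rewrite !mxE; ring.
Qed.

Let B_split (k : nat) w : B0 k w = S0 k w + R0 k w.
Proof.
rewrite /B0 /S0 /R0; move: (gradF _ _) => gr.
rewrite (cedas_x hcedas) (cedas_H hcedas) /r /E /cerror (cedas_y hcedas).
by apply/matrixP => i j; rewrite !mxE; ring.
Qed.

Let B0s (k : nat) : mxadapted (past_sample xi zeta k.+1) (B0 k).
Proof.
apply: mxmeasB; first apply: mxmeasB; first apply: mxmeasB.
- exact: xs.
- exact: Ds.
- exact: Hs.
by apply: mxmeasZ; apply: mxmeas_gradF f_smooth _; exact: xs.
Qed.

Let B0L2 (k : nat) : L2 (B0 k).
Proof. exact: L2B (L2B (L2B (xL2 k.+1) (DL2 k.+1)) (HL2 k.+1)) (L2Z _ (gxL2 k.+1)). Qed.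

Let r_compress (k : nat) : mxadapted (past_compress xi zeta k) (r k).
Proof.
have -> : r k = fun w => x k w - eta k *: G k w - D k w - H k w.
  by apply/funext => w; rewrite /r (cedas_y hcedas).
apply: mxmeasB; last by apply: sample_to_compress; exact: Hs.
apply: mxmeasB; last by apply: sample_to_compress; exact: Ds.
apply: mxmeasB; first by apply: sample_to_compress; exact: xs.
by apply: mxmeasZ; exact (G_adapted_compress hcedas hgrad hcmp (k:=k)).
Qed.

(** The update of [H] makes the next difference [y - H] equal to [1 - alpha]
    times the present one, up to a multiple of the compression error, the
    residual of [residual_bound] and the next gradient noise; both noises are
    centered. *)
Lemma comp_step (k : nat) :
  compress_err k.+1 <= (1 + alpha) * ((1 - alpha) ^+ 2 + alpha ^+ 2 * C) * compress_err k
    + (1 + alpha^-1) * (5 * ((4 * gamma + 2 * (eta k.+1 ^+ 2 * L ^+ 2)) * consensus_err k.+1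
         + gamma * consensus_err k + drift k + n%:R * eta k.+1 ^+ 2 * sqgrad k.+1))
    + eta k.+1 ^+ 2 * (n%:R * sigma ^+ 2).
Proof.
have z1 : Ex (fun w => ip (B0 k w) (N k.+1 w)) = 0.
  by apply: (Ex_ip_gnoise hxi hzeta hgrad); [exact: B0s | exact: B0L2].
have z2 : Ex (fun w => ip (r k w) (E k w)) = 0.
  by apply: (Ex_ip_cerror hxi hzeta hcmp); [exact: r_compress | exact: rL2].
have i3 := L2_ip (B0L2 k) (NL2 k.+1); have i4 := L2_ip (rL2 k) (EL2 k).
have := @Ex_le_lin _ _ _ P _
  [:: ((1 + alpha) * (1 - alpha) ^+ 2, fun w => sqn (r k w));
      ((1 + alpha) * alpha ^+ 2, fun w => sqn (E k w));
      ((1 + alpha^-1) * 5 * (4 * gamma + 2 * (eta k.+1 ^+ 2 * L ^+ 2)),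
        fun w => sqn (h k.+1 w));
      ((1 + alpha^-1) * 5 * gamma, fun w => sqn (h k w));
      ((1 + alpha^-1) * 5, fun w => sqn (Dl k w));
      ((1 + alpha^-1) * 5 * (n%:R * eta k.+1 ^+ 2), fun w => sqn (gm k.+1 w));
      (eta k.+1 ^+ 2, fun w => sqn (N k.+1 w));
      (- 2 * eta k.+1, fun w => ip (B0 k w) (N k.+1 w));
      (- 2 * (1 + alpha) * (1 - alpha) * alpha, fun w => ip (r k w) (E k w))]
  (rL2 k.+1).2
  (conj (rL2 k).2 (conj (EL2 k).2 (conj (hL2 k.+1).2 (conj (hL2 k).2 (conj (DlL2 k).2
  (conj (gmL2 k.+1).2 (conj (NL2 k.+1).2 (conj i3 (conj i4 I))))))))).
rewrite /lin_fun /lin_Ex /= z1 z2 => le_lin.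
have hEk : Ex (fun w => sqn (E k w)) <= C * compress_err k.
  exact (Ex_cerror hxi hzeta hcmp (rL2 k)).
have hNk : Ex (fun w => sqn (N k.+1 w)) <= n%:R * sigma ^+ 2.
  by apply: (Ex_gnoise hxi hzeta hgrad).
refine (comp_final (ltW alpha_gt0) (le_lin _) hEk hNk) => w.
have e1 : sqn (r k.+1 w) = sqn (S0 k w + R0 k w) - 2 * (eta k.+1 * ip (B0 k w) (N k.+1 w))
    + eta k.+1 ^+ 2 * sqn (N k.+1 w).
  by rewrite r_step sqnB sqnZ ipZr -B_split.
have e2 : sqn (S0 k w) = (1 - alpha) ^+ 2 * sqn (r k w)
    - 2 * ((1 - alpha) * (alpha * ip (r k w) (E k w))) + alpha ^+ 2 * sqn (E k w).
  by rewrite /S0 sqnB !sqnZ ipZl ipZr.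
have hR := residual_bound n_ge2 hQ1 hJ lambda_ge0 lambda_le2 lambda2_lt1 gamma_gt0
  (eta k) (eta k.+1) (x k w) (x k.+1 w) f_smooth (ones_D k w) (ones_D k.+1 w).
exact (comp_combine alpha_gt0 e1 (sqnD_young _ _ alpha_gt0) e2 hR).
Qed.

Lemma sqmean_le (k : nat) : sqmean k <= 2 * sqgrad k + 4 * L ^+ 2 / n%:R * consensus_err k.
Proof.
have := @Ex_le_lin _ _ _ P _ [:: (2, fun w => sqn (gm k w));
  (2 * (2 * L ^+ 2 / n%:R), fun w => sqn (h k w))] (uL2 k).2
  (conj (gmL2 k).2 (conj (hL2 k).2 I)).
rewrite /lin_fun /lin_Ex /= => le_lin.
have -> : 4 * L ^+ 2 / n%:R = 2 * (2 * L ^+ 2 / n%:R) by ring.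
rewrite -[_ * consensus_err k]addr0; apply: le_lin => w.
apply: (le_trans (sqn_le_diffC (gm k w) (u k w))); rewrite addr0 lerD2l -mulrA.
by rewrite ler_pM2l //; exact: sqn_gm_u.
Qed.

Lemma sqgrad_le_gap (k : nat) : sqgrad k <= 2 * L * gap k.
Proof.
rewrite /gap -(ExZ _ (integ_gap k)); apply: Ex_le; first exact: (gmL2 k).2.
  by apply: integZ; exact: integ_gap.
move=> w; rewrite gmE.
exact: (sqn_grad_le n_gt0 p_gt0 f_diff mu_gt0 f_convex f_smooth f_min).
Qed.

Lemma gap_le_sqgrad (k : nat) : 2 * mu * gap k <= sqgrad k.
Proof.
rewrite /gap -(ExZ _ (integ_gap k)); apply: Ex_le; last first.
- by move=> w; rewrite gmE; exact: (favg_gap_le f_diff mu_gt0 f_convex).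
- exact: (gmL2 k).2.
- by apply: integZ; exact: integ_gap.
Qed.

Lemma gap_ge0 (k : nat) : 0 <= gap k.
Proof. by apply: Ex_ge0 => w; rewrite subr_ge0. Qed.

Lemma sqgrad_ge0 (k : nat) : 0 <= sqgrad k.
Proof. by apply: Ex_ge0 => w; exact: sqn_ge0. Qed.

Lemma sqmean_ge0 (k : nat) : 0 <= sqmean k.
Proof. by apply: Ex_ge0 => w; exact: sqn_ge0. Qed.

Lemma cons_ge0 (k : nat) : 0 <= consensus_err k.
Proof. by apply: Ex_ge0 => w; exact: sqn_ge0. Qed.

Lemma comp_ge0 (k : nat) : 0 <= compress_err k.
Proof. by apply: Ex_ge0 => w; exact: sqn_ge0. Qed.

Lemma hetero_ge0 : 0 <= hetero.
Proof. by apply: sumr_ge0 => i _; exact: sqn_ge0. Qed.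

Let distL2 (k : nat) i : L2 (fun w => row i (x k w) - xstar).
Proof.
apply: L2B (L2_cst P xstar); under eq_fun do rewrite rowE.
exact: L2_mull.
Qed.

Lemma integ_dist (k : nat) i : integ (fun w => sqn (row i (x k w) - xstar)).
Proof. exact: (distL2 k i).2. Qed.

Lemma integ_cons (k : nat) : integ (fun w => sqn (h k w)).
Proof. exact: (hL2 k).2. Qed.

Lemma integ_comp (k : nat) : integ (fun w => sqn (r k w)).
Proof. exact: (rL2 k).2. Qed.

(** Pythagoras around the mean of the agents; strong convexity bounds the
    squared distance of this mean to the minimizer by the suboptimality. *)
Lemma dist_le (k : nat) :
  n%:R^-1 * (\sum_i Ex (fun w => sqn (row i (x k w) - xstar)))
    <= 2 / mu * gap k + 2 / n%:R * consensus_err k.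
Proof.
rewrite -Ex_sum; last by move=> i; exact: integ_dist.
rewrite -ExZ; last by apply: integ_sum => i; exact: integ_dist.
have := @Ex_le_lin _ _ _ P (fun w => n%:R^-1 * \sum_i sqn (row i (x k w) - xstar))
  [:: (2 / mu, fun w => favg f (rowmean (x k w)) - favg f xstar);
  (2 / n%:R, fun w => sqn (h k w))] _
  (conj (integ_gap k) (conj (hL2 k).2 I)).
rewrite /lin_fun /lin_Ex /= addr0; apply.
  by apply: integZ; apply: integ_sum => i; exact: integ_dist.
move=> w; rewrite addr0.
have e1 : \sum_i sqn (row i (x k w) - xstar) =
    sqn (x k w - ones n *m rowmean (x k w)) + n%:R * sqn (rowmean (x k w) - xstar).
  rewrite -sqn_center // sqn_rows; apply: eq_bigr => i _.
  by rewrite linearB /= row_ones_mul.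
have h1 : sqn (x k w - ones n *m rowmean (x k w)) <= 2 * sqn (h k w).
  rewrite -(sqn_Q1T_mul n_gt0 hQ1).
  exact (sqn_consensus hJ f (eta k) (x k w) (D k w)).
have h2 := favg_gap_ge n_gt0 p_gt0 f_diff mu_gt0 f_convex f_smooth f_min (rowmean (x k w)).
rewrite e1 mulrDr mulKf ?gt_eqF // addrC; apply: lerD.
  by rewrite mulrAC ler_pdivlMr // mulrC -ler_pdivrMl // mulrA [2^-1 * mu]mulrC.
by rewrite mulrAC ler_pdivlMr // mulrC mulVKf ?gt_eqF.
Qed.

End Recursions.

(** * One round of the error recursions *)

Section ScalarEstimates.
Context {R : realType}.

Fact drift_estimate (D e e' L mu N U s q z t d : R) :
  0 < N -> 0 <= U -> 0 <= s -> 0 <= q -> 0 <= z ->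
  D <= 2 * e' ^+ 2 * (L ^+ 2 * (N * e ^+ 2)) * (U + s / N)
       + 2 * (e' - e) ^+ 2 * (2 * N * (L / mu) ^+ 2 * q + 2 * z) ->
  e' ^+ 2 * L ^+ 2 <= d ^+ 2 / 576 -> (e' - e) ^+ 2 <= e ^+ 2 / t ^+ 2 ->
  (L / mu) ^+ 2 / t ^+ 2 <= d ^+ 2 / (576 * 400) ->
  D <= e ^+ 2 * d ^+ 2 * ((N * U + s) / 288 + N * q / (240 * 240))
       + 4 * e ^+ 2 * (z / t ^+ 2).
Proof.
move=> N0 U0 s0 q0 z0 hD h1 h2 h3.
have NU : 0 <= e ^+ 2 * (N * U + s) by rewrite mulr_ge0 ?sqr_ge0 // addr_ge0 // mulr_ge0 // ltW.
have X0 : 0 <= 2 * N * (L / mu) ^+ 2 * q + 2 * z.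
  apply: addr_ge0; last by rewrite mulr_ge0.
  by apply: mulr_ge0 q0; apply: mulr_ge0 (sqr_ge0 _); rewrite mulr_ge0 // ltW.
have Nq : 0 <= e ^+ 2 * (N * q) by rewrite mulr_ge0 ?sqr_ge0 // mulr_ge0 // ltW.
have k1 := ler_wpM2r NU h1; have k2 := ler_wpM2r X0 h2; have k3 := ler_wpM2r Nq h3.
have e1 : 2 * e' ^+ 2 * (L ^+ 2 * (N * e ^+ 2)) * (U + s / N) =
  2 * (e' ^+ 2 * L ^+ 2 * (e ^+ 2 * (N * U + s))) by field; rewrite gt_eqF.
rewrite e1 in hD.
have e2 : e ^+ 2 / t ^+ 2 * (2 * N * (L / mu) ^+ 2 * q + 2 * z) =
  2 * ((L / mu) ^+ 2 / t ^+ 2 * (e ^+ 2 * (N * q))) + 2 * (e ^+ 2 * (z / t ^+ 2)) by ring.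
rewrite e2 in k2.
move: hD k1 k2 k3; move: (e' ^+ 2 * L ^+ 2 * _) ((e' - e) ^+ 2) => A B hD k1 k2 k3.
lra.
Qed.

(** With the Young weights [d / 5] and [d / 4], half of the contraction [1 -
    d] is left. *)
Fact cons_coef (d X : R) : 0 < d -> d <= 1 / 16 -> X <= d ^+ 2 / 576 ->
  (1 + d / 5) * ((1 + d / 4) * (1 - d) + (1 + (d / 4)^-1) * (2 / 3 * (2 * X)))
    <= 1 - d / 2.
Proof.
move=> d0 d1 hX.
have h1 : (1 + (d / 4)^-1) * (2 / 3 * (2 * X)) <= (d ^+ 2 + 4 * d) / 432.
  have c0 : 0 <= (1 + (d / 4)^-1) * (4 / 3).
    by rewrite mulr_ge0 // addr_ge0 // invr_ge0 divr_ge0 // ltW.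
  have := ler_wpM2l c0 hX.
  have -> : (1 + (d / 4)^-1) * (4 / 3) * (d ^+ 2 / 576) = (d ^+ 2 + 4 * d) / 432.
    by field; rewrite gt_eqF.
  by apply: le_trans; apply: le_of_eq; ring.
have h2 : 0 <= 1 + d / 5 by lra.
have := ler_wpM2l h2 (lerD (lexx ((1 + d / 4) * (1 - d))) h1).
move/le_trans; apply; nra.
Qed.

Fact drift_coef (d : R) : 0 < d -> d <= 1 / 16 ->
  (2 + (d / 5)^-1) * (2 / (3 * d)) <= 4 / d ^+ 2.
Proof.
move=> d0 d1; have -> : (2 + (d / 5)^-1) * (2 / (3 * d)) = (4 / 3 * d + 10 / 3) / d ^+ 2.
  by field; rewrite gt_eqF.
by rewrite ler_pM2r ?invr_gt0 ?exprn_gt0 //; lra.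
Qed.

Fact comp_coef (a C : R) : 0 < a -> 0 < C -> a * (C + 1) <= 1 / 4 ->
  (1 + a) * ((1 - a) ^+ 2 + a ^+ 2 * C) <= 1 - 3 / 4 * a.
Proof.
move=> a0 C0 h.
have h1 : (1 - a) ^+ 2 + a ^+ 2 * C <= 1 - 7 / 4 * a.
  have -> : (1 - a) ^+ 2 + a ^+ 2 * C = 1 - 2 * a + a * (a * (C + 1)) by ring.
  by have := ler_wpM2l (ltW a0) h; lra.
have a1 : 0 <= 1 + a by lra.
have := ler_wpM2l a1 h1; move/le_trans; apply; nra.
Qed.

Fact resid_coef (a : R) : 0 < a -> a <= 1 / 4 -> (1 + a^-1) * 5 <= 25 / (4 * a).
Proof.
move=> a0 a1; have -> : (1 + a^-1) * 5 = (20 * a + 20) / (4 * a).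
  by field; rewrite gt_eqF.
by rewrite ler_pM2r ?invr_gt0 ?mulr_gt0 //; lra.
Qed.

Fact cons_estimate (d b b' D c Y N s U q zt G : R) :
  0 < d -> d <= 1 / 16 -> 0 <= D ->
  b' <= (1 - d / 2) * b + 4 / 3 * (Y * N * s) + 4 / d ^+ 2 * D + G * c ->
  D <= Y * d ^+ 2 * ((N * U + s) / 288 + N * q / (240 * 240)) + 4 * Y * zt ->
  b' <= (1 - d / 2) * b + G * c + Y * N * s * (4 / 3) + Y * (N * U + s) / 72
    + Y * N * q / (120 * 120) + 16 * Y * zt / d ^+ 2.
Proof.
move=> d0 d1 D0 hb hD.
have c0 : 0 <= 4 / d ^+ 2 by rewrite divr_ge0 // sqr_ge0.
have := ler_wpM2l c0 hD.
have -> : 4 / d ^+ 2 * (Y * d ^+ 2 * ((N * U + s) / 288 + N * q / (240 * 240)) + 4 * Y * zt) =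
  Y * (N * U + s) / 72 + Y * N * q / (120 * 120) + 16 * Y * zt / d ^+ 2.
  by field; rewrite gt_eqF.
move: hb; move: (4 / d ^+ 2 * D) (_ / d ^+ 2) => u v; lra.
Qed.

Let lyap_b_abstract (d a b b' v v' p1 p2 p3 p4 p5 k1 k2 k3 k4 k5 : R) :
  0 < d -> d <= 1 / 16 -> 4 * d <= a -> 0 <= b -> 0 <= v -> 0 <= p1 -> 0 <= p2 ->
  0 <= p3 -> 0 <= p4 -> 0 <= p5 -> p2 <= p1 ->
  b' <= (1 - d / 2) * b + 5 / 96 * a * v + p1 * (4 / 3) + (p3 + p2) / 72
        + p4 / (120 * 120) + 16 * p5 ->
  v' <= (1 - 3 / 4 * a) * v + k1 + k2 + k3 + k4 + k5 ->
  k1 <= d / 37 * b' -> k2 <= d / 150 * b ->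
  k3 <= (p3 + p2) / 1000 / 1000 + p4 / 1000 / 1000 + p5 / 100 ->
  k4 <= 2 / 317 * p4 + (p3 + p2) / 1000 / 1000 -> k5 <= p1 / 1000 ->
  b' + v' <= (1 - 46 / 100 * d) * (b + v) + 3 / 2 * p1 + p3 / 70 + p4 / 150 + 17 * p5.
Proof.
move=> d0 d1 ad b0 v0 p10 p20 p30 p40 p50 p21 hb hv h1 h2 h3 h4 h5.
have d37 : 0 <= d / 37 by rewrite divr_ge0 // ltW.
have m0 := ler_wpM2l d37 hb.
have a0 : 0 <= a by apply: le_trans ad; rewrite mulr_ge0 // ltW.
have m1 := ler_wpM2r p10 d1; have m2 := ler_wpM2r p20 d1; have m3 := ler_wpM2r p30 d1.
have m4 := ler_wpM2r p40 d1; have m5 := ler_wpM2r p50 d1.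
have m6 := ler_wpM2r (mulr_ge0 a0 v0) d1.
have m7 := ler_wpM2r v0 ad.
have m8 : 0 <= d * d * b by rewrite !mulr_ge0 // ltW.
have m9 : 0 <= d * v by rewrite mulr_ge0 // ltW.
have m10 : 0 <= d * b by rewrite mulr_ge0 // ltW.
lra.
Qed.

Let mul_small (K x S : R) : 0 <= K -> K <= 1 / 317 -> 0 <= S -> x <= S ->
  K * x <= 1 / 317 * S.
Proof.
by move=> K0 K1 S0 xS; apply: le_trans (ler_wpM2l K0 xS) _; exact: ler_wpM2r.
Qed.

(** The term of [c] in the recursion of [b] is a small part of the contraction
    of [w c], and the terms of [b] and [b'] in the recursion of [w c] have the
    factors [K g1] and [K g2], which are small compared with [d]. *)
Fact lyap_b_estimate (b b' c c' D K w a g1 g2 Y N s U q q' zt d : R) :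
  0 < d -> d <= 1 / 16 -> 4 * d <= a -> 0 <= b -> 0 <= b' -> 0 <= c ->
  0 <= Y -> 1 <= N -> 0 <= s -> 0 <= U -> 0 <= q -> 0 <= zt ->
  0 <= w -> w <= 1 / 1000 -> 0 <= K -> K <= 1 / 317 ->
  K * g1 <= d / 37 -> K * g2 <= d / 150 ->
  b' <= (1 - d / 2) * b + 5 / 96 * a * w * c + Y * N * s * (4 / 3)
    + Y * (N * U + s) / 72 + Y * N * q / (120 * 120) + 16 * Y * zt / d ^+ 2 ->
  D <= Y * d ^+ 2 * ((N * U + s) / 288 + N * q / (240 * 240)) + 4 * Y * zt ->
  w * c' <= (1 - 3 / 4 * a) * (w * c) + K * (g1 * b' + g2 * b + D + N * Y * q')
    + w * (Y * N * s) ->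
  q' <= 2 * q + d ^+ 2 / 288 * (U + s / N) ->
  b' + w * c' <= (1 - 46 / 100 * d) * (b + w * c) + 3 / 2 * (Y * N * s)
    + Y * N * U / 70 + Y * N * q / 150 + 17 * (Y * zt / d ^+ 2).
Proof.
move=> d0 d1 ad b0 b'0 c0 Y0 N1 s0 U0 q0 zt0 w0 w1 K0 K1 Kg1 Kg2 hb hD hc hq.
have N0 : 0 < N by rewrite (lt_le_trans ltr01).
have d2 : d ^+ 2 <= 1 / 256 by nra.
have d20 : 0 < d ^+ 2 by rewrite exprn_gt0.
have p1 : 0 <= Y * N * s by rewrite !mulr_ge0 // ltW.
have p2 : 0 <= Y * s by rewrite mulr_ge0.
have p3 : 0 <= Y * N * U by rewrite !mulr_ge0 // ltW.
have p4 : 0 <= Y * N * q by rewrite !mulr_ge0 // ltW.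
have p5 : 0 <= Y * zt / d ^+ 2 by rewrite divr_ge0 ?mulr_ge0 // ltW.
have p21 : Y * s <= Y * N * s by rewrite -mulrA ler_wpM2l // ler_peMl.
have e5 : Y * zt = d ^+ 2 * (Y * zt / d ^+ 2) by field; rewrite gt_eqF.
have hD' : D <= (Y * N * U + Y * s) / 288 / 256 + Y * N * q / (240 * 240) / 256
    + 4 / 256 * (Y * zt / d ^+ 2).
  have := ler_wpM2r p3 d2; have := ler_wpM2r p2 d2; have := ler_wpM2r p4 d2.
  have := ler_wpM2r p5 d2; rewrite -e5; move: hD; move: (Y * zt / _) => u.
  lra.
have hq' : N * Y * q' <= 2 * (Y * N * q) + (Y * N * U + Y * s) / 288 / 256.
  have NY : 0 <= N * Y by rewrite mulr_ge0 // ltW.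
  have := ler_wpM2l NY hq.
  have -> : N * Y * (2 * q + d ^+ 2 / 288 * (U + s / N)) =
     2 * (Y * N * q) + d ^+ 2 * (Y * N * U + Y * s) / 288 by field; rewrite gt_eqF.
  have := ler_wpM2r p3 d2; have := ler_wpM2r p2 d2.
  lra.
apply: (@lyap_b_abstract d a b b' (w * c) (w * c') (Y * N * s) (Y * s) (Y * N * U)
  (Y * N * q) (Y * zt / d ^+ 2) (K * (g1 * b')) (K * (g2 * b)) (K * D)
  (K * (N * Y * q')) (w * (Y * N * s))) => //.
- by rewrite mulr_ge0.
- have e1 : Y * (N * U + s) / 72 = (Y * N * U + Y * s) / 72 by rewrite mulrDr mulrA.
  have e2 : 16 * Y * zt / d ^+ 2 = 16 * (Y * zt / d ^+ 2) by rewrite !mulrA.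
  have e3 : 5 / 96 * a * w * c = 5 / 96 * a * (w * c) by rewrite !mulrA.
  by move: hb; rewrite e1 e2 e3.
- by move: hc; rewrite !mulrDr !addrA.
- by rewrite mulrA; apply: ler_wpM2r.
- by rewrite mulrA; apply: ler_wpM2r.
- apply: le_trans (mul_small K0 K1 _ hD') _; first by move: p2 p3 p4 p5; clear; lra.
  by move: p2 p3 p4 p5; clear; lra.
- apply: le_trans (mul_small K0 K1 _ hq') _; first by move: p2 p3 p4 p5; clear; lra.
  by move: p2 p3 p4 p5; clear; lra.
- by have := ler_wpM2r p1 w1; lra.
Qed.

Let lyap_v_abstract (phi phi' em eq eU Z Z' bz lu t1 t2 t3 k1 k2 d : R) :
  0 < d -> d <= 1 / 16 -> 0 <= eU -> 0 <= eq -> 0 <= Z ->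
  phi' <= phi - eq / 2 - eU / 2 + bz + lu + t1 ->
  Z' <= (1 - 46 / 100 * d) * Z + t2 + k1 + k2 + t3 ->
  bz <= d / 8 * Z -> lu <= eU / 100 -> k1 <= eU / 100 -> k2 <= eq / 100 ->
  2 * em * phi <= eq -> em <= d / 24 ->
  phi' + Z' <= (1 - em / 2) * (phi + Z) + t1 + t2 + t3.
Proof.
move=> d0 d1 eU0 eq0 Z0 h1 h2 h3 h4 h5 h6 h7 h8.
have m1 := ler_wpM2r Z0 h8; have m2 : 0 <= d * Z by rewrite mulr_ge0 // ltW.
lra.
Qed.

(** The weight [8 L^2 e / (N d)] of [Lb] makes the contraction of [Lb] absorb
    the consensus error in the descent inequality. In return, [Lb] brings in
    squared gradients with the factor [(e L)^2], which is small enough for the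
    negative terms of the descent inequality. *)
Fact lyap_v_estimate (phi phi' q U b Lb Lb' e e' L mu N s zt d : R) :
  0 < d -> d <= 1 / 16 -> 0 < N -> 0 <= U -> 0 <= q -> 0 <= Lb' -> 0 <= L ->
  b <= Lb -> 0 <= b -> 0 < e -> e' <= e -> e * L <= d / 24 -> mu <= L ->
  2 * mu * phi <= q ->
  phi' <= phi - e / 2 * q - e / 2 * U + e / 2 * (2 * L ^+ 2 / N * b)
    + L * e ^+ 2 / 2 * (U + s / N) ->
  Lb' <= (1 - 46 / 100 * d) * Lb + 3 / 2 * (e ^+ 2 * N * s)
    + e ^+ 2 * N * U / 70 + e ^+ 2 * N * q / 150 + 17 * (e ^+ 2 * zt / d ^+ 2) ->
  phi' + 8 * L ^+ 2 / (N * d) * e' * Lb' <=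
    (1 - e * mu / 2) * (phi + 8 * L ^+ 2 / (N * d) * e * Lb)
    + L * e ^+ 2 * s / (2 * N) + 12 * L ^+ 2 * e ^+ 3 * s / d
    + 136 * L ^+ 2 * e ^+ 3 * zt / (N * d ^+ 3).
Proof.
move=> d0 d1 N0 U0 q0 Lb'0 L0 bLb b0 e0 ee eL muL hq hphi hLb.
have dn : d != 0 by rewrite gt_eqF.
have Nn : N != 0 by rewrite gt_eqF.
pose A := 8 * L ^+ 2 / (N * d); rewrite -/A.
have A0 : 0 <= A by rewrite /A divr_ge0 ?mulr_ge0 ?sqr_ge0 // ltW.
have Ae : 0 <= A * e by rewrite mulr_ge0 // ltW.
have eU : 0 <= e * U by rewrite mulr_ge0 // ltW.
have eq : 0 <= e * q by rewrite mulr_ge0 // ltW.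
have eL0 : 0 <= e * L by rewrite mulr_ge0 // ltW.
have X1 : (e * L) ^+ 2 / d <= d / 576.
  rewrite ler_pdivrMr //.
  have h : (e * L) ^+ 2 <= (d / 24) ^+ 2.
    by rewrite ler_sqr ?nnegrE //; apply: le_trans eL.
  by apply: le_trans h _; apply: le_of_eq; field.
have X2 : (e * L) ^+ 2 / d <= 1 / 1000 by apply: le_trans X1 _; lra.
have hL := ler_wpM2l Ae hLb.
apply: (@le_trans _ _ (phi' + A * e * Lb')).
  by rewrite lerD2l; apply: ler_wpM2r => //; apply: ler_wpM2l.
apply: (@lyap_v_abstract phi phi' (e * mu) (e * q) (e * U) (A * e * Lb) (A * e * Lb')
  (e / 2 * (2 * L ^+ 2 / N * b)) (L * e ^+ 2 / 2 * U) _ _ _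
  (8 / 70 * ((e * L) ^+ 2 / d * (e * U))) (8 / 150 * ((e * L) ^+ 2 / d * (e * q))) d) => //.
- by rewrite mulr_ge0 // (le_trans b0).
- by apply: le_trans hphi _; apply: le_of_eq; field.
- apply: le_trans hL _; rewrite le_eqVlt /A; apply/orP; left; apply/eqP.
  by field; rewrite dn.
- have -> : e / 2 * (2 * L ^+ 2 / N * b) = d / 8 * (A * e * b).
    by rewrite /A; field; rewrite dn.
  apply: ler_wpM2l; first by rewrite divr_ge0 // ltW.
  exact: ler_wpM2l.
- have -> : L * e ^+ 2 / 2 * U = (e * L) / 2 * (e * U) by ring.
  have := ler_wpM2r eU eL; have := ler_wpM2r eU d1; lra.
- have := ler_wpM2r eU X2; lra.
- have := ler_wpM2r eq X2; lra.
- have := ler_wpM2l (ltW e0) hq; lra.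
- by apply: le_trans eL; apply: ler_wpM2l => //; exact: ltW.
Qed.

(** Bernoulli's inequality for [(1 + 1 / t)^(-r)], by expansion for the three
    exponents that occur. *)
Fact inv_pow_decay (t : R) (r : nat) : (r \in [:: 1; 2; 4])%N -> 4 <= t ->
  (1 - r%:R / t) / t ^+ r <= 1 / (t + 1) ^+ r.
Proof.
move=> hr t4; have t0 : 0 < t by apply: lt_le_trans t4.
have t1 : 0 < t + 1 by rewrite addr_gt0.
have e1 : (1 - r%:R / t) / t ^+ r = (t - r%:R) / (t * t ^+ r).
  by field; rewrite expf_neq0 gt_eqF.
rewrite e1 ler_pdivrMr ?mulr_gt0 ?exprn_gt0 // mulrAC mul1r ler_pdivlMr ?exprn_gt0 //.
move: hr; rewrite !inE => /or3P[] /eqP ->.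
- by rewrite !expr1; nra.
- have -> : (t - 2%:R) * (t + 1) ^+ 2 = t * t ^+ 2 - (3 * t + 2) by ring.
  by rewrite gerBl; lra.
- have -> : (t - 4%:R) * (t + 1) ^+ 4 =
    t * t ^+ 4 - (10 * t ^+ 3 + 20 * t ^+ 2 + 15 * t + 4) by ring.
  by rewrite gerBl !addr_ge0 // ?mulr_ge0 ?exprn_ge0 // ltW.
Qed.

(** The same for real exponents, from the concavity of [ln] and the convexity
    of [expR]. *)
Fact powR_decay (t a : R) : 0 < t -> 0 <= a ->
  (1 - a / t) * (t `^ a)^-1 <= ((t + 1) `^ a)^-1.
Proof.
move=> t0 a0; have t1 : 0 < t + 1 by rewrite addr_gt0.
rewrite /powR !gt_eqF // -!expRN.
have -> : - (a * ln (t + 1)) = (a * ln t - a * ln (t + 1)) + - (a * ln t) by ring.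
rewrite expRD ler_pM2r ?expR_gt0 //; apply: le_trans (expR_ge1Dx _); rewrite lerD2l.
have e1 : t + 1 = t * (1 + t^-1) by rewrite mulrDr mulr1 mulfV ?gt_eqF.
have l1 : ln (t + 1) <= ln t + t^-1.
  rewrite e1 lnM ?posrE // ?addr_gt0 ?invr_gt0 // lerD2l.
  by apply: le_ln1Dx; rewrite (lt_trans (ltrN10 _)) // invr_gt0.
have := ler_wpM2l a0 l1; lra.
Qed.

End ScalarEstimates.

(** * Rates for vanishing step sizes *)

Section Rates.
Context {R : realType}.

Let rate_factor_ge0 (d : R) : d <= 1 / 16 -> 0 <= 1 - d / 6.
Proof. by move=> ?; lra. Qed.

Let rate_abstract (d r B B' p p' x y x' y' : R) : 0 < d -> d <= 1 / 16 ->
  0 <= r -> 0 <= p -> 0 <= x -> 0 <= y ->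
  B' <= (1 - 45 / 100 * d) * B + 3 / 8 * d * x + 17 / 41 * d * y + 2 / 5 * d * p ->
  B <= r + (p + x + y) ->
  forall c pb pb', p = c * pb -> p' = c * pb' ->
  c * ((1 - d / 48) * pb) <= c * pb' ->
  (1 - d / 48) * x <= x' -> (1 - d / 48) * y <= y' ->
  B' <= (1 - d / 6) * r + (p' + x' + y').
Proof.
move=> d0 d1 r0 p0 x0 y0 h1 h2 c pb pb' ep ep' h3 h4 h5.
rewrite mulrCA -ep -ep' in h3.
have c0 : 0 <= 1 - 45 / 100 * d by lra.
have k1 := ler_wpM2l c0 h2.
have k2 : 0 <= d * r by rewrite mulr_ge0 // ltW.
have k3 : 0 <= d * p by rewrite mulr_ge0 // ltW.
have k4 : 0 <= d * x by rewrite mulr_ge0 // ltW.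
have k5 : 0 <= d * y by rewrite mulr_ge0 // ltW.
lra.
Qed.

Let collect_abstract (dist a0 x0 x1 x2 x2' x4 x4' a5 a6 a7 a8 : R) :
  dist <= a7 + a8 -> 0 <= a5 -> 0 <= a6 ->
  a7 <= 2 * (x0 + 10 / 9 * x1 + 30 * x2 + 20 * 23 * x4) ->
  a8 <= a0 + 1 / (200 * 100) * (x0 + 10 / 9 * x1 + 30 * x2 + 20 * 23 * x4)
    + 8 * x2' + 82 * x4' ->
  0 <= x0 -> 0 <= x1 -> 0 <= x2 -> 0 <= x2' -> 0 <= x4 -> 0 <= x4' ->
  dist <= a0 + 8 * x1 + 48 * (14 * x2 + 3 * x2') + 96 * (32 * x4 + 9 * x4') + 70 * x0
    + a5 + a6.
Proof. by move=> ? ? ? ? ? ? ? ? ? ? ?; lra. Qed.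

Let term_decay (th t G K : R) (r : nat) : (r \in [:: 1; 2; 4])%N -> 4 <= t -> 0 <= G ->
  K <= (th / 2 - r%:R) * G ->
  (1 - th / (2 * t)) * (G / t ^+ r) + K / t ^+ r.+1 <= G / (t + 1) ^+ r.
Proof.
move=> hr t4 G0 hK; have t0 : 0 < t by apply: lt_le_trans t4.
have tr : 0 < t ^+ r.+1 by rewrite exprn_gt0.
have h1 := ler_wpM2l G0 (inv_pow_decay hr t4).
rewrite mul1r in h1; apply: le_trans h1.
have -> : G * ((1 - r%:R / t) / t ^+ r) =
  (1 - th / (2 * t)) * (G / t ^+ r) + (th / 2 - r%:R) * G / t ^+ r.+1.
  by rewrite exprS; field; rewrite expf_neq0 ?gt_eqF.
by rewrite lerD2l ler_pM2r ?invr_gt0.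
Qed.

(** A supersolution of the recursion for the suboptimality: the contribution
    of the initial value, and one negative power of [t] for each source term. *)
Let psi (a m V0 G1 G2 G4 t : R) : R :=
  V0 * (m `^ a * (t `^ a)^-1) + G1 / t ^+ 1 + G2 / t ^+ 2 + G4 / t ^+ 4.

(** The contraction [1 - th / (2 t)] is faster than the decay of [t^-r] as
    soon as [r < th / 2]; the surplus [(th / 2 - r) G] pays for the source
    term. *)
Let psi_step (th m V0 G1 G2 G4 K1 K2 K4 t v v' : R) :
  20 <= th -> th / 2 <= t -> 0 < m -> 0 <= V0 -> 0 <= G1 -> 0 <= G2 -> 0 <= G4 ->
  K1 <= 9 / 20 * th * G1 -> K2 <= 2 / 5 * th * G2 -> K4 <= 3 / 10 * th * G4 ->
  v' <= (1 - th / (2 * t)) * v + K1 / t ^+ 2 + K2 / t ^+ 3 + K4 / t ^+ 5 ->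
  v <= psi (th / 2) m V0 G1 G2 G4 t -> v' <= psi (th / 2) m V0 G1 G2 G4 (t + 1).
Proof.
move=> th20 tht m0 V00 G10 G20 G40 hK1 hK2 hK4 hv' hv.
have t4 : 4 <= t by lra.
have t0 : 0 < t by lra.
have c0 : 0 <= 1 - th / (2 * t).
  by rewrite subr_ge0 ler_pdivrMr ?mulr_gt0 //; lra.
have w1 : 9 / 20 * th * G1 <= (th / 2 - 1%:R) * G1 by apply: ler_wpM2r => //; lra.
have w2 : 2 / 5 * th * G2 <= (th / 2 - 2%:R) * G2 by apply: ler_wpM2r => //; lra.
have w4 : 3 / 10 * th * G4 <= (th / 2 - 4%:R) * G4 by apply: ler_wpM2r => //; lra.
have d1 := @term_decay th t G1 K1 1 isT t4 G10 (le_trans hK1 w1).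
have d2 := @term_decay th t G2 K2 2 isT t4 G20 (le_trans hK2 w2).
have d4 := @term_decay th t G4 K4 4 isT t4 G40 (le_trans hK4 w4).
have a0 : 0 <= th / 2 by lra.
have d0 := powR_decay t0 a0.
have Vm : 0 <= V0 * m `^ (th / 2) by rewrite mulr_ge0 // powR_ge0.
have {}d0 := ler_wpM2l Vm d0.
have := ler_wpM2l c0 hv.
have e1 : th / (2 * t) = th / 2 / t by field; rewrite gt_eqF.
rewrite /psi; move: hv' d0 d1 d2 d4; rewrite e1.
move: (1 - th / 2 / t) ((t `^ _)^-1) (((t + 1) `^ _)^-1) => c p p'.
move: (G1 / t ^+ 1) (G2 / t ^+ 2) (G4 / t ^+ 4) => g1 g2 g4.
move: (G1 / _) (G2 / _) (G4 / _) (K1 / _) (K2 / _) (K4 / _) => g1' g2' g4' k1 k2 k4.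
clear; move: (m `^ _) => mm; lra.
Qed.

Let psi_ge0 (a m V0 G1 G2 G4 t : R) : 0 < t -> 0 <= V0 -> 0 <= G1 -> 0 <= G2 ->
  0 <= G4 -> 0 <= psi a m V0 G1 G2 G4 t.
Proof.
move=> t0 V00 G10 G20 G40; have tp k : 0 <= t ^+ k by rewrite exprn_ge0 // ltW.
rewrite /psi !addr_ge0 // ?divr_ge0 //.
by rewrite mulr_ge0 // mulr_ge0 ?invr_ge0 ?powR_ge0.
Qed.

Let psi_decay (th m V0 G1 G2 G4 d t : R) :
  20 <= th -> th / t <= d / 24 -> th / 2 <= t -> 0 < m -> 0 <= V0 ->
  0 <= G1 -> 0 <= G2 -> 0 <= G4 ->
  (1 - d / 48) * psi (th / 2) m V0 G1 G2 G4 t <= psi (th / 2) m V0 G1 G2 G4 (t + 1).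
Proof.
move=> th20 thd tht m0 V00 G10 G20 G40.
have t0 : 0 < t by lra.
have -> : 1 - d / 48 = 1 - th / (2 * t) + (th / (2 * t) - d / 48) by ring.
apply: (@psi_step th m V0 G1 G2 G4 0 0 0 t (psi (th / 2) m V0 G1 G2 G4 t)) => //.
- by rewrite !mulr_ge0 //; lra.
- by rewrite !mulr_ge0 //; lra.
- by rewrite !mulr_ge0 //; lra.
rewrite !mul0r !addr0 mulrDl gerDl.
apply: mulr_le0_ge0; last exact: psi_ge0.
have -> : th / (2 * t) = th / t / 2 by field; rewrite gt_eqF.
by lra.
Qed.

Definition vbound (th mu L m N s z d V0 t : R) : R :=
  psi (th / 2) m V0 (10 / 9 * (L * th * s / (N * mu ^+ 2)))
    (30 * (L ^+ 2 * th ^+ 2 * s / (d * mu ^+ 3)))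
    ((20 * 23) * (L ^+ 2 * th ^+ 2 * z / (N * d ^+ 3 * mu ^+ 3))) t.

Context {th mu L m N s z d : R}.
Hypothesis th20 : 20 <= th.
Hypothesis mu0 : 0 < mu.
Hypothesis muL : mu <= L.
Hypothesis N0 : 0 < N.
Hypothesis s0 : 0 <= s.
Hypothesis z0 : 0 <= z.
Hypothesis d0 : 0 < d.
Hypothesis d1 : d <= 1 / 16.
Hypothesis m0 : 0 < m.
Hypothesis hm : th * L / mu <= d / 24 * m.

Let th0 : 0 < th. Proof. by apply: lt_le_trans th20. Qed.
Let L0 : 0 < L. Proof. exact: lt_le_trans mu0 muL. Qed.

Let t_gt0 (k : nat) : 0 < k%:R + m. Proof. by rewrite ltr_wpDl. Qed.

Let th_le_m : th <= d / 24 * m.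
Proof.
apply: le_trans hm; rewrite -mulrA ler_peMr ?(ltW th0) //.
by rewrite ler_pdivlMr // mul1r.
Qed.

Let th_t (k : nat) : th / (k%:R + m) <= d / 24.
Proof.
rewrite ler_pdivrMr //; apply: le_trans th_le_m _.
by rewrite ler_pM2l ?divr_gt0 // lerDr.
Qed.

Let th2_t (k : nat) : th / 2 <= k%:R + m.
Proof.
have h1 : d / 24 * m <= m / 2.
  by have := ler_wpM2r (ltW m0) d1; move: (m0) => m0'; lra.
have h2 : 0 <= k%:R :> R by [].
have h3 := th_le_m; have h4 := m0; have h5 := th20.
by lra.
Qed.

Let G1_ge0 : 0 <= 10 / 9 * (L * th * s / (N * mu ^+ 2)).
Proof.
apply: mulr_ge0; first by rewrite divr_ge0.
by apply: divr_ge0; rewrite ?mulr_ge0 ?exprn_ge0 // ltW.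
Qed.

Let G2_ge0 : 0 <= 30 * (L ^+ 2 * th ^+ 2 * s / (d * mu ^+ 3)).
Proof.
apply: mulr_ge0 => //.
by apply: divr_ge0; [apply: mulr_ge0 s0; apply: mulr_ge0; exact: sqr_ge0|
  rewrite mulr_ge0 ?exprn_ge0 // ltW].
Qed.

Let G4_ge0 : 0 <= (20 * 23) * (L ^+ 2 * th ^+ 2 * z / (N * d ^+ 3 * mu ^+ 3)).
Proof.
apply: mulr_ge0; first by rewrite mulr_ge0.
apply: divr_ge0; first by apply: mulr_ge0 z0; apply: mulr_ge0; exact: sqr_ge0.
by rewrite !mulr_ge0 ?exprn_ge0 // ltW.
Qed.

Lemma vbound_ge0 V0 (k : nat) : 0 <= V0 -> 0 <= vbound th mu L m N s z d V0 (k%:R + m).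
Proof. by move=> V00; apply: psi_ge0. Qed.

Lemma vbound_decay V0 (k : nat) : 0 <= V0 ->
  (1 - d / 48) * vbound th mu L m N s z d V0 (k%:R + m) <=
  vbound th mu L m N s z d V0 (k.+1%:R + m).
Proof.
move=> V00; have -> : k.+1%:R + m = k%:R + m + 1 by rewrite -natr1; ring.
by apply: psi_decay; rewrite ?th_t ?th2_t.
Qed.

Lemma lyap_v_rate (V : nat -> R) : 0 <= V 0%N ->
  (forall k, let t := k%:R + m in let e := th / (mu * t) in
    V k.+1 <= (1 - e * mu / 2) * V k + L * e ^+ 2 * s / (2 * N)
      + 12 * L ^+ 2 * e ^+ 3 * s / d
      + 136 * L ^+ 2 * e ^+ 3 * (z / t ^+ 2) / (N * d ^+ 3)) ->
  forall k, V k <= vbound th mu L m N s z d (V 0%N) (k%:R + m).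
Proof.
move=> V00 HV; elim=> [|k ih].
  rewrite add0r /vbound /psi mulfV ?gt_eqF ?powR_gt0 // mulr1 -!addrA lerDl.
  by rewrite !addr_ge0 // divr_ge0 // exprn_ge0 // ltW.
have -> : k.+1%:R + m = k%:R + m + 1 by rewrite -natr1; ring.
have t0 := t_gt0 k; set t := k%:R + m in ih t0 *.
have tn : t != 0 by rewrite gt_eqF.
have mn : mu != 0 by rewrite gt_eqF.
have nn : N != 0 by rewrite gt_eqF.
have dn : d != 0 by rewrite gt_eqF.
have tn0 : th != 0 by rewrite gt_eqF.
apply: (@psi_step th m (V 0%N) _ _ _ (L * th ^+ 2 * s / (2 * N * mu ^+ 2))
  (12 * (L ^+ 2 * th ^+ 3 * s / (d * mu ^+ 3)))
  (136 * (L ^+ 2 * th ^+ 3 * z / (N * d ^+ 3 * mu ^+ 3))) t (V k)) => //.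
- exact: th2_t.
- by apply: le_of_eq; field; rewrite mn nn.
- by apply: le_of_eq; field; rewrite mn dn.
- have -> : 3 / 10 * th * (20 * 23 * (L ^+ 2 * th ^+ 2 * z / (N * d ^+ 3 * mu ^+ 3))) =
    138 * (L ^+ 2 * th ^+ 3 * z / (N * d ^+ 3 * mu ^+ 3)) by field; rewrite mn nn dn.
  apply: ler_wpM2r; last by rewrite ler_nat.
  apply: divr_ge0; last by rewrite !mulr_ge0 ?exprn_ge0 // ltW.
  by apply: mulr_ge0 z0; apply: mulr_ge0; rewrite exprn_ge0 // ltW.
apply: le_trans (HV k) _; rewrite -/t le_eqVlt; apply/orP; left; apply/eqP.
by field; rewrite tn mn nn dn.
Qed.

(** The source terms lose at most the fraction [d / 48] per round, so that
    they are nearly constant on the time scale [1 / d] of the contraction: up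
    to constants, the solution is the transient plus the source terms divided
    by [d]. *)
Lemma lyap_b_rate (V0 : R) (B : nat -> R) : 0 <= V0 -> 0 <= B 0%N ->
  (forall k, let t := k%:R + m in let e := th / (mu * t) in
    B k.+1 <= (1 - 45 / 100 * d) * B k + 3 / 2 * N * s * e ^+ 2
      + 17 * (e ^+ 2 * (z / t ^+ 2) / d ^+ 2)
      + N * d / (100 * 1000 * mu) * vbound th mu L m N s z d V0 t) ->
  forall k, B k <= (1 - d / 6) ^+ k * B 0%N
    + (N / (200 * 200 * mu) * vbound th mu L m N s z d V0 (k%:R + m)
       + 4 * (N * s * th ^+ 2 / (mu ^+ 2 * d)) / (k%:R + m) ^+ 2
       + 41 * (th ^+ 2 * z / (mu ^+ 2 * d ^+ 3)) / (k%:R + m) ^+ 4).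
Proof.
move=> V00 B0 HB.
have c1 : 0 <= N / (200 * 200 * mu).
  exact: divr_ge0 (ltW N0) (mulr_ge0 (mulr_ge0 (ler0n _ _) (ler0n _ _)) (ltW mu0)).
have c2 : 0 <= 4 * (N * s * th ^+ 2 / (mu ^+ 2 * d)).
  apply: mulr_ge0 => //; apply: divr_ge0; first by rewrite mulr_ge0 ?sqr_ge0 // mulr_ge0 // ltW.
  by rewrite mulr_ge0 ?sqr_ge0 // ltW.
have c3 : 0 <= 41 * (th ^+ 2 * z / (mu ^+ 2 * d ^+ 3)).
  apply: mulr_ge0 => //; apply: divr_ge0; first by rewrite mulr_ge0 ?sqr_ge0.
  by rewrite mulr_ge0 ?sqr_ge0 // exprn_ge0 // ltW.
elim=> [|k ih].
  rewrite expr0 mul1r lerDl; apply: addr_ge0; first apply: addr_ge0.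
  - exact: mulr_ge0 c1 (vbound_ge0 0 V00).
  - by apply: divr_ge0 c2 _; rewrite exprn_ge0 // ltW.
  - by apply: divr_ge0 c3 _; rewrite exprn_ge0 // ltW.
have t0 := t_gt0 k; have hB := HB k; rewrite /= in hB.
have hv := vbound_decay k V00; have v0 := vbound_ge0 k V00.
have e1 : k.+1%:R + m = k%:R + m + 1 by rewrite -natr1; ring.
have tt := th_t k; have t2 := th2_t k; rewrite e1 in hv *.
set t := k%:R + m in ih t0 hB hv v0 tt t2 *.
have q2 : (1 - d / 48) * (4 * (N * s * th ^+ 2 / (mu ^+ 2 * d)) / t ^+ 2) <=
   4 * (N * s * th ^+ 2 / (mu ^+ 2 * d)) / (t + 1) ^+ 2.
  have := @psi_decay th m 0 0 (4 * (N * s * th ^+ 2 / (mu ^+ 2 * d))) 0 d t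
    th20 tt t2 m0 (lexx 0) (lexx 0) c2 (lexx 0).
  by rewrite /psi !mul0r !add0r !addr0.
have q4 : (1 - d / 48) * (41 * (th ^+ 2 * z / (mu ^+ 2 * d ^+ 3)) / t ^+ 4) <=
   41 * (th ^+ 2 * z / (mu ^+ 2 * d ^+ 3)) / (t + 1) ^+ 4.
  have := @psi_decay th m 0 0 0 (41 * (th ^+ 2 * z / (mu ^+ 2 * d ^+ 3))) d t
    th20 tt t2 m0 (lexx 0) (lexx 0) (lexx 0) c3.
  by rewrite /psi !mul0r !add0r.
have tn : t != 0 by rewrite gt_eqF.
have mn : mu != 0 by rewrite gt_eqF.
have dn : d != 0 by rewrite gt_eqF.
have s2 : 3 / 2 * N * s * (th / (mu * t)) ^+ 2 =
    3 / 8 * d * (4 * (N * s * th ^+ 2 / (mu ^+ 2 * d)) / t ^+ 2).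
  by field; rewrite tn mn dn.
have s4 : 17 * ((th / (mu * t)) ^+ 2 * (z / t ^+ 2) / d ^+ 2) =
    17 / 41 * d * (41 * (th ^+ 2 * z / (mu ^+ 2 * d ^+ 3)) / t ^+ 4).
  by field; rewrite tn mn dn.
have s5 : N * d / (100 * 1000 * mu) * vbound th mu L m N s z d V0 t =
    2 / 5 * d * (N / (200 * 200 * mu) * vbound th mu L m N s z d V0 t).
  by move: (vbound _ _ _ _ _ _ _ _ _ _) => vb; field; rewrite mn.
have hv' := ler_wpM2l c1 hv; have v0' := mulr_ge0 c1 v0.
rewrite s2 s4 s5 in hB.
have u2 : 0 <= 4 * (N * s * th ^+ 2 / (mu ^+ 2 * d)) / t ^+ 2.
  by apply: divr_ge0 c2 _; rewrite exprn_ge0 // ltW.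
have u4 : 0 <= 41 * (th ^+ 2 * z / (mu ^+ 2 * d ^+ 3)) / t ^+ 4.
  by apply: divr_ge0 c3 _; rewrite exprn_ge0 // ltW.
have r0 : 0 <= (1 - d / 6) ^+ k * B 0%N.
  by apply: mulr_ge0 B0; apply: exprn_ge0; exact: rate_factor_ge0 d1.
rewrite exprS -mulrA.
exact: (rate_abstract d0 d1 r0 v0' u2 u4 hB ih (erefl _) (erefl _) hv' q2 q4).
Qed.

Lemma rate_collect (V0 B0 dist phi b c5 c6 : R) (k : nat) (t := k%:R + m) :
  0 <= V0 -> 0 <= c5 -> 0 <= c6 ->
  dist <= 2 / mu * phi + 2 / N * b ->
  phi <= vbound th mu L m N s z d V0 t ->
  b <= (1 - d / 6) ^+ k * B0
    + (N / (200 * 200 * mu) * vbound th mu L m N s z d V0 t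
       + 4 * (N * s * th ^+ 2 / (mu ^+ 2 * d)) / t ^+ 2
       + 41 * (th ^+ 2 * z / (mu ^+ 2 * d ^+ 3)) / t ^+ 4) ->
  dist <= (1 - d / 6) ^+ k * (2 / N * B0)
    + 8 * L * th * s / (N * mu ^+ 3 * t)
    + 48 * th ^+ 2 * (14 * (L / mu) ^+ 2 + 3) * s / (mu ^+ 2 * d * t ^+ 2)
    + 96 * th ^+ 2 * (32 * (L / mu) ^+ 2 + 9) * z / (N * mu ^+ 2 * d ^+ 3 * t ^+ 4)
    + 70 * (m `^ (th / 2)) / (mu * (t `^ (th / 2))) * V0
    + c5 * th ^+ 3 * (L / mu) ^+ 2 * s / (N * mu ^+ 2 * d * t ^+ 3)
    + c6 * th ^+ 4 * (L / mu) ^+ 3 * s / (mu ^+ 2 * d ^+ 2 * t ^+ 4).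
Proof.
move=> V00 c50 c60 hdist hphi hb; have t0 : 0 < t := t_gt0 k.
have tn : t != 0 by rewrite gt_eqF.
have mn : mu != 0 by rewrite gt_eqF.
have nn : N != 0 by rewrite gt_eqF.
have dn : d != 0 by rewrite gt_eqF.
have pn : t `^ (th / 2) != 0 by rewrite gt_eqF // powR_gt0.
pose T0 := V0 * (m `^ (th / 2) * (t `^ (th / 2))^-1) / mu.
pose T1 := L * th * s / (N * mu ^+ 3 * t).
pose T2 := (L / mu) ^+ 2 * (th ^+ 2 * s / (mu ^+ 2 * d * t ^+ 2)).
pose T2' := th ^+ 2 * s / (mu ^+ 2 * d * t ^+ 2).
pose T4 := (L / mu) ^+ 2 * (th ^+ 2 * z / (N * mu ^+ 2 * d ^+ 3 * t ^+ 4)).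
pose T4' := th ^+ 2 * z / (N * mu ^+ 2 * d ^+ 3 * t ^+ 4).
have p0 : 0 <= T0.
  by apply: divr_ge0 (ltW mu0); apply: mulr_ge0 V00 _; rewrite mulr_ge0 ?invr_ge0 ?powR_ge0.
have p1 : 0 <= T1.
  by apply: divr_ge0; [rewrite !mulr_ge0 // ltW | rewrite !mulr_ge0 ?exprn_ge0 // ltW].
have p2' : 0 <= T2'.
  apply: divr_ge0; first by apply: mulr_ge0 (sqr_ge0 _) s0.
  by rewrite !mulr_ge0 ?exprn_ge0 // ltW.
have p2 : 0 <= T2 by exact: mulr_ge0 (sqr_ge0 _) p2'.
have p4' : 0 <= T4'.
  apply: divr_ge0; first by apply: mulr_ge0 (sqr_ge0 _) z0.
  by rewrite !mulr_ge0 ?exprn_ge0 // ltW.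
have p4 : 0 <= T4 by exact: mulr_ge0 (sqr_ge0 _) p4'.
have p5 : 0 <= c5 * th ^+ 3 * (L / mu) ^+ 2 * s / (N * mu ^+ 2 * d * t ^+ 3).
  apply: divr_ge0; last by rewrite !mulr_ge0 ?exprn_ge0 // ltW.
  by apply: mulr_ge0 s0; apply: mulr_ge0 (sqr_ge0 _); apply: mulr_ge0 c50 _; rewrite exprn_ge0 ?(ltW th0).
have p6 : 0 <= c6 * th ^+ 4 * (L / mu) ^+ 3 * s / (mu ^+ 2 * d ^+ 2 * t ^+ 4).
  apply: divr_ge0; last by rewrite !mulr_ge0 ?exprn_ge0 // ltW.
  apply: mulr_ge0 s0; apply: mulr_ge0; last by rewrite exprn_ge0 // divr_ge0 // ltW.
  by apply: mulr_ge0 c60 _; rewrite exprn_ge0 ?(ltW th0).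
have ev : vbound th mu L m N s z d V0 t =
    mu * (T0 + 10 / 9 * T1 + 30 * T2 + 20 * 23 * T4).
  rewrite /vbound /psi /T0 /T1 /T2 /T4; field.
  by rewrite tn mn nn dn pn.
have e1 : 8 * L * th * s / (N * mu ^+ 3 * t) = 8 * T1.
  by rewrite /T1; field; rewrite tn mn nn.
have e2 : 48 * th ^+ 2 * (14 * (L / mu) ^+ 2 + 3) * s / (mu ^+ 2 * d * t ^+ 2)
    = 48 * (14 * T2 + 3 * T2').
  by rewrite /T2 /T2'; field; rewrite tn mn dn.
have e4 : 96 * th ^+ 2 * (32 * (L / mu) ^+ 2 + 9) * z / (N * mu ^+ 2 * d ^+ 3 * t ^+ 4)
    = 96 * (32 * T4 + 9 * T4').
  by rewrite /T4 /T4'; field; rewrite tn mn nn dn.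
have e0 : 70 * (m `^ (th / 2)) / (mu * (t `^ (th / 2))) * V0 = 70 * T0.
  by rewrite /T0; field; rewrite mn pn.
have q1 : 2 / mu * phi <= 2 * (T0 + 10 / 9 * T1 + 30 * T2 + 20 * 23 * T4).
  have c0 : 0 <= 2 / mu by rewrite divr_ge0 // ltW.
  have := ler_wpM2l c0 hphi; rewrite ev.
  by have -> // : 2 / mu * (mu * (T0 + 10 / 9 * T1 + 30 * T2 + 20 * 23 * T4)) =
    2 * (T0 + 10 / 9 * T1 + 30 * T2 + 20 * 23 * T4) by field.
have q2 : 2 / N * b <= (1 - d / 6) ^+ k * (2 / N * B0)
    + 1 / (200 * 100) * (T0 + 10 / 9 * T1 + 30 * T2 + 20 * 23 * T4) + 8 * T2' + 82 * T4'.
  have c0 : 0 <= 2 / N by rewrite divr_ge0 // ltW.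
  apply: le_trans (ler_wpM2l c0 hb) _; rewrite ev le_eqVlt; apply/orP; left; apply/eqP.
  rewrite /T2' /T4'; move: (T0 + _ + _ + _) => X; move: ((1 - d / 6) ^+ k) => rk.
  by field; rewrite tn mn nn dn.
rewrite e0 e1 e2 e4.
clear ev e0 e1 e2 e4 hphi hb.
move: hdist p5 p6 q1 q2 p0 p1 p2 p2' p4 p4'.
move: (c5 * _ * _ * _ / _) (c6 * _ * _ * _ / _) (2 / mu * phi) (2 / N * b).
move: (_ * (2 / N * B0)) T0 T1 T2 T2' T4 T4' => a0 x0 x1 x2 x2' x4 x4' a5 a6 a7 a8.
exact: collect_abstract.
Qed.

End Rates.

(** * One round of the Lyapunov functions *)

Section OneStep.
Context {R : realType}.

(** The upper bound on [g] keeps the weight [w] of the compression error and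
    its feedback [K] on the consensus error small. *)
Fact weight_bounds (a C g l d w K : R) :
  0 < a -> 0 < C -> a * (C + 1) <= 1 / 4 -> 0 < g -> g * (126 ^+ 2 * C) <= a ^+ 2 * l ->
  0 < l -> l <= 1 -> d = g / 2 * l -> w = 8 * g * C / a -> K = w * (25 / (4 * a)) ->
  [/\ w <= 1 / 1000, K <= 1 / 317 & K * g <= d / 158].
Proof.
move=> a0 C0 haC g0 hg l0 l1 -> -> ->.
have a14 : a <= 1 / 4.
  by apply: le_trans haC; rewrite ler_peMr ?(ltW a0) // lerDr ltW.
have a2l : a ^+ 2 * l <= a ^+ 2 by rewrite ler_piMr ?sqr_ge0.
have a20 : 0 < a ^+ 2 by rewrite exprn_gt0.
have eK : 8 * g * C / a * (25 / (4 * a)) = 50 * (g * C) / a ^+ 2 by field; rewrite gt_eqF.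
have gC : g * C <= a ^+ 2 * l / (126 * 126).
  by rewrite ler_pdivlMr ?mulr_gt0 ?ltr0n //; apply: le_trans hg; apply: le_of_eq; ring.
have KB : 8 * g * C / a * (25 / (4 * a)) <= l / 317.
  rewrite eK ler_pdivrMr //.
  have al0 : 0 <= a ^+ 2 * l by rewrite mulr_ge0 ?ltW.
  move: gC al0; move: (g * C) => x; rewrite [l / 317 * _]mulrAC [l * _]mulrC.
  by move: (a ^+ 2 * l) => y; lra.
split.
- rewrite ler_pdivrMr // -mulrA.
  have a2 : a ^+ 2 <= a / 4 by rewrite expr2 ler_wpM2l ?(ltW a0) //; lra.
  by move: gC a2l a2; move: (g * C) (a ^+ 2 * l) (a ^+ 2) => x y u; lra.
- by apply: le_trans KB _; lra.
rewrite eK.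
have -> : 50 * (g * C) / a ^+ 2 * g = (g * C) / a ^+ 2 * (50 * g) by ring.
have h : g * C / a ^+ 2 <= l / (126 * 126).
  by rewrite ler_pdivrMr //; apply: le_trans gC _; apply: le_of_eq; ring.
have g50 : 0 <= 50 * g by rewrite mulr_ge0 ?ler0n // ltW.
have gl : 0 <= g * l by rewrite mulr_ge0 // ltW.
apply: le_trans (ler_wpM2r g50 h) _; rewrite [g / 2 * l]mulrAC.
have -> : l / (126 * 126) * (50 * g) = 50 * (g * l) / (126 * 126) by ring.
by move: gl; move: (g * l) => x; lra.
Qed.

Let twice_le (x y : R) : x <= y / 576 -> 2 * x <= y / 288.
Proof. by move=> ?; lra. Qed.

Let step_coef (K g d : R) : 0 < d -> d <= 1 / 16 -> 0 <= K -> K <= 1 / 317 ->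
  K * g <= d / 158 -> K * (4 * g + d ^+ 2 / 288) <= d / 37.
Proof.
move=> d0 d1 K0 K1; have h := ler_wpM2l (ltW d0) d1.
have h2 := ler_wpM2r (ltW d0) K1; have h3 := ler_wpM2l K0 h.
have -> : K * (4 * g + d ^+ 2 / 288) = 4 * (K * g) + K * (d * d) / 288 by ring.
move: h2 h3 d0; have -> : K * (d * (1 / 16)) = K * d / 16 by ring.
by move: (K * g) (K * (d * d)) (K * d) => x y v; clear; lra.
Qed.

(** The Young weight of the residual in the recursion of [c] is [a]: it leaves
    the contraction [1 - 3 / 4 a] and gives the residual the factor [K = 25 w
    / (4 a)]. *)
Fact lyap_b_step (b b' c c' D q q' U e e' mu L N s z d a g C l w t : R) :
  0 < d -> d <= 1 / 16 -> 4 * d <= a -> 0 < a -> 0 < C -> a * (C + 1) <= 1 / 4 ->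
  0 < g -> g * (126 ^+ 2 * C) <= a ^+ 2 * l -> 0 < l -> l <= 1 -> d = g / 2 * l ->
  w = 8 * g * C / a -> 1 <= N -> 0 <= s -> 0 <= z ->
  0 <= b -> 0 <= b' -> 0 <= c -> 0 <= D -> 0 <= q -> 0 <= U ->
  e ^+ 2 * L ^+ 2 <= d ^+ 2 / 576 -> e' ^+ 2 <= e ^+ 2 ->
  (e' - e) ^+ 2 <= e ^+ 2 / t ^+ 2 ->
  (L / mu) ^+ 2 / t ^+ 2 <= d ^+ 2 / (576 * 400) ->
  D <= 2 * e' ^+ 2 * (L ^+ 2 * (N * e ^+ 2)) * (U + s / N)
       + 2 * (e' - e) ^+ 2 * (2 * N * (L / mu) ^+ 2 * q + 2 * z) ->
  q' <= 2 * q + 2 * (L ^+ 2 * e ^+ 2 * (U + s / N)) ->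
  b' <= (1 + d / 5) * ((1 + d / 4) * (1 - d)
           + (1 + (d / 4)^-1) * (e ^+ 2 * (2 / 3 * (2 * L ^+ 2)))) * b
        + 2 * (e ^+ 2 * (2 / 3)) * (N * s)
        + (2 + (d / 5)^-1) * (2 / (3 * d)) * D + 5 / 12 * g * (C * c) ->
  c' <= (1 + a) * ((1 - a) ^+ 2 + a ^+ 2 * C) * c
        + (1 + a^-1) * (5 * ((4 * g + 2 * (e' ^+ 2 * L ^+ 2)) * b' + g * b + D
                             + N * e' ^+ 2 * q'))
        + e' ^+ 2 * (N * s) ->
  b' + w * c' <= (1 - 46 / 100 * d) * (b + w * c) + 3 / 2 * (e ^+ 2 * N * s)
    + e ^+ 2 * N * U / 70 + e ^+ 2 * N * q / 150 + 17 * (e ^+ 2 * (z / t ^+ 2) / d ^+ 2).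
Proof.
move=> d0 d1 ad a0 C0 haC g0 hg l0 l1 ed ew N1 s0 z0 b0 b0' c0 D0 q0 U0 hX he hee hk hD hq hb hc.
have [] := @weight_bounds a C g l d w (w * (25 / (4 * a))) => //.
set K := w * _ => w1 K1 Kg.
have w0 : 0 <= w by rewrite ew divr_ge0 ?(ltW a0) // !mulr_ge0 // ltW.
have a40 : 0 < 25 / (4 * a) by rewrite divr_gt0 ?mulr_gt0 ?ltr0n.
have K0 : 0 <= K by rewrite mulr_ge0 // ltW.
have N0 : 0 < N := lt_le_trans ltr01 N1.
have Nn : N != 0 by rewrite gt_eqF.
have dn : d != 0 by rewrite gt_eqF.
have a14 : a <= 1 / 4.
  by apply: le_trans haC; rewrite ler_peMr ?(ltW a0) // lerDr ltW.
have X' : e' ^+ 2 * L ^+ 2 <= d ^+ 2 / 576.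
  by apply: le_trans hX; rewrite ler_wpM2r ?sqr_ge0.
have hD' := drift_estimate N0 U0 s0 q0 z0 hD X' hee hk.
have zt0 : 0 <= z / t ^+ 2 by rewrite divr_ge0 ?sqr_ge0.
have Us : 0 <= U + s / N by rewrite addr_ge0 // divr_ge0 // ltW.
have q'2 : q' <= 2 * q + d ^+ 2 / 288 * (U + s / N).
  apply: le_trans hq _; rewrite lerD2l mulrA ler_wpM2r //.
  by rewrite [L ^+ 2 * _]mulrC; exact: twice_le hX.
have hb' : b' <= (1 - d / 2) * b + 5 / 96 * a * w * c + e ^+ 2 * N * s * (4 / 3)
    + e ^+ 2 * (N * U + s) / 72 + e ^+ 2 * N * q / (120 * 120)
    + 16 * e ^+ 2 * (z / t ^+ 2) / d ^+ 2.
  apply: (cons_estimate d0 d1 D0 _ hD').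
  apply: le_trans hb _.
  have -> : e ^+ 2 * (2 / 3 * (2 * L ^+ 2)) = 2 / 3 * (2 * (e ^+ 2 * L ^+ 2)) by ring.
  have h1 := ler_wpM2r b0 (cons_coef d0 d1 hX).
  have h2 := ler_wpM2r D0 (drift_coef d0 d1).
  have -> : 5 / 96 * a * w * c = 5 / 12 * g * (C * c) by rewrite ew; field; rewrite gt_eqF.
  have -> : 2 * (e ^+ 2 * (2 / 3)) * (N * s) = 4 / 3 * (e ^+ 2 * N * s) by ring.
  by rewrite lerD2r; apply: lerD h2; rewrite lerD2r.
have d288 : 0 <= d ^+ 2 / 288 := divr_ge0 (sqr_ge0 _) (ler0n _ _).
have q'0 : 0 <= 2 * q + d ^+ 2 / 288 * (U + s / N).
  exact: addr_ge0 (mulr_ge0 (ler0n _ _) q0) (mulr_ge0 d288 Us).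
pose q2 := 2 * q + d ^+ 2 / 288 * (U + s / N).
have res : (4 * g + 2 * (e' ^+ 2 * L ^+ 2)) * b' + g * b + D + N * e' ^+ 2 * q' <=
    (4 * g + d ^+ 2 / 288) * b' + g * b + D + N * e ^+ 2 * q2.
  apply: lerD; last first.
    have h : N * e' ^+ 2 * q' <= N * e' ^+ 2 * q2.
      exact: (ler_wpM2l (mulr_ge0 (ltW N0) (sqr_ge0 _)) q'2).
    by apply: le_trans h _; apply: (ler_wpM2r q'0); apply: (ler_wpM2l (ltW N0)).
  rewrite !lerD2r; apply: (ler_wpM2r b0'); by rewrite lerD2l; exact: twice_le X'.
have res0 : 0 <= (4 * g + d ^+ 2 / 288) * b' + g * b + D + N * e ^+ 2 * q2.
  apply: addr_ge0; last exact: mulr_ge0 (mulr_ge0 (ltW N0) (sqr_ge0 _)) q'0.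
  apply: addr_ge0 _ D0; apply: addr_ge0; last exact: mulr_ge0 (ltW g0) b0.
  exact: mulr_ge0 (addr_ge0 (mulr_ge0 (ler0n _ _) (ltW g0)) d288) b0'.
apply: (@lyap_b_estimate R b b' c c' D K w a (4 * g + d ^+ 2 / 288) g (e ^+ 2) N s U q q2
  (z / t ^+ 2) d) => //; rewrite ?sqr_ge0 //.
- exact: step_coef.
- by apply: le_trans Kg _; rewrite ler_wpM2l ?(ltW d0) // lef_pV2 ?posrE ?ltr0n // ler_nat.
have e1 : w * ((1 + a^-1) * (5 * ((4 * g + 2 * (e' ^+ 2 * L ^+ 2)) * b' + g * b + D
    + N * e' ^+ 2 * q'))) <=
    K * ((4 * g + d ^+ 2 / 288) * b' + g * b + D + N * e ^+ 2 * q2).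
  rewrite [(1 + a^-1) * _]mulrA /K -[leRHS]mulrA; apply: (ler_wpM2l w0).
  have r5 : 0 <= (1 + a^-1) * 5.
    by apply: mulr_ge0 (ler0n _ _); rewrite addr_ge0 // invr_ge0 ltW.
  exact: le_trans (ler_wpM2l r5 res) (ler_wpM2r res0 (resid_coef a0 a14)).
have e2 : w * (e' ^+ 2 * (N * s)) <= w * (e ^+ 2 * N * s).
  by rewrite -[e ^+ 2 * N * s]mulrA; apply: (ler_wpM2l w0); apply: ler_wpM2r he; rewrite mulr_ge0 // ltW.
have e3 := ler_wpM2l w0 (ler_wpM2r c0 (comp_coef a0 C0 haC)).
apply: le_trans (ler_wpM2l w0 hc) _; rewrite 2!mulrDr.
apply: lerD e2; apply: lerD e1; apply: le_trans e3 _.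
by rewrite mulrCA.
Qed.

Let lyap_b_closed_lin (x' x u1 u2 u3 u4 u5 u6 u7 u8 u9 : R) :
  x' <= x - 46 / 100 * u9 + 3 / 2 * u5 + u6 / 70 + u7 / 150 + 17 * u4 ->
  u6 <= 2 * u7 + 4 * u1 -> u7 <= u2 -> u1 <= u8 / (576 * 16) ->
  u2 <= 2 * u3 / (576 * 16) -> u8 <= u9 -> 0 <= u8 -> 0 <= u3 ->
  x' <= x - 45 / 100 * u9 + 3 / 2 * u5 + 17 * u4 + u3 / (100 * 1000).
Proof. by move=> *; lra. Qed.

(** Squared gradients are at most [2 L phi], and [e^2 L mu <= (e L)^2] is of the
    order of [d^2]: the gradient terms become a small multiple of [N d phi / mu]. *)
Fact lyap_b_closed (Lb Lb' b q U phi v e mu L N s z' d : R) :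
  0 < d -> d <= 1 / 16 -> 0 < N -> 0 < mu -> mu <= L -> 0 <= e ->
  b <= Lb -> 0 <= b -> 0 <= phi -> phi <= v ->
  e * L <= d / 24 ->
  U <= 2 * q + 4 * L ^+ 2 / N * b -> q <= 2 * L * phi ->
  Lb' <= (1 - 46 / 100 * d) * Lb + 3 / 2 * (e ^+ 2 * N * s)
    + e ^+ 2 * N * U / 70 + e ^+ 2 * N * q / 150 + 17 * (e ^+ 2 * z' / d ^+ 2) ->
  Lb' <= (1 - 45 / 100 * d) * Lb + 3 / 2 * N * s * e ^+ 2
    + 17 * (e ^+ 2 * z' / d ^+ 2) + N * d / (100 * 1000 * mu) * v.
Proof.
move=> d0 d1 N0 mu0 muL e0 bLb b0 phi0 phiv eL hU hq hLb.
have L0 : 0 < L by exact: lt_le_trans muL.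
have eL0 : 0 <= e * L by rewrite mulr_ge0 // ltW.
have X : (e * L) ^+ 2 <= d / (576 * 16).
  have h : (e * L) ^+ 2 <= (d / 24) ^+ 2.
    by rewrite ler_sqr ?nnegrE //; apply: le_trans eL.
  apply: le_trans h _; have := ler_wpM2l (ltW d0) d1.
  have -> : (d / 24) ^+ 2 = d * d / 576 by field.
  by move: (d * d) => y; lra.
have YN : 0 <= e ^+ 2 * N by rewrite mulr_ge0 ?sqr_ge0 // ltW.
have k1 := ler_wpM2l YN hU; have k2 := ler_wpM2l YN hq.
have e1 : e ^+ 2 * N * (2 * q + 4 * L ^+ 2 / N * b) =
    2 * (e ^+ 2 * N * q) + 4 * ((e * L) ^+ 2 * b) by field; rewrite gt_eqF.
rewrite e1 in k1.
have k3 := ler_wpM2r b0 X.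
have k4 : e ^+ 2 * N * (2 * L * phi) <= 2 * (N * d / mu * v) / (576 * 16).
  have -> : e ^+ 2 * N * (2 * L * phi) = 2 * (N * (e ^+ 2 * L * mu) / mu * phi).
    by field; rewrite gt_eqF.
  rewrite -[leRHS]mulrA ler_wpM2l //.
  have X' : e ^+ 2 * L * mu <= d / (576 * 16).
    by apply: le_trans X; rewrite exprMn -mulrA ler_wpM2l ?sqr_ge0 // expr2 ler_wpM2l // ltW.
  have -> : N * d / mu * v / (576 * 16) = N * (d / (576 * 16)) / mu * v by ring.
  apply: ler_pM => //.
    by rewrite divr_ge0 ?(ltW mu0) // !mulr_ge0 ?sqr_ge0 // ltW.
  by rewrite ler_wpM2r ?invr_ge0 ?(ltW mu0) // ler_wpM2l // ltW.
have k5 := ler_wpM2l (ltW d0) bLb.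
have db : 0 <= d * b by rewrite mulr_ge0 // ltW.
have e2 : N * d / (100 * 1000 * mu) * v = N * d / mu * v / (100 * 1000).
  by field; rewrite gt_eqF.
have NV : 0 <= N * d / mu * v.
  by rewrite mulr_ge0 ?(le_trans phi0 phiv) // divr_ge0 ?(ltW mu0) // mulr_ge0 // ltW.
rewrite e2; move: hLb k1 k2 k3 k4 k5 db NV; rewrite [3 / 2 * N * s * _]mulrC.
have -> : e ^+ 2 * (3 / 2 * N * s) = 3 / 2 * (e ^+ 2 * N * s) by ring.
move: ((e * L) ^+ 2 * b) (e ^+ 2 * N * (2 * L * phi)) (N * d / mu * v) => u1 u2 u3.
have -> : d / (576 * 16) * b = d * b / (576 * 16) by ring.
move: (e ^+ 2 * z' / _) (e ^+ 2 * N * s) (e ^+ 2 * N * U) (e ^+ 2 * N * q) => u4 u5 u6 u7.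
have -> : (1 - 46 / 100 * d) * Lb = Lb - 46 / 100 * (d * Lb) by ring.
have -> : (1 - 45 / 100 * d) * Lb = Lb - 45 / 100 * (d * Lb) by ring.
move: (d * b) (d * Lb) => u8 u9.
exact: lyap_b_closed_lin.
Qed.

End OneStep.

(** * Step sizes and the combined recursion *)

Section Stepsize.
Context {R : realType}.
Variables (th mu L m d : R).
Hypothesis th20 : 20 <= th.
Hypothesis mu0 : 0 < mu.
Hypothesis L0 : 0 < L.
Hypothesis m0 : 0 < m.
Hypothesis hm : th * L / mu <= d / 24 * m.

(** The lower bound on the offset [m] makes every step size at most [d / (24
    L)]. *)
Definition stepsize (k : nat) : R := th / (mu * (k%:R + m)).

Let th0 : 0 < th. Proof. by apply: lt_le_trans th20. Qed.
Let t0 (k : nat) : 0 < k%:R + m. Proof. by rewrite ltr_wpDl. Qed.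
Let d0 : 0 < d.
Proof.
have h : 0 < d / 24 * m by apply: lt_le_trans hm; rewrite divr_gt0 ?mulr_gt0.
by rewrite -(pmulr_lgt0 _ m0) -(@pmulr_lgt0 _ 24^-1) ?invr_gt0 ?ltr0n // mulrAC.
Qed.

Lemma stepsize_gt0 k : 0 < stepsize k.
Proof. by rewrite divr_gt0 // mulr_gt0. Qed.

Lemma stepsize_le k : stepsize k.+1 <= stepsize k.
Proof.
rewrite /stepsize ler_wpM2l ?(ltW th0) // lef_pV2 ?posrE ?mulr_gt0 //.
by rewrite ler_wpM2l ?(ltW mu0) // lerD2r ler_nat.
Qed.

Let hm_t k : th * L / mu <= d / 24 * (k%:R + m).
Proof.
by apply: le_trans hm _; rewrite ler_wpM2l ?divr_ge0 ?(ltW d0) // lerDr.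
Qed.

Lemma stepsize_L k : stepsize k * L <= d / 24.
Proof.
rewrite /stepsize; have -> : th / (mu * (k%:R + m)) * L = th * L / mu / (k%:R + m).
  by field; rewrite !gt_eqF.
by rewrite ler_pdivrMr.
Qed.

Lemma stepsize_sqr_L k : stepsize k ^+ 2 * L ^+ 2 <= d ^+ 2 / 576.
Proof.
have -> : d ^+ 2 / 576 = (d / 24) ^+ 2 by field.
rewrite -exprMn ler_sqr ?nnegrE; first exact: stepsize_L.
- by rewrite mulr_ge0 ?(ltW L0) // ltW // stepsize_gt0.
- by rewrite divr_ge0 // ltW.
Qed.

Lemma stepsize_sqr_le k : stepsize k.+1 ^+ 2 <= stepsize k ^+ 2.
Proof. by rewrite ler_sqr ?nnegrE ?stepsize_le // ltW // stepsize_gt0. Qed.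

Lemma stepsize_diff k :
  (stepsize k.+1 - stepsize k) ^+ 2 <= stepsize k ^+ 2 / (k%:R + m) ^+ 2.
Proof.
have tk := t0 k; have e1 : stepsize k.+1 - stepsize k = - (stepsize k / (k%:R + m + 1)).
  rewrite /stepsize -natr1 -addrA [1 + m]addrC addrA; field.
  by rewrite !gt_eqF // addr_gt0.
have s0 := ltW (stepsize_gt0 k).
have t1 : 0 < k%:R + m + 1 by rewrite addr_gt0.
rewrite e1 sqrrN -expr_div_n ler_sqr ?nnegrE ?(divr_ge0 s0 (ltW tk)) ?(divr_ge0 s0 (ltW t1)) //.
by rewrite (ler_wpM2l s0) // lef_pV2 ?posrE // lerDl.
Qed.

Lemma stepsize_kappa k : (L / mu) ^+ 2 / (k%:R + m) ^+ 2 <= d ^+ 2 / (576 * 400).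
Proof.
have -> : d ^+ 2 / (576 * 400) = (d / 24 / 20) ^+ 2 by field.
have k0 : 0 <= L / mu / (k%:R + m) by rewrite !divr_ge0 ?(ltW L0) ?(ltW mu0) ?(ltW (t0 k)).
have d20 : 0 <= d / 24 / 20 := divr_ge0 (divr_ge0 (ltW d0) (ler0n _ _)) (ler0n _ _).
rewrite -expr_div_n ler_sqr ?nnegrE //.
have h := hm_t k; rewrite ler_pdivrMr //.
apply: (@le_trans _ _ (th * L / mu / 20)).
  rewrite ler_pdivlMr // mulrC -mulrA ler_wpM2r //; exact: divr_ge0 (ltW L0) (ltW mu0).
by apply: le_trans (ler_wpM2r _ h) _; rewrite ?invr_ge0 // mulrAC.
Qed.

End Stepsize.

Section Assembly.
Context {R : realType}.
Variables (th mu L m N s z d a g C l : R).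
Variables (phi q U b c D : nat -> R).
Hypothesis th20 : 20 <= th.
Hypothesis mu0 : 0 < mu.
Hypothesis muL : mu <= L.
Hypothesis m0 : 0 < m.
Hypothesis hm : th * L / mu <= d / 24 * m.
Hypothesis N1 : 1 <= N.
Hypothesis s0 : 0 <= s.
Hypothesis z0 : 0 <= z.
Hypothesis d0 : 0 < d.
Hypothesis d1 : d <= 1 / 16.
Hypothesis a0 : 0 < a.
Hypothesis ad : 4 * d <= a.
Hypothesis C0 : 0 < C.
Hypothesis haC : a * (C + 1) <= 1 / 4.
Hypothesis g0 : 0 < g.
Hypothesis hg : g * (126 ^+ 2 * C) <= a ^+ 2 * l.
Hypothesis l0 : 0 < l.
Hypothesis l1 : l <= 1.
Hypothesis ed : d = g / 2 * l.
Let w := 8 * g * C / a.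
Let e := stepsize th mu m.
Hypothesis phi0 : forall k, 0 <= phi k.
Hypothesis q0 : forall k, 0 <= q k.
Hypothesis U0 : forall k, 0 <= U k.
Hypothesis b0 : forall k, 0 <= b k.
Hypothesis c0 : forall k, 0 <= c k.
Hypothesis D0 : forall k, 0 <= D k.
Hypothesis phi_step : forall k,
  phi k.+1 <= phi k - e k / 2 * q k - e k / 2 * U k + e k / 2 * (2 * L ^+ 2 / N * b k)
    + L * e k ^+ 2 / 2 * (U k + s / N).
Hypothesis D_le : forall k,
  D k <= 2 * e k.+1 ^+ 2 * (L ^+ 2 * (N * e k ^+ 2)) * (U k + s / N)
    + 2 * (e k.+1 - e k) ^+ 2 * (2 * N * (L / mu) ^+ 2 * q k + 2 * z).
Hypothesis q_step : forall k,
  q k.+1 <= 2 * q k + 2 * (L ^+ 2 * e k ^+ 2 * (U k + s / N)).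
Hypothesis b_step : forall k,
  b k.+1 <= (1 + d / 5) * ((1 + d / 4) * (1 - d)
      + (1 + (d / 4)^-1) * (e k ^+ 2 * (2 / 3 * (2 * L ^+ 2)))) * b k
    + 2 * (e k ^+ 2 * (2 / 3)) * (N * s)
    + (2 + (d / 5)^-1) * (2 / (3 * d)) * D k + 5 / 12 * g * (C * c k).
Hypothesis c_step : forall k,
  c k.+1 <= (1 + a) * ((1 - a) ^+ 2 + a ^+ 2 * C) * c k
    + (1 + a^-1) * (5 * ((4 * g + 2 * (e k.+1 ^+ 2 * L ^+ 2)) * b k.+1 + g * b k + D k
                         + N * e k.+1 ^+ 2 * q k.+1))
    + e k.+1 ^+ 2 * (N * s).
Hypothesis U_le : forall k, U k <= 2 * q k + 4 * L ^+ 2 / N * b k.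
Hypothesis q_le : forall k, q k <= 2 * L * phi k.
Hypothesis phi_le : forall k, 2 * mu * phi k <= q k.

Let N0 : 0 < N. Proof. exact: lt_le_trans ltr01 N1. Qed.
Let L0 : 0 < L. Proof. exact: lt_le_trans mu0 muL. Qed.
Let B k := b k + w * c k.
Let V k := phi k + 8 * L ^+ 2 / (N * d) * e k * B k.
Let w0 : 0 <= w.
Proof.
exact: divr_ge0 (mulr_ge0 (mulr_ge0 (ler0n _ _) (ltW g0)) (ltW C0)) (ltW a0).
Qed.
Let B0 k : 0 <= B k. Proof. exact: addr_ge0 (b0 k) (mulr_ge0 w0 (c0 k)). Qed.
Let e0 k : 0 <= e k. Proof. by apply/ltW/stepsize_gt0. Qed.
Let bB k : b k <= B k. Proof. by rewrite /B lerDl mulr_ge0. Qed.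

Let B_step k :
  B k.+1 <= (1 - 46 / 100 * d) * B k + 3 / 2 * (e k ^+ 2 * N * s)
    + e k ^+ 2 * N * U k / 70 + e k ^+ 2 * N * q k / 150
    + 17 * (e k ^+ 2 * (z / (k%:R + m) ^+ 2) / d ^+ 2).
Proof.
exact: (lyap_b_step d0 d1 ad a0 C0 haC g0 hg l0 l1 ed (erefl w) N1 s0 z0 (b0 k) (b0 k.+1)
  (c0 k) (D0 k) (q0 k) (U0 k) (stepsize_sqr_L th20 mu0 L0 m0 hm k)
  (stepsize_sqr_le th20 mu0 m0 k) (stepsize_diff th20 mu0 m0 k)
  (stepsize_kappa th20 mu0 L0 m0 hm k) (D_le k) (q_step k) (b_step k) (c_step k)).
Qed.

Let V_ge0 k : 0 <= V k.
Proof.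
apply: addr_ge0 (phi0 k) (mulr_ge0 (mulr_ge0 _ (e0 k)) (B0 k)).
exact: divr_ge0 (mulr_ge0 (ler0n _ _) (sqr_ge0 _)) (mulr_ge0 (ltW N0) (ltW d0)).
Qed.

Let V_bound k : phi k <= vbound th mu L m N s z d (V 0%N) (k%:R + m).
Proof.
have A0 : 0 <= 8 * L ^+ 2 / (N * d).
  exact: divr_ge0 (mulr_ge0 (ler0n _ _) (sqr_ge0 _)) (mulr_ge0 (ltW N0) (ltW d0)).
apply: (@le_trans _ _ (V k)); first by rewrite lerDl; exact: mulr_ge0 (mulr_ge0 A0 (e0 k)) (B0 k).
apply: (lyap_v_rate th20 mu0 muL N0 s0 z0 d0 d1 m0 hm (V_ge0 0%N)) => j /=.
rewrite -/(stepsize th mu m j) -/e.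
exact: (lyap_v_estimate d0 d1 N0 (U0 j) (q0 j) (B0 j.+1) (ltW L0) (bB j) (b0 j)
  (stepsize_gt0 th20 mu0 m0 j) (stepsize_le th20 mu0 m0 j)
  (stepsize_L th20 mu0 L0 m0 hm j) muL (phi_le j) (phi_step j) (B_step j)).
Qed.

(** First [phi] is bounded through the Lyapunov function [V], in which the
    consensus error has a weight of the order of the step size; the bound then
    makes the recursion of [B] autonomous. *)
Lemma rate_main (dist c5 c6 : R) (k : nat) (t := k%:R + m) : 0 <= c5 -> 0 <= c6 ->
  dist <= 2 / mu * phi k + 2 / N * b k ->
  dist <= (1 - d / 6) ^+ k * (2 / N * B 0%N)
    + 8 * L * th * s / (N * mu ^+ 3 * t)
    + 48 * th ^+ 2 * (14 * (L / mu) ^+ 2 + 3) * s / (mu ^+ 2 * d * t ^+ 2)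
    + 96 * th ^+ 2 * (32 * (L / mu) ^+ 2 + 9) * z / (N * mu ^+ 2 * d ^+ 3 * t ^+ 4)
    + 70 * (m `^ (th / 2)) / (mu * (t `^ (th / 2))) * V 0%N
    + c5 * th ^+ 3 * (L / mu) ^+ 2 * s / (N * mu ^+ 2 * d * t ^+ 3)
    + c6 * th ^+ 4 * (L / mu) ^+ 3 * s / (mu ^+ 2 * d ^+ 2 * t ^+ 4).
Proof.
move=> c50 c60 hdist.
apply: (rate_collect th20 mu0 muL N0 s0 z0 d0 m0 (V_ge0 0%N) c50 c60 hdist (V_bound k)).
apply: le_trans (_ : b k <= B k) _; first exact: bB.
apply: (lyap_b_rate th20 mu0 muL N0 s0 z0 d0 d1 m0 hm (V_ge0 0%N) (B0 0%N)) => j /=.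
rewrite -/(stepsize th mu m j) -/e.
exact: (lyap_b_closed d0 d1 N0 mu0 muL (e0 j) (bB j) (b0 j) (phi0 j) (V_bound j)
  (stepsize_L th20 mu0 L0 m0 hm j) (U_le j) (q_le j) (B_step j)).
Qed.

End Assembly.

(** * The convergence rate *)

(** The spectral gap is positive because [g] is positive and at most a
    positive multiple of it. The compression parameter [a] is at most [1 / 4],
    whence the numerical bounds. *)
Fact parameter_bounds {R : realType} (th mu L m a C g l2 : R) :
  20 <= th -> 0 < mu -> mu <= L ->
  48 * th * (L / mu) / (g * (1 - l2)) <= m ->
  0 < C -> 0 < a -> a <= 1 / (4 * (C + 1)) -> 0 < g ->
  g <= Num.min (1 / 2) (Num.min (a ^+ 2 * (1 - l2) / (126 ^+ 2 * C)) (a / 2)) ->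
  0 <= l2 ->
  let d := 1 - (1 - g / 2 * (1 - l2)) in
  [/\ l2 < 1, d = g / 2 * (1 - l2), 0 < d, d <= 1 / 16 & 4 * d <= a] /\
  [/\ a * (C + 1) <= 1 / 4, g <= 1 / 8, g * (126 ^+ 2 * C) <= a ^+ 2 * (1 - l2),
      0 < m & th * L / mu <= d / 24 * m].
Proof.
move=> th20 mu0 muL hm C0 a0 ha g0 hg l20.
have {hg} [h1 h2] : g <= a ^+ 2 * (1 - l2) / (126 ^+ 2 * C) /\ g <= a / 2.
  by move: hg; rewrite !le_min => /and3P[].
have c0 : 0 < (126 ^+ 2 * C : R) by rewrite mulr_gt0 ?exprn_gt0 ?ltr0n.
rewrite ler_pdivlMr // in h1.
have C1 : 0 < C + 1 by rewrite addr_gt0.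
have haC : a * (C + 1) <= 1 / 4.
  rewrite -ler_pdivlMr //; apply: le_trans ha _.
  by apply: le_of_eq; field; rewrite gt_eqF.
have a14 : a <= 1 / 4.
  by apply: le_trans haC; rewrite ler_peMr ?(ltW a0) // lerDr ltW.
have l1 : 0 < 1 - l2.
  have : 0 < a ^+ 2 * (1 - l2) by apply: lt_le_trans h1; rewrite mulr_gt0.
  by rewrite pmulr_rgt0 // exprn_gt0.
move=> d; have ed : d = g / 2 * (1 - l2) by rewrite /d; ring.
have dg : d <= g / 2 by rewrite ed ler_piMr ?divr_ge0 ?(ltW g0) //; lra.
have d0 : 0 < d by rewrite ed mulr_gt0 // divr_gt0.
have th0 : 0 < th by apply: lt_le_trans th20.
have L0 : 0 < L by exact: lt_le_trans muL.
have gl : 0 < g * (1 - l2) by rewrite mulr_gt0.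
have tLm : 0 < th * (L / mu) by rewrite mulr_gt0 ?divr_gt0.
split; split=> //; try by move: dg h2 a14; clear; lra.
- by move: l1; lra.
- apply: lt_le_trans hm; rewrite divr_gt0 // -mulrA; apply: mulr_gt0 tLm; exact: ltr0n.
- rewrite ler_pdivrMr // in hm; rewrite ed.
  have -> : th * L / mu = 48 * th * (L / mu) / 48 by field; rewrite gt_eqF.
  have -> : g / 2 * (1 - l2) / 24 * m = m * (g * (1 - l2)) / 48 by field.
  by rewrite ler_wpM2r // invr_ge0.
Qed.

(* 126 ^+ 2 = 15876 and 96 * 1008 = 96768 (the unary literals are too large) *)
Theorem theorem3 (R : realType) (n p : nat) (hn : (2 <= n)%N) (hp : (0 < p)%N)
  (* objective functions *)
  (f : 'I_n -> 'rV[R]_p -> R) (mu L : R) (xstar : 'rV[R]_p)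
  (hdiff : forall i x, differentiable (f i) x)
  (hmu : 0 < mu)
  (hconvex : strongly_convex mu (favg f))
  (hsmooth : forall i, lipschitz_grad L (f i))
  (hxstar : forall x, favg f xstar <= favg f x)
  (* network *)
  (e : rel 'I_n) (W : 'M[R]_n) (lambda : nat -> R)
  (hnet : network e W)
  (hlambda : ordered_spectrum W lambda)
  (* randomness *)
  (d dS dZ : measure_display) (T : measurableType d)
  (Xi : measurableType dS) (Z : measurableType dZ) (P : probability T R)
  (xi : int -> 'I_n -> {RV P >-> Xi}) (zeta : nat -> 'I_n -> {RV P >-> Z})
  (* algorithm *)
  (eta : int -> R) (theta m alpha gamma C sigma : R)
  (g : 'I_n -> 'rV[R]_p -> Xi -> 'rV[R]_p) (cmp : 'rV[R]_p -> Z -> 'rV[R]_p)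
  (x_init H_init : 'M[R]_(n, p))
  (x G : int -> T -> 'M[R]_(n, p)) (y Q D H : nat -> T -> 'M[R]_(n, p))
  (hcedas : cedas W eta alpha gamma g cmp x_init H_init xi zeta x G y Q D H)
  (heta : forall k : int, -1 <= k -> eta k = theta / (mu * (k%:~R + m)))
  (hsigma : 0 < sigma)
  (hgrad : stochastic_gradient P sigma f g xi zeta x G)
  (hC : 0 < C)
  (hcmp : unbiased_compressor P C cmp xi zeta y Q H)
  (* parameters *)
  (htheta : 20 <= theta)
  (hm : 48 * theta * (L / mu) / (gamma * (1 - lambda 2%N)) <= m)
  (halpha0 : 0 < alpha) (halpha : alpha <= 1 / (4 * (C + 1)))
  (hgamma0 : 0 < gamma)
  (hgamma : gamma <= Num.min (1 / 2)
      (Num.min (alpha ^+ 2 * (1 - lambda 2%N) / (126 ^+ 2 * C)) (alpha / 2)))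
  (* spectral decompositions entering the Lyapunov functions *)
  (Q1 : 'M[R]_(n, n.-1)) (hQ1 : eigenbasis W lambda Q1)
  (J P1 : 'M[R]_(n.-1 + n.-1)) (hJ : decomposition gamma lambda J P1) :
  let kappa := L / mu in
  let lt2 := lambdat gamma lambda 2%N in
  let Lv0 := fun w => lyap_v f L C alpha gamma lambda Q1 J (eta 0)
                        (x 0 w) (y 0%N w) (D 0%N w) (H 0%N w) in
  let Lb0 := fun w => lyap_b f C alpha gamma lambda Q1 J (eta 0)
                        (x 0 w) (y 0%N w) (D 0%N w) (H 0%N w) in
  forall k : nat,
  ((n%:R^-1)%:E *
     \sum_(i < n) 'E_P[fun w => (fnorm (row i (x k w) - xstar) ^+ 2)%R]
   <=
   ((1 - (1 - lt2) / 6) ^+ k)%:E * ((2 / n%:R)%:E * 'E_P[Lb0])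
   + (8 * L * theta * sigma ^+ 2 / (n%:R * mu ^+ 3 * (k%:R + m)))%:E
   + (48 * theta ^+ 2 * (14 * kappa ^+ 2 + 3) * sigma ^+ 2
        / (mu ^+ 2 * (1 - lt2) * (k%:R + m) ^+ 2))%:E
   + (96 * theta ^+ 2 * (32 * kappa ^+ 2 + 9)
        * (\sum_(i < n) fnorm (grad (f i) xstar) ^+ 2)
        / (n%:R * mu ^+ 2 * (1 - lt2) ^+ 3 * (k%:R + m) ^+ 4))%:E
   + (70 * (m `^ (theta / 2)) / (mu * ((k%:R + m) `^ (theta / 2))))%:E
       * 'E_P[Lv0]
   + (456 * theta ^+ 3 * kappa ^+ 2 * sigma ^+ 2
        / (n%:R * mu ^+ 2 * (1 - lt2) * (k%:R + m) ^+ 3))%:E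
   + ((96 * 1008) * theta ^+ 4 * kappa ^+ 3 * sigma ^+ 2
        / (mu ^+ 2 * (1 - lt2) ^+ 2 * (k%:R + m) ^+ 4))%:E)%E.
Proof.
move=> kappa lt2 Lv0 Lb0 k.
have n0 : (0 < n)%N by exact: ltnW.
have N1 : 1 <= n%:R :> R by rewrite ler1n.
have muL := mu_le_L n0 hp hdiff hmu hconvex hsmooth.
have L0 : 0 < L := lt_le_trans hmu muL.
have l_ge0 (i : 'I_n.-1) : 0 <= lambda i.+2 := eigenvalue_ge0 hQ1 i (net_Wpsd hnet).
have n1 : (0 < n.-1)%N by rewrite -subn1 subn_gt0.
have l2_ge0 : 0 <= lambda 2%N := l_ge0 (Ordinal n1).
have l_le2 (i : 'I_n.-1) : lambda i.+2 <= lambda 2%N.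
  by apply: hlambda.2 => //; move: (ltn_ord i); rewrite -ltnS prednK.
have [[l2_lt1 ed d0 d1 ad] [haC g8 hg m0 hm']] :=
  parameter_bounds htheta hmu muL hm hC halpha0 halpha hgamma0 hgamma l2_ge0.
have hxi i j : measurable_fun setT (xi i j) by exact: measurable_funPT.
have hzeta i j : measurable_fun setT (zeta i j) by exact: measurable_funPT.
have he j : eta (Posz j) = stepsize theta mu m j by rewrite heta // -pmulrn.
have Ws := net_Wsym hnet; have W1 := net_Wones hnet.
have iD := integ_dist (xstar := xstar) hsmooth hxi hzeta hcedas hgrad hcmp k.
have iG := integ_gap hdiff hmu hconvex hsmooth hxstar hxi hzeta hcedas hgrad hcmp 0.
have iB := integ_cons (lambda := lambda) (Q1 := Q1) (J := J)
  hsmooth hxi hzeta hcedas hgrad hcmp 0.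
have iC := integ_comp hsmooth hxi hzeta hcedas hgrad hcmp 0.
pose w := 8 * gamma * C / alpha.
pose B0 : R := @consensus_err _ _ _ _ _ P lambda Q1 J f eta gamma x D 0%N
  + w * @compress_err _ _ _ _ _ P y H 0%N.
pose V0 : R := @gap _ _ _ _ _ P f xstar x 0%N
  + 8 * L ^+ 2 / (n%:R * (1 - lt2)) * stepsize theta mu m 0 * B0.
have eD i : ('E_P[fun w => (fnorm (row i (x k w) - xstar) ^+ 2)%R]
    = (Ex P (fun w => sqn (row i (x k w) - xstar)))%:E)%E.
  rewrite -(ExpE (iD i)); congr ('E_P[_])%E; apply: funext => v.
  exact: sqn_fnorm.
have iBC := integD iB (integZ w iC).
have eB : ('E_P[Lb0] = B0%:E)%E.
  have -> : B0 = Ex P Lb0.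
    rewrite /B0 /consensus_err /compress_err -ExZ // -ExD //; last exact: integZ.
    by apply: eq_Ex => v; rewrite /Lb0 /lyap_b !sqn_fnorm.
  apply: ExpE; apply: eq_integ iBC => v.
  by rewrite /Lb0 /lyap_b !sqn_fnorm.
have an : alpha != 0 by rewrite gt_eqF.
have nn : n%:R != 0 :> R by rewrite gt_eqF // (lt_le_trans ltr01).
have ln : 1 - lt2 != 0 by rewrite gt_eqF.
pose A := 8 * L ^+ 2 / (n%:R * (1 - lt2)) * stepsize theta mu m 0.
(* The two weights of [lyap_v] are [A] times those of [lyap_b]. *)
have Lv0E v : Lv0 v = favg f (rowmean (x 0 v)) - favg f xstar + A * Lb0 v.
  rewrite /Lv0 /lyap_v /Lb0 /lyap_b (inf_favg hxstar) he /A -/lt2.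
  set u := fnorm _ ^+ 2; set v' := fnorm _ ^+ 2.
  rewrite -addrA; congr (_ + _); field; by rewrite an nn ln.
have iLb : integ P Lb0.
  by apply: eq_integ iBC => v; rewrite /Lb0 /lyap_b !sqn_fnorm.
have eV : ('E_P[Lv0] = V0%:E)%E.
  have -> : V0 = Ex P Lv0.
    rewrite /V0 (eq_Ex _ Lv0E) ExD ?ExZ //; last exact: integZ.
    by rewrite /gap; congr (_ + _ * _); apply/EFin_inj; rewrite -eB ExpE.
  by apply: ExpE; apply: eq_integ (integD iG (integZ A iLb)) => v; rewrite Lv0E.
under eq_bigr do rewrite eD.
rewrite sumEFin eB eV -!EFinM -!EFinD lee_fin.
have -> : \sum_(i < n) fnorm (grad (f i) xstar) ^+ 2 = @hetero _ _ _ f xstar.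
  by apply: eq_bigr => i _; exact: sqn_fnorm.
have sg0 : 0 <= sigma ^+ 2 := sqr_ge0 sigma.
have e_ge0 j : 0 <= eta (Posz j).
  by rewrite he ltW // stepsize_gt0.
have c5 : 0 <= 456 :> R := ler0n _ _.
have c6 : 0 <= 96 * 1008 :> R := mulr_ge0 (ler0n _ _) (ler0n _ _).
have gs j := gap_step hn hp hdiff hmu hconvex hsmooth hxstar Ws W1 hQ1 hJ hxi hzeta
  hcedas hgrad hcmp (e_ge0 j) (ltW L0).
have ds j := drift_step hn hp hdiff hmu hconvex hsmooth hxstar Ws W1 hxi hzeta hcedas
  hgrad hcmp j.
have qs j := sqgrad_step hn hsmooth Ws W1 hxi hzeta hcedas hgrad hcmp j.
have b5 : 0 < (1 - lt2) / 5 by rewrite divr_gt0.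
have b4 : 0 < (1 - lt2) / 4 by rewrite divr_gt0.
have bs j := cons_step hn hsmooth Ws W1 hQ1 hJ l_ge0 l_le2 l2_lt1 hgamma0 g8 hxi hzeta
  hcedas hgrad hcmp j b5 b4 (ltW hC).
have cs j := comp_step hn hsmooth Ws W1 hQ1 hJ l_ge0 l_le2 l2_lt1 hgamma0 halpha0 hxi
  hzeta hcedas hgrad hcmp j.
have ul j := sqmean_le hn hsmooth hQ1 hJ hxi hzeta hcedas hgrad hcmp j.
have ql j := sqgrad_le_gap hn hp hdiff hmu hconvex hsmooth hxstar hxi hzeta hcedas hgrad
  hcmp j.
have pl j := gap_le_sqgrad hdiff hmu hconvex hsmooth hxstar hxi hzeta hcedas hgrad hcmp j.
have hd := dist_le hn hp hdiff hmu hconvex hsmooth hxstar hQ1 hJ hxi hzeta hcedas hgrad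
  hcmp k.
have l1 : 0 < 1 - lambda 2%N by rewrite subr_gt0.
have l11 : 1 - lambda 2%N <= 1 by rewrite gerBl.
have D0 j : 0 <= @drift _ _ _ _ _ P f eta x j by apply: Ex_ge0 => v; exact: sqn_ge0.
do [setoid_rewrite he] in gs ds qs bs cs.
exact: (rate_main htheta hmu muL m0 hm' N1 sg0 (@hetero_ge0 _ _ _ f xstar) d0 d1 halpha0 ad hC haC hgamma0
  hg l1 l11 ed (gap_ge0 P hxstar) (sqgrad_ge0 P) (sqmean_ge0 P) (cons_ge0 P) (comp_ge0 P) D0
  gs ds qs bs cs ul ql pl c5 c6 hd).
Qed.
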